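(* Let $n\ge 1$ and $0\le k\le n$. The sequence $$0\rightarrow \mathcal{H}(\mathbb{R}^n,\Lambda^k)\rightarrow \mathcal{S}'(\mathbb{R}^n,\Lambda^k)\overset{\Delta}{\rightarrow}\mathcal{S}'(\mathbb{R}^n,\Lambda^k)\rightarrow 0$$ is exact, where the first map is the inclusion and $\mathcal{H}(\mathbb{R}^n,\Lambda^k)$ is the space of differential forms of degree $k$ on $\mathbb{R}^n$ whose coefficients are harmonic polynomials.
   Context: $\Lambda^k=\Lambda^k(\mathbb{R}^{n*})$ is the space of alternating $k$-forms on $\mathbb{R}^n$, and $\mathcal{S}(\mathbb{R}^n,\Lambda^k)$ is the space of degree $k$ differential forms with (complex) coefficients in the Schwartz space $\mathcal{S}(\mathbb{R}^n)$. $\mathcal{S}'(\mathbb{R}^n,\Lambda^k)$ is the space of temperate currents of degree $k$: continuous linear forms on $\mathcal{S}(\mathbb{R}^n,\Lambda^k)$, equivalently $k$-forms $\sum_{i_1<\dots<i_k} a_{i_1\cdots i_k}\,dx_{i_1}\wedge\cdots\wedge dx_{i_k}$ whose coefficients are tempered distributions. The Laplacian acts coefficientwise: $\Delta=-\sum_{\mu=1}^n\partial_\mu^2$. Polynomials have complex coefficients. *)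

(* Defs.v *)
From HB Require Import structures.
From mathcomp Require Import all_boot all_order all_algebra.
From mathcomp Require Import all_classical all_reals all_analysis.
From mathcomp Require Import complex.
From mathcomp Require mpoly.
(* The notations of mpoly are incompatible with those of all_analysis. *)
Import (canonicals) mpoly.

Set Implicit Arguments.
Unset Strict Implicit.
Unset Printing Implicit Defensive.

Import Order.TTheory GRing.Theory Num.Theory.
Import numFieldNormedType.Exports.

Local Open Scope classical_set_scope.
Local Open Scope ring_scope.
Local Open Scope complex_scope.

Section AlternatingForms.
Variables (R : realType) (n k : nat).

(* Forms are complex-valued, and linear over R in each of their k arguments,
   which are the rows of a k x n matrix. *)
Definition multilinear (w : 'M[R]_(k, n) -> R[i]) : Prop :=
  forall (A B C : 'M[R]_(k, n)) (i : 'I_k) (b c : R),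
    row i A = b *: row i B + c *: row i C ->
    row' i B = row' i A -> row' i C = row' i A ->
    w A = b%:C * w B + c%:C * w C.

Definition alternate (w : 'M[R]_(k, n) -> R[i]) : Prop :=
  forall (A : 'M[R]_(k, n)) (i1 i2 : 'I_k),
    i1 != i2 -> row i1 A = row i2 A -> w A = 0.

Definition alternating_form : {pred 'M[R]_(k, n) -> R[i]} :=
  fun w => `[< multilinear w /\ alternate w >].

Fact alternating_form_submod : submod_closed alternating_form.
Proof.
split.
  apply/asboolP; split=> [A B C i b c _ _ _|//].
  by rewrite /= !mulr0 addr0.
move=> a u v /asboolP[mu au] /asboolP[mv av]; apply/asboolP; split.
  move=> A B C i b c eA eB eC.
  rewrite /= !fctE (mu _ _ _ _ _ _ eA eB eC) (mv _ _ _ _ _ _ eA eB eC).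
  by rewrite /GRing.scale/= !mulrDr !(mulrCA a) !addrA; congr (_ + _); rewrite addrAC.
move=> A i1 i2 ni e.
by rewrite !fctE (au _ _ _ ni e) (av _ _ _ ni e) scaler0 addr0.
Qed.

HB.instance Definition _ :=
  GRing.isSubmodClosed.Build R[i] ('M[R]_(k, n) -> R[i]) alternating_form
    alternating_form_submod.

Record altform := Altform {
  altform_fun :> 'M[R]_(k, n) -> R[i];
  altform_subproof : altform_fun \in alternating_form }.

HB.instance Definition _ := gen_eqMixin altform.
HB.instance Definition _ := gen_choiceMixin altform.

Lemma altform_inj : injective altform_fun.
Proof. by move=> [f fP] [g gP] /= e; subst g; congr Altform; exact: Prop_irrelevance. Qed.

Definition altform_zero : altform := Altform (rpred0 alternating_form).
Definition altform_add (u v : altform) : altform :=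
  Altform (rpredD (altform_subproof u) (altform_subproof v)).
Definition altform_opp (u : altform) : altform :=
  Altform (rpredNr (altform_subproof u)).
Definition altform_scale (a : R[i]) (u : altform) : altform :=
  Altform (rpredZ a (altform_subproof u)).

Fact altform_addA : associative altform_add.
Proof. by move=> u v w; apply: altform_inj; exact: addrA. Qed.
Fact altform_addC : commutative altform_add.
Proof. by move=> u v; apply: altform_inj; exact: addrC. Qed.
Fact altform_add0 : left_id altform_zero altform_add.
Proof. by move=> u; apply: altform_inj; exact: add0r. Qed.
Fact altform_addN : left_inverse altform_zero altform_opp altform_add.
Proof. by move=> u; apply: altform_inj; exact: addNr. Qed.

HB.instance Definition _ := GRing.isZmodule.Build altform
  altform_addA altform_addC altform_add0 altform_addN.

Fact altform_scaleA a b u :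
  altform_scale a (altform_scale b u) = altform_scale (a * b) u.
Proof. by apply: altform_inj; exact: scalerA. Qed.
Fact altform_scale1 : left_id 1 altform_scale.
Proof. by move=> u; apply: altform_inj; exact: scale1r. Qed.
Fact altform_scaleDr : right_distributive altform_scale +%R.
Proof. by move=> a u v; apply: altform_inj; exact: scalerDr. Qed.
Fact altform_scaleDl u : {morph altform_scale^~ u : a b / a + b}.
Proof. by move=> a b; apply: altform_inj; exact: scalerDl. Qed.

HB.instance Definition _ := GRing.Zmodule_isLmodule.Build R[i] altform
  altform_scaleA altform_scale1 altform_scaleDr altform_scaleDl.

Lemma altform_lin (a : R[i]) (u v : altform) :
  altform_fun (a *: u + v) = a *: altform_fun u + altform_fun v.
Proof. by []. Qed.

Lemma altform_sumE (I : Type) (r : seq I) (P : pred I) (c : I -> R[i])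
    (u : I -> altform) (A : 'M[R]_(k, n)) :
  (\sum_(i <- r | P i) c i *: u i) A = \sum_(i <- r | P i) c i * u i A.
Proof. by elim/big_rec2 : _ => [//|i f w _ <-]. Qed.

End AlternatingForms.

Section ComplexFunctions.
Variables (R : realType) (n : nat).
Local Notation E := 'rV[R]_n.

Definition re_fun (f : E -> R[i]) : E -> R := fun x => complex.Re (f x).
Definition im_fun (f : E -> R[i]) : E -> R := fun x => complex.Im (f x).

Definition cdifferentiable (f : E -> R[i]) (x : E) : Prop :=
  differentiable (re_fun f) x /\ differentiable (im_fun f) x.

Definition partial (i : 'I_n) (f : E -> R[i]) : E -> R[i] := fun x =>
  'D_(delta_mx 0 i) (re_fun f) x +i* 'D_(delta_mx 0 i) (im_fun f) x.

(* A sequence of indices stands for the multi-index that counts them, with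
   the size of the sequence as the order of the multi-index. *)
Definition partials (b : seq 'I_n) (f : E -> R[i]) : E -> R[i] :=
  foldr partial f b.

Definition monomial (a : seq 'I_n) (x : E) : R := \prod_(i <- a) x 0 i.

Definition laplacian (f : E -> R[i]) : E -> R[i] :=
  - \sum_(mu < n) partial mu (partial mu f).

Definition smooth (f : E -> R[i]) : Prop :=
  forall (b : seq 'I_n) (x : E), cdifferentiable (partials b f) x.

Definition rapidly_decreasing (f : E -> R[i]) : Prop :=
  forall a b : seq 'I_n, exists M : R,
    forall x : E, `|(monomial a x)%:C * partials b f x| <= M%:C.

Definition schwartz : {pred E -> R[i]} :=
  fun f => `[< smooth f /\ rapidly_decreasing f >].

Lemma re_fun_lin (c : R[i]) f g : re_fun (c *: f + g) =
  complex.Re c *: re_fun f + (- complex.Im c *: im_fun f + re_fun g).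
Proof.
apply/funext => x; rewrite /re_fun /im_fun !fctE.
case: c (f x) (g x) => [a b] [u v] [s t] /=.
by rewrite addrA /GRing.scale/= mulNr.
Qed.

Lemma im_fun_lin (c : R[i]) f g : im_fun (c *: f + g) =
  complex.Re c *: im_fun f + (complex.Im c *: re_fun f + im_fun g).
Proof.
apply/funext => x; rewrite /re_fun /im_fun !fctE.
by case: c (f x) (g x) => [a b] [u v] [s t] /=; rewrite addrA.
Qed.

Lemma derive_lin (a : R) (f g : E -> R) (x v : E) :
  differentiable f x -> differentiable g x ->
  'D_v (a *: f + g) x = a * 'D_v f x + 'D_v g x.
Proof.
move=> df dg; have /diff_derivable daf := differentiableZ a df.
rewrite (deriveD (daf v) (diff_derivable dg)); congr (_ + _).
exact: (deriveZ a (diff_derivable df)).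
Qed.

Lemma differentiable_lin (a : R) (f g : E -> R) (x : E) :
  differentiable f x -> differentiable g x -> differentiable (a *: f + g) x.
Proof. by move=> df dg; exact: differentiableD (differentiableZ a df) dg. Qed.

Lemma cdifferentiable_lin (c : R[i]) f g x :
  cdifferentiable f x -> cdifferentiable g x -> cdifferentiable (c *: f + g) x.
Proof.
move=> [rf jf] [rg jg]; rewrite /cdifferentiable re_fun_lin im_fun_lin.
by split; do 2!apply: differentiable_lin => //.
Qed.

Lemma partial_lin (c : R[i]) f g i x :
  cdifferentiable f x -> cdifferentiable g x ->
  partial i (c *: f + g) x = c * partial i f x + partial i g x.
Proof.
move=> [rf jf] [rg jg]; rewrite /partial re_fun_lin im_fun_lin.
rewrite (derive_lin _ _ rf (differentiable_lin _ jf rg)) (derive_lin _ _ jf rg).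
rewrite (derive_lin _ _ jf (differentiable_lin _ rf jg)) (derive_lin _ _ rf jg).
by case: c => a b; rewrite !addrA mulNr.
Qed.

Lemma partials_lin (c : R[i]) b f g : smooth f -> smooth g ->
  partials b (c *: f + g) = c *: partials b f + partials b g.
Proof.
move=> sf sg; elim: b => //= i b ->; apply/funext => x.
by rewrite partial_lin.
Qed.

Lemma smooth_lin (c : R[i]) f g : smooth f -> smooth g -> smooth (c *: f + g).
Proof. by move=> sf sg b x; rewrite partials_lin//; exact: cdifferentiable_lin. Qed.

Lemma partials0 b : partials b 0 = 0.
Proof.
elim: b => //= i b ->; apply/funext => x; rewrite /partial.
by rewrite (_ : re_fun 0 = cst 0)// (_ : im_fun 0 = cst 0)// !derive_cst.
Qed.

Lemma smooth0 : smooth 0.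
Proof.
move=> b x; rewrite partials0; split; exact: differentiable_cst.
Qed.

Lemma smooth_partial i f : smooth f -> smooth (partial i f).
Proof. by move=> sf b x; have := sf (rcons b i) x; rewrite /partials foldr_rcons. Qed.

Fact schwartz_submod : submod_closed schwartz.
Proof.
split.
  apply/asboolP; split; first exact: smooth0.
  by move=> a b; exists 0 => x; rewrite partials0 /= mulr0 normr0.
move=> c f g /asboolP[sf df] /asboolP[sg dg]; apply/asboolP.
split; first exact: smooth_lin.
move=> a b; have [M fM] := df a b; have [N gN] := dg a b.
exists (complex.Re `|c| * M + N) => x; rewrite partials_lin// !fctE.
rewrite mulrDr (le_trans (ler_normD _ _))// rmorphD rmorphM/=.
rewrite lerD// mulrCA normrM.
have -> : (complex.Re `|c|)%:C = `|c| by rewrite RRe_real// normr_real.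
by rewrite ler_wpM2l.
Qed.

HB.instance Definition _ :=
  GRing.isSubmodClosed.Build R[i] (E -> R[i]) schwartz schwartz_submod.

Lemma schwartz_smooth f : f \in schwartz -> smooth f.
Proof. by move=> /asboolP[]. Qed.

Lemma schwartz_partial i f : f \in schwartz -> partial i f \in schwartz.
Proof.
move=> /asboolP[sf df]; apply/asboolP; split; first exact: smooth_partial.
move=> a b; have [M fM] := df a (rcons b i); exists M => x.
by have := fM x; rewrite /partials foldr_rcons.
Qed.

Lemma schwartz_laplacian f : f \in schwartz -> laplacian f \in schwartz.
Proof.
move=> Sf; rewrite rpredN rpred_sum// => i _.
by do 2!apply: schwartz_partial.
Qed.

Lemma smooth_sum (I : Type) (r : seq I) (F : I -> E -> R[i]) :
  (forall i, smooth (F i)) -> smooth (\sum_(i <- r) F i).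
Proof.
move=> sF; elim/big_rec : _ => [|i g _ sg]; first exact: smooth0.
by rewrite -[F i]scale1r; exact: smooth_lin.
Qed.

Lemma partials_sum (I : Type) (r : seq I) (F : I -> E -> R[i]) b :
  (forall i, smooth (F i)) ->
  partials b (\sum_(i <- r) F i) = \sum_(i <- r) partials b (F i).
Proof.
move=> sF; elim: r => [|i r IH]; first by rewrite !big_nil partials0.
rewrite !big_cons -IH -[F i]scale1r partials_lin//; last exact: smooth_sum.
by rewrite !scale1r.
Qed.

Lemma partials_laplacian b f : smooth f ->
  partials b (laplacian f) = - \sum_(mu < n) partials (b ++ [:: mu; mu]) f.
Proof.
move=> sf; have s2 mu : smooth (partial mu (partial mu f)).
  by do 2!apply: smooth_partial.
rewrite /laplacian -[- _]addr0 -scaleN1r partials_lin; last exact: smooth0.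
  rewrite partials0 addr0 scaleN1r partials_sum//.
  by congr (- _); apply: eq_bigr => i _; rewrite /partials foldr_cat.
exact: smooth_sum.
Qed.

Lemma laplacian_lin (c : R[i]) f g : smooth f -> smooth g ->
  laplacian (c *: f + g) = c *: laplacian f + laplacian g.
Proof.
move=> sf sg; have := @partials_laplacian [::].
rewrite /= => L; rewrite !L//; last exact: smooth_lin.
rewrite scalerN -opprD scaler_sumr -big_split/=; congr (- _).
by apply: eq_bigr => i _; exact: (partials_lin c [:: i; i]).
Qed.

End ComplexFunctions.

Section LebesgueMeasure.
Variable R : realType.
Local Notation mR := (measurableTypeR R).

Definition tcons n (p : mR * n.-tuple mR) : n.+1.-tuple mR :=
  [tuple of p.1 :: p.2].

Fact measurable_tcons n : measurable_fun [set: mR * n.-tuple mR] (@tcons n).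
Proof. exact: measurable_cons measurable_fst measurable_snd. Qed.

HB.instance Definition _ n :=
  isMeasurableFun.Build _ _ _ _ (@tcons n) (@measurable_tcons n).

Section Step.
Variables (n : nat) (mu : {measure set (n.-tuple mR) -> \bar R}).

Definition lebesgue_step : set (n.+1.-tuple mR) -> \bar R :=
  pushforward (@lebesgue_measure R \x^ mu)%E (@tcons n).

Let lebesgue_step0 : lebesgue_step set0 = 0%E.
Proof. exact: measure0. Qed.

Let lebesgue_step_ge0 A : (0 <= lebesgue_step A)%E.
Proof. exact: measure_ge0. Qed.

Let lebesgue_step_sigma_additive : semi_sigma_additive lebesgue_step.
Proof. exact: measure_semi_sigma_additive. Qed.

HB.instance Definition _ := isMeasure.Build _ _ _ lebesgue_step
  lebesgue_step0 lebesgue_step_ge0 lebesgue_step_sigma_additive.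
End Step.

(* The n-fold product of the Lebesgue measure of R; the measurable structure
   of R^n is only available on tuples. *)
Fixpoint lebesgue_tuple (n : nat) : {measure set (n.-tuple mR) -> \bar R} :=
  match n with
  | 0 => dirac [tuple]
  | m.+1 => lebesgue_step (lebesgue_tuple m)
  end.

Definition cintegral n (f : 'rV[R]_n -> R[i]) : R[i] :=
  let row (t : n.-tuple mR) : 'rV[R]_n := \row_i tnth t i in
  Rintegral (lebesgue_tuple n) setT (fun t => complex.Re (f (row t))) +i*
  Rintegral (lebesgue_tuple n) setT (fun t => complex.Im (f (row t))).
End LebesgueMeasure.

Section SchwartzForms.
Variables (R : realType) (n k : nat).
Local Notation E := 'rV[R]_n.
Local Notation form := (E -> altform R n k).
Implicit Types (I J : k.-tuple 'I_n) (w : form).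

Definition increasing I : bool := sorted ltn (map val I).

Definition frame I : 'M[R]_(k, n) := rowsub (tnth I) 1%:M.

Definition coef w I : E -> R[i] := fun x => w x (frame I).

Definition dx_fun I : 'M[R]_(k, n) -> R[i] :=
  fun A => (\det (colsub (tnth I) A))%:C.

Fact dx_subproof I : dx_fun I \in @alternating_form R n k.
Proof.
apply/asboolP; split=> [A B C i b c eA eB eC|A i1 i2 ni e]; rewrite /dx_fun.
  rewrite -!rmorphM -rmorphD; congr (_%:C).
  apply: (determinant_multilinear (i0 := i)); apply/matrixP => x y.
  - by have /rowP/(_ (tnth I y)) := eA; rewrite !mxE.
  - by have /matrixP/(_ x (tnth I y)) := eB; rewrite !mxE.
  - by have /matrixP/(_ x (tnth I y)) := eC; rewrite !mxE.
rewrite (determinant_alternate ni)// => y.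
by have /rowP/(_ (tnth I y)) := e; rewrite !mxE.
Qed.

(* dx_{i_1} /\ ... /\ dx_{i_k} *)
Definition dx I : altform R n k := Altform (dx_subproof I).

Lemma increasing_uniq I : increasing I -> uniq I.
Proof.
move=> sI; rewrite -(map_inj_uniq val_inj).
exact: (sorted_uniq ltn_trans ltnn).
Qed.

Lemma dx_frame I J : increasing I -> increasing J ->
  dx I (frame J) = (I == J)%:R.
Proof.
move=> iI iJ; rewrite /= /dx_fun.
have -> : colsub (tnth I) (frame J) = \matrix_(a, b) (tnth J a == tnth I b)%:R.
  by apply/matrixP => a b; rewrite !mxE.
have [<-|neIJ] := eqVneq I J.
  rewrite (_ : \matrix_(a, b) _ = 1%:M) ?det1//.
  apply/matrixP => a b; rewrite !mxE; congr (_%:R).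
  by rewrite -(inj_eq (tuple_uniqP _ (increasing_uniq iI))).
have [a aI] : exists a, tnth J a \notin I.
  apply/existsP; rewrite -[X in is_true X]negbK negb_exists; apply/negP.
  move=> /forallP sJI; case/negP: neIJ; apply/eqP/val_inj => /=.
  apply: (inj_map val_inj); apply: (irr_sorted_eq ltn_trans ltnn iI iJ) => x.
  have sub : {subset J <= I}.
    by move=> y /tnthP[a ->]; have := sJI a; rewrite negbK.
  have [_ eqIJ] := uniq_min_size (increasing_uniq iJ) sub
    (eq_leq (etrans (size_tuple I) (esym (size_tuple J)))).
  by apply/mapP/mapP => -[y yI ->]; exists y => //; rewrite ?eqIJ// -eqIJ.
rewrite (expand_det_row _ a) big1// => b _; rewrite !mxE.
case: eqP => [e|_]; last by rewrite mul0r.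
by rewrite e mem_tnth in aI.
Qed.

Definition form_laplacian w : form := fun x =>
  \sum_(I : k.-tuple 'I_n | increasing I) laplacian (coef w I) x *: dx I.

Definition schwartz_forms : {pred form} :=
  fun w => `[< forall I, increasing I -> coef w I \in @schwartz R n >].

Lemma coef_lin (a : R[i]) w w' I :
  coef (a *: w + w') I = a *: coef w I + coef w' I.
Proof.
by apply/funext => x; rewrite /coef [(_ + _) x]/(_ + _) altform_lin.
Qed.

Lemma coef0 I : coef 0 I = 0.
Proof. by []. Qed.

Lemma coef_laplacian w I : increasing I ->
  coef (form_laplacian w) I = laplacian (coef w I).
Proof.
move=> iI; apply/funext => x.
transitivity (\sum_(J : k.-tuple 'I_n | increasing J)
    laplacian (coef w J) x * dx J (frame I)); first exact: altform_sumE.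
rewrite (bigD1 I iI) big1 => [|J /andP[iJ nJ]].
  by rewrite (dx_frame iI iI) eqxx mulr1 /= addr0.
by rewrite (dx_frame iJ iI) (negbTE nJ) mulr0.
Qed.

Fact schwartz_forms_submod : submod_closed schwartz_forms.
Proof.
split; first by apply/asboolP => I _; rewrite coef0 rpred0.
move=> a u v /asboolP Su /asboolP Sv; apply/asboolP => I iI.
by rewrite coef_lin rpredD ?rpredZ ?Su ?Sv.
Qed.

HB.instance Definition _ :=
  GRing.isSubmodClosed.Build R[i] form schwartz_forms schwartz_forms_submod.

Record schwartz_form := SchwartzForm {
  schwartz_form_fun :> form;
  schwartz_form_subproof : schwartz_form_fun \in schwartz_forms }.

HB.instance Definition _ := gen_eqMixin schwartz_form.
HB.instance Definition _ := gen_choiceMixin schwartz_form.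

Lemma schwartz_form_inj : injective schwartz_form_fun.
Proof. by move=> [f fP] [g gP] /= e; subst g; congr SchwartzForm; exact: Prop_irrelevance. Qed.

Definition schwartz_form_zero : schwartz_form := SchwartzForm (rpred0 schwartz_forms).
Definition schwartz_form_add (u v : schwartz_form) : schwartz_form :=
  SchwartzForm (rpredD (schwartz_form_subproof u) (schwartz_form_subproof v)).
Definition schwartz_form_opp (u : schwartz_form) : schwartz_form :=
  SchwartzForm (rpredNr (schwartz_form_subproof u)).
Definition schwartz_form_scale (a : R[i]) (u : schwartz_form) : schwartz_form :=
  SchwartzForm (rpredZ a (schwartz_form_subproof u)).

Fact schwartz_form_addA : associative schwartz_form_add.
Proof. by move=> u v w; apply: schwartz_form_inj; exact: addrA. Qed.
Fact schwartz_form_addC : commutative schwartz_form_add.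
Proof. by move=> u v; apply: schwartz_form_inj; exact: addrC. Qed.
Fact schwartz_form_add0 : left_id schwartz_form_zero schwartz_form_add.
Proof. by move=> u; apply: schwartz_form_inj; exact: add0r. Qed.
Fact schwartz_form_addN : left_inverse schwartz_form_zero schwartz_form_opp schwartz_form_add.
Proof. by move=> u; apply: schwartz_form_inj; exact: addNr. Qed.

HB.instance Definition _ := GRing.isZmodule.Build schwartz_form
  schwartz_form_addA schwartz_form_addC schwartz_form_add0 schwartz_form_addN.

Fact schwartz_form_scaleA a b u :
  schwartz_form_scale a (schwartz_form_scale b u) = schwartz_form_scale (a * b) u.
Proof. by apply: schwartz_form_inj; exact: scalerA. Qed.
Fact schwartz_form_scale1 : left_id 1 schwartz_form_scale.
Proof. by move=> u; apply: schwartz_form_inj; exact: scale1r. Qed.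
Fact schwartz_form_scaleDr : right_distributive schwartz_form_scale +%R.
Proof. by move=> a u v; apply: schwartz_form_inj; exact: scalerDr. Qed.
Fact schwartz_form_scaleDl u : {morph schwartz_form_scale^~ u : a b / a + b}.
Proof. by move=> a b; apply: schwartz_form_inj; exact: scalerDl. Qed.

HB.instance Definition _ := GRing.Zmodule_isLmodule.Build R[i] schwartz_form
  schwartz_form_scaleA schwartz_form_scale1 schwartz_form_scaleDr schwartz_form_scaleDl.

Implicit Types phi psi : schwartz_form.

Lemma schwartz_coef phi I : increasing I -> coef phi I \in @schwartz R n.
Proof. by move=> iI; have /asboolP := schwartz_form_subproof phi; apply. Qed.

Lemma schwartz_form_eq phi psi :
  (forall x, phi x = psi x) -> phi = psi.
Proof. by move=> e; apply: schwartz_form_inj; apply/funext. Qed.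

Lemma schwartz_form_lin (a : R[i]) phi psi :
  (a *: phi + psi : schwartz_form) = a *: (phi : form) + psi :> form.
Proof. by []. Qed.

Fact schwartz_laplacian_subproof phi : form_laplacian phi \in schwartz_forms.
Proof.
apply/asboolP => I iI; rewrite coef_laplacian//.
by apply: schwartz_laplacian; exact: schwartz_coef.
Qed.

Definition schwartz_form_laplacian phi : schwartz_form :=
  SchwartzForm (schwartz_laplacian_subproof phi).

Lemma schwartz_coef_lin (a : R[i]) phi psi I :
  coef (a *: phi + psi : schwartz_form) I = a *: coef phi I + coef psi I.
Proof. exact: coef_lin. Qed.

Fact schwartz_form_laplacian_linear : linear schwartz_form_laplacian.
Proof.
move=> a phi psi; apply: schwartz_form_eq => x.
transitivity (a *: form_laplacian phi x + form_laplacian psi x) => //.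
rewrite /form_laplacian scaler_sumr -big_split; apply: eq_bigr => I iI.
have sphi := schwartz_smooth (schwartz_coef phi iI).
have spsi := schwartz_smooth (schwartz_coef psi iI).
transitivity
    ((a * laplacian (coef phi I) x + laplacian (coef psi I) x) *: dx I).
  by rewrite schwartz_coef_lin (laplacian_lin a sphi spsi).
by rewrite scalerDl scalerA.
Qed.

HB.instance Definition _ := GRing.isLinear.Build R[i] schwartz_form schwartz_form _
  schwartz_form_laplacian schwartz_form_laplacian_linear.

(* The condition says that phi is less than e for each of the seminorms
   sup_x |x^a d^b phi_I(x)| with |a|, |b| <= N, up to the strictness of the
   inequality for the supremum. *)
Definition seminorm_lt (N : nat) (e : R) phi : Prop :=
  forall (a b : seq 'I_n) I (x : E), (size a <= N)%N -> (size b <= N)%N ->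
    increasing I ->
    `|(monomial a x)%:C * partials b (coef phi I) x| < e%:C.

Definition schwartz_nbhs phi : set_system schwartz_form :=
  filter_from [set p : nat * R | 0 < p.2]
    (fun p => [set psi | seminorm_lt p.1 p.2 (psi - phi)]).

Lemma seminorm_lt0 N e : 0 < e -> seminorm_lt N e 0.
Proof.
move=> e0 a b I x _ _ _; rewrite [coef _ _]coef0 partials0 /= mulr0 normr0.
by rewrite ltcR.
Qed.

Lemma seminorm_ltD N e d phi psi : seminorm_lt N e phi ->
  seminorm_lt N d psi -> seminorm_lt N (e + d) (phi + psi).
Proof.
move=> Hp Hq a b I x aN bN iI.
have sphi := schwartz_smooth (schwartz_coef phi iI).
have spsi := schwartz_smooth (schwartz_coef psi iI).
rewrite -[phi]scale1r schwartz_coef_lin (partials_lin 1 b sphi spsi).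
rewrite !scale1r [(_ + _) x]/(_ x + _ x) mulrDr (le_lt_trans (ler_normD _ _))// rmorphD ltrD//.
  exact: Hp.
exact: Hq.
Qed.

Lemma seminorm_ltS N N' e e' phi : (N <= N')%N -> e' <= e ->
  seminorm_lt N' e' phi -> seminorm_lt N e phi.
Proof.
move=> NN ee H a b I x aN bN iI.
apply: lt_le_trans (H _ _ _ _ (leq_trans aN NN) (leq_trans bN NN) iI) _.
by rewrite lecR.
Qed.

HB.instance Definition _ := hasNbhs.Build schwartz_form schwartz_nbhs.

Fact schwartz_nbhs_filter phi : ProperFilter (nbhs phi).
Proof.
apply: filter_from_proper; last first.
  by move=> [N e] /= e0; exists phi; rewrite /= subrr; exact: seminorm_lt0.
apply: filter_from_filter; first by exists (0, 1); rewrite /= ltr01.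
move=> [N e] [M d] /= e0 d0.
exists (maxn N M, Num.min e d); first by rewrite /= lt_min e0.
move=> psi /= H; split; apply: seminorm_ltS H; rewrite ?leq_maxl ?leq_maxr//.
  by rewrite ge_min lexx.
by rewrite ge_min lexx orbT.
Qed.

Fact schwartz_nbhs_singleton phi A : nbhs phi A -> A phi.
Proof.
by move=> [[N e] /= e0]; apply; rewrite /= subrr; exact: seminorm_lt0.
Qed.

Fact schwartz_nbhs_nbhs phi A : nbhs phi A -> nbhs phi (nbhs^~ A).
Proof.
move=> [[N e] /= e0 sA]; exists (N, e / 2); first by rewrite /= divr_gt0.
move=> psi /= Hpsi; exists (N, e / 2); first by rewrite /= divr_gt0.
move=> chi /= Hchi; apply: sA => /=.
have -> : chi - phi = chi - psi + (psi - phi) by rewrite addrA subrK.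
by rewrite [e]splitr; exact: seminorm_ltD.
Qed.

HB.instance Definition _ := Nbhs_isNbhsTopological.Build schwartz_form
  schwartz_nbhs_filter schwartz_nbhs_singleton schwartz_nbhs_nbhs.

Lemma schwartz_form_laplacian_continuous : continuous schwartz_form_laplacian.
Proof.
move=> phi A [[N e] /= e0 sA].
exists (N.+2, e / n.+1%:R); first by rewrite /= divr_gt0.
move=> psi /= Hpsi; apply: sA => /= a b I x aN bN iI.
have -> : schwartz_form_laplacian psi - schwartz_form_laplacian phi =
  schwartz_form_laplacian (psi - phi) by rewrite linearB.
rewrite [coef _ _]coef_laplacian// partials_laplacian; last first.
  exact/schwartz_smooth/schwartz_coef.
rewrite fctE mulrN normrN fct_sumE mulr_sumr.
rewrite (le_lt_trans (ler_norm_sum _ _ _))//.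
apply: (@le_lt_trans _ _ (\sum_(mu < n) (e / n.+1%:R)%:C)).
  apply: ler_sum => mu _; apply/ltW/Hpsi => //; first by rewrite (leq_trans aN)// -addn2 leq_addr.
  by rewrite size_cat addn2.
rewrite sumr_const card_ord -rmorphMn ltcR /= -mulr_natr -mulrA gtr_pMr//.
by rewrite mulrC ltr_pdivrMr// mul1r ltr_nat.
Qed.

End SchwartzForms.

Section Currents.
Variables (R : realType) (n k : nat).
Local Notation form := ('rV[R]_n -> altform R n k).
Local Notation test_form := (schwartz_form R n k).

Definition currents : {pred test_form -> R[i]} :=
  fun T => `[< linear T /\ continuous (T : test_form -> R[i]^o) >].

Fact currents_submod : submod_closed currents.
Proof.
split.
  apply/asboolP; split=> [a u v|]; last exact: (@cst_continuous _ R[i]^o 0).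
  by transitivity (a *: (0 : R[i]) + 0) => //; rewrite scaler0 addr0.
move=> a S T /asboolP[lS cS] /asboolP[lT cT]; apply/asboolP; split.
  move=> b u v; transitivity (a *: S (b *: u + v) + T (b *: u + v)) => //.
  transitivity (b *: (a *: S u + T u) + (a *: S v + T v)) => //.
  rewrite lS lT !scalerDr !scalerA (mulrC b) !addrA.
  by congr (_ + _); rewrite addrAC.
move=> u; have fu : Filter (nbhs u) by exact: nbhs_filter.
have cZ := @cvgZl_tmp R[i] R[i]^o _ _ fu a _ _ (cS u).
exact: (@cvgD R[i] R[i]^o _ _ fu _ _ _ _ cZ (cT u)).
Qed.

HB.instance Definition _ :=
  GRing.isSubmodClosed.Build R[i] (test_form -> R[i]) currents currents_submod.

Record current := Current {
  current_fun :> test_form -> R[i];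
  current_subproof : current_fun \in currents }.

HB.instance Definition _ := gen_eqMixin current.
HB.instance Definition _ := gen_choiceMixin current.

Lemma current_inj : injective current_fun.
Proof. by move=> [f fP] [g gP] /= e; subst g; congr Current; exact: Prop_irrelevance. Qed.

Definition current_zero : current := Current (rpred0 currents).
Definition current_add (u v : current) : current :=
  Current (rpredD (current_subproof u) (current_subproof v)).
Definition current_opp (u : current) : current :=
  Current (rpredNr (current_subproof u)).
Definition current_scale (a : R[i]) (u : current) : current :=
  Current (rpredZ a (current_subproof u)).

Fact current_addA : associative current_add.
Proof. by move=> u v w; apply: current_inj; exact: addrA. Qed.
Fact current_addC : commutative current_add.
Proof. by move=> u v; apply: current_inj; exact: addrC. Qed.
Fact current_add0 : left_id current_zero current_add.
Proof. by move=> u; apply: current_inj; exact: add0r. Qed.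
Fact current_addN : left_inverse current_zero current_opp current_add.
Proof. by move=> u; apply: current_inj; exact: addNr. Qed.

HB.instance Definition _ := GRing.isZmodule.Build current
  current_addA current_addC current_add0 current_addN.

Fact current_scaleA a b u :
  current_scale a (current_scale b u) = current_scale (a * b) u.
Proof. by apply: current_inj; exact: scalerA. Qed.
Fact current_scale1 : left_id 1 current_scale.
Proof. by move=> u; apply: current_inj; exact: scale1r. Qed.
Fact current_scaleDr : right_distributive current_scale +%R.
Proof. by move=> a u v; apply: current_inj; exact: scalerDr. Qed.
Fact current_scaleDl u : {morph current_scale^~ u : a b / a + b}.
Proof. by move=> a b; apply: current_inj; exact: scalerDl. Qed.

HB.instance Definition _ := GRing.Zmodule_isLmodule.Build R[i] current
  current_scaleA current_scale1 current_scaleDr current_scaleDl.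


Fact current_linear (T : current) : linear T.
Proof. by have /asboolP[] := current_subproof T. Qed.

Fact current_continuous (T : current) : continuous (T : test_form -> R[i]^o).
Proof. by have /asboolP[] := current_subproof T. Qed.

Fact current_laplacian_subproof (T : current) :
  T \o @schwartz_form_laplacian R n k \in currents.
Proof.
apply/asboolP; split=> [a u v|u] /=.
  by rewrite schwartz_form_laplacian_linear current_linear.
apply: continuous_comp; first exact: schwartz_form_laplacian_continuous.
exact: current_continuous.
Qed.

(* The derivative of a distribution a in the direction mu is
   f |-> - a (d_mu f), so that the coefficientwise Laplacian of a current is
   the transpose of the coefficientwise Laplacian of test forms. *)
Definition current_laplacian (T : current) : current :=
  Current (current_laplacian_subproof T).

Fact current_laplacian_is_linear : linear current_laplacian.
Proof. by move=> a S T; exact: current_inj. Qed.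

HB.instance Definition _ := GRing.isLinear.Build R[i] current current _
  current_laplacian current_laplacian_is_linear.

Definition polynomial_fun (p : mpoly.mpoly n R[i]) : 'rV[R]_n -> R[i] :=
  fun x => mpoly.meval (fun i => (x 0 i)%:C) p.

Definition polynomial_laplacian (p : mpoly.mpoly n R[i]) : mpoly.mpoly n R[i] :=
  - \sum_(mu < n) mpoly.mderiv mu (mpoly.mderiv mu p).

Definition harmonic_polynomial (f : 'rV[R]_n -> R[i]) : Prop :=
  exists2 p, polynomial_laplacian p = 0 & f = polynomial_fun p.

Definition harmonic_forms : {pred form} := fun w =>
  `[< forall I, increasing I -> harmonic_polynomial (coef w I) >].

Fact harmonic_forms_submod : submod_closed harmonic_forms.
Proof.
split.
  apply/asboolP => I _; exists 0.
    by rewrite /polynomial_laplacian big1 ?oppr0// => i _; rewrite !linear0.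
  by apply/funext => x; rewrite /polynomial_fun mpoly.meval0.
move=> a u v /asboolP Hu /asboolP Hv; apply/asboolP => I iI.
have [p p0 pE] := Hu I iI; have [q q0 qE] := Hv I iI; exists (a *: p + q).
  rewrite /polynomial_laplacian.
  have -> : \sum_(mu < n) mpoly.mderiv mu (mpoly.mderiv mu (a *: p + q)) =
      a *: \sum_(mu < n) mpoly.mderiv mu (mpoly.mderiv mu p) +
      \sum_(mu < n) mpoly.mderiv mu (mpoly.mderiv mu q).
    by rewrite scaler_sumr -big_split; apply: eq_bigr => mu _; rewrite !linearP.
  rewrite opprD -scalerN.
  by move: p0 q0; rewrite /polynomial_laplacian => -> ->; rewrite scaler0 addr0.
rewrite coef_lin pE qE; apply/funext => x.
by rewrite /polynomial_fun mpoly.mevalD mpoly.mevalZ.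
Qed.

HB.instance Definition _ :=
  GRing.isSubmodClosed.Build R[i] form harmonic_forms harmonic_forms_submod.

Record harmonic_form := HarmonicForm {
  harmonic_form_fun :> form;
  harmonic_form_subproof : harmonic_form_fun \in harmonic_forms }.

HB.instance Definition _ := gen_eqMixin harmonic_form.
HB.instance Definition _ := gen_choiceMixin harmonic_form.

Lemma harmonic_form_inj : injective harmonic_form_fun.
Proof. by move=> [f fP] [g gP] /= e; subst g; congr HarmonicForm; exact: Prop_irrelevance. Qed.

Definition harmonic_form_zero : harmonic_form := HarmonicForm (rpred0 harmonic_forms).
Definition harmonic_form_add (u v : harmonic_form) : harmonic_form :=
  HarmonicForm (rpredD (harmonic_form_subproof u) (harmonic_form_subproof v)).
Definition harmonic_form_opp (u : harmonic_form) : harmonic_form :=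
  HarmonicForm (rpredNr (harmonic_form_subproof u)).
Definition harmonic_form_scale (a : R[i]) (u : harmonic_form) : harmonic_form :=
  HarmonicForm (rpredZ a (harmonic_form_subproof u)).

Fact harmonic_form_addA : associative harmonic_form_add.
Proof. by move=> u v w; apply: harmonic_form_inj; exact: addrA. Qed.
Fact harmonic_form_addC : commutative harmonic_form_add.
Proof. by move=> u v; apply: harmonic_form_inj; exact: addrC. Qed.
Fact harmonic_form_add0 : left_id harmonic_form_zero harmonic_form_add.
Proof. by move=> u; apply: harmonic_form_inj; exact: add0r. Qed.
Fact harmonic_form_addN : left_inverse harmonic_form_zero harmonic_form_opp harmonic_form_add.
Proof. by move=> u; apply: harmonic_form_inj; exact: addNr. Qed.

HB.instance Definition _ := GRing.isZmodule.Build harmonic_form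
  harmonic_form_addA harmonic_form_addC harmonic_form_add0 harmonic_form_addN.

Fact harmonic_form_scaleA a b u :
  harmonic_form_scale a (harmonic_form_scale b u) = harmonic_form_scale (a * b) u.
Proof. by apply: harmonic_form_inj; exact: scalerA. Qed.
Fact harmonic_form_scale1 : left_id 1 harmonic_form_scale.
Proof. by move=> u; apply: harmonic_form_inj; exact: scale1r. Qed.
Fact harmonic_form_scaleDr : right_distributive harmonic_form_scale +%R.
Proof. by move=> a u v; apply: harmonic_form_inj; exact: scalerDr. Qed.
Fact harmonic_form_scaleDl u : {morph harmonic_form_scale^~ u : a b / a + b}.
Proof. by move=> a b; apply: harmonic_form_inj; exact: scalerDl. Qed.

HB.instance Definition _ := GRing.Zmodule_isLmodule.Build R[i] harmonic_form
  harmonic_form_scaleA harmonic_form_scale1 harmonic_form_scaleDr harmonic_form_scaleDl.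


(* A k-form is viewed as the current that sends a test k-form to the integral
   of the sum of the products of their coefficients, without conjugation. *)
Definition pairing (w phi : form) : R[i] :=
  cintegral (fun x =>
    \sum_(I : k.-tuple 'I_n | increasing I) coef w I x * coef phi I x).

Definition is_inclusion (j : harmonic_form -> current) : Prop :=
  forall (w : harmonic_form) (phi : test_form), j w phi = pairing w phi.

End Currents.

(* Main.v *)
Require Import Defs.
From HB Require Import structures.
From mathcomp Require Import all_boot all_order all_algebra.
From mathcomp Require Import all_classical all_reals all_analysis measurable_realfun.
From mathcomp Require Import perm complex ring lra.
From mathcomp Require mpoly.
Import (canonicals) mpoly.

(** The Laplacian acts on each coefficient of a current separately, and the dx_I
    form a basis of the alternating forms ([altform_ext]), so the theorem
    reduces to two facts about a tempered distribution T on R^n: T = U o Delta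
    for some tempered U ([laplacian_distribution_surj]), and if T o Delta = 0
    then T is the integral against a harmonic polynomial
    ([laplacian_distribution_ker]).

    The Fourier transform F is an automorphism of the Schwartz space with
    F (Delta f) = |x|^2 F f, so the equation T = U o Delta is a problem of
    division by |x|^2.  Regularize 1/|x|^2 as 1/(|x|^2 + e).  On functions g that
    vanish at 0 to a high enough order, multiplication by 1/(|x|^2 + e) is bounded
    in every seminorm uniformly in e ([reg_inv_uniform]): Taylor's formula for g
    pays for the derivatives of the kernel.  Hence T (g / (|x|^2 + e)) converges
    as e tends to 0, and composing with a continuous projection onto such g
    ([jet_projection]) gives a tempered U such that T - U o |x|^2 vanishes on flat
    functions, so that it is a combination of derivatives at 0 ([jet_span]):
    this is [tempered_division].  It avoids the Hahn-Banach theorem.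

    Across the Fourier transform, a derivative at 0 is the integral against a
    polynomial, and the Laplacian maps polynomials onto polynomials
    ([polynomial_laplacian_surj]), so this remainder is in the range as well.
    If T o Delta = 0, then T o F^-1 kills |x|^2 f for all f, and
    f = |x|^2 f / (|x|^2 + e) + e f / (|x|^2 + e) shows that it kills flat
    functions ([tempered_jet0]); so T is the integral against a polynomial p, which
    is harmonic because a polynomial is determined by its integrals against
    Schwartz functions ([cintegral_polynomial_inj]).

    Fourier inversion ([fourier_inverse]) comes from the same argument: the
    functional f |-> int F f kills each x_i f, so it is a multiple of the
    evaluation at 0 ([tempered_delta]); translations turn this into
    F (F f) (- x) = c f x, and the Gaussian, an eigenvector of F whose eigenvalue
    is its integral, shows that c is not 0.

    All continuity statements are in terms of [qbound], and products are estimated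
    through families closed under derivatives ([generated]), which keep bounds
    uniform in a parameter such as e. *)

Set Implicit Arguments.
Unset Strict Implicit.
Unset Printing Implicit Defensive.

Import Order.TTheory GRing.Theory Num.Theory.
Import numFieldNormedType.Exports.

Local Open Scope classical_set_scope.
Local Open Scope ring_scope.

(** * The complex modulus and differential calculus *)

Section Modulus.
Variable R : realType.
Implicit Types (z w : R[i]) (x : R).

Local Notation nc := (@Normc.normc R).

Lemma nc_ge0 z : 0 <= nc z.
Proof. by case: z => a b; exact: sqrtr_ge0. Qed.

Lemma ncE z : `|z| = (nc z)%:C%C.
Proof. by case: z. Qed.

Lemma ncD z w : nc (z + w) <= nc z + nc w.
Proof. exact: le_normcD. Qed.

Lemma ncN z : nc (- z) = nc z.
Proof. exact: normcN. Qed.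

Lemma ncM z w : nc (z * w) = nc z * nc w.
Proof. exact: Normc.normcM. Qed.

Lemma nc0 : nc 0 = 0.
Proof. exact: Normc.normc0. Qed.

Lemma nc1 : nc 1 = 1.
Proof. exact: Normc.normc1. Qed.

Lemma nc_real x : nc x%:C%C = `|x|.
Proof. by rewrite /Normc.normc/= expr0n/= addr0 sqrtr_sqr. Qed.

Lemma nc_eq0 z : (nc z == 0) = (z == 0).
Proof.
apply/eqP/eqP => [|->]; [exact: Normc.eq0_normc|exact: nc0].
Qed.

Lemma nc_Re z : `|complex.Re z| <= nc z.
Proof.
case: z => a b /=; rewrite -sqrtr_sqr ler_wsqrtr// lerDl; exact: sqr_ge0.
Qed.

Lemma nc_Im z : `|complex.Im z| <= nc z.
Proof.
case: z => a b /=; rewrite -sqrtr_sqr ler_wsqrtr// lerDr; exact: sqr_ge0.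
Qed.

Lemma nc_le_ReIm z : nc z <= `|complex.Re z| + `|complex.Im z|.
Proof.
case: z => a b /=; rewrite -(@ler_pXn2r _ 2)// ?nnegrE ?sqrtr_ge0 ?addr_ge0//.
rewrite sqr_sqrtr ?addr_ge0 ?sqr_ge0// sqrrD !real_normK ?num_real//.
have := mulr_ge0 (normr_ge0 a) (normr_ge0 b); lra.
Qed.

Lemma ReB z w : complex.Re (z - w) = complex.Re z - complex.Re w.
Proof. by case: z w => a b [c d]. Qed.

Lemma ImB z w : complex.Im (z - w) = complex.Im z - complex.Im w.
Proof. by case: z w => a b [c d]. Qed.

Lemma Re_realM x z : complex.Re (x%:C%C * z) = x * complex.Re z.
Proof. by case: z => a b /=; rewrite mul0r subr0. Qed.

Lemma Im_realM x z : complex.Im (x%:C%C * z) = x * complex.Im z.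
Proof. by case: z => a b /=; rewrite mul0r addr0. Qed.

End Modulus.
Notation nc := Normc.normc.

Section Calculus.
Variables (R : realType) (n : nat).
Local Notation E := 'rV[R]_n.
Local Notation C := R[i].
Local Notation ee i := (delta_mx 0 i : E).
Implicit Types (f g : E -> C) (x v : E) (i j : 'I_n).

Lemma re_funM f g : re_fun (f * g) = re_fun f * re_fun g - im_fun f * im_fun g.
Proof.
apply/funext => x; rewrite /re_fun /im_fun !fctE.
by case: (f x) => a b; case: (g x).
Qed.

Lemma im_funM f g : im_fun (f * g) = re_fun f * im_fun g + im_fun f * re_fun g.
Proof.
apply/funext => x; rewrite /re_fun /im_fun !fctE.
by case: (f x) => a b; case: (g x) => c d /=; rewrite (mulrC b).
Qed.

Lemma cdifferentiableM f g x :
  cdifferentiable f x -> cdifferentiable g x -> cdifferentiable (f * g) x.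
Proof.
move=> [rf jf] [rg jg]; split; rewrite ?re_funM ?im_funM.
  by apply: differentiableB; apply: differentiableM.
by apply: differentiableD; apply: differentiableM.
Qed.

Lemma partialM i f g x : cdifferentiable f x -> cdifferentiable g x ->
  partial i (f * g) x = partial i f x * g x + f x * partial i g x.
Proof.
move=> [rf jf] [rg jg]; rewrite /partial re_funM im_funM.
have d h : differentiable h x -> derivable h x (ee i) by exact: diff_derivable.
rewrite deriveB ?deriveD ?deriveM; do ?[exact: d | apply: d; apply: differentiableM => //].
rewrite /re_fun /im_fun.
move: ('D_ _ _ _) ('D_ _ _ _) ('D_ _ _ _) ('D_ _ _ _) => r s t u.
case: (f x) (g x) => a b [c e]; congr Complex; rewrite /GRing.scale/=.
  ring.
ring.
Qed.

Lemma cdifferentiable_cst (c : C) x : cdifferentiable (cst c) x.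
Proof. by split; exact: differentiable_cst. Qed.

Lemma partial_cst i (c : C) : partial i (cst c) = 0.
Proof.
apply/funext => x; rewrite /partial.
by rewrite (_ : re_fun _ = cst (complex.Re c))// (_ : im_fun _ = cst (complex.Im c))// !derive_cst.
Qed.

Lemma cdifferentiableD f g x :
  cdifferentiable f x -> cdifferentiable g x -> cdifferentiable (f + g) x.
Proof. by move=> df dg; rewrite -[f]scale1r; exact: cdifferentiable_lin. Qed.

Lemma partialD i f g x : cdifferentiable f x -> cdifferentiable g x ->
  partial i (f + g) x = partial i f x + partial i g x.
Proof. by move=> df dg; rewrite -[in LHS](scale1r f) partial_lin// mul1r. Qed.

Lemma cdifferentiable_real (h : E -> R) x :
  differentiable h x -> cdifferentiable (fun y => (h y)%:C%C) x.
Proof. by move=> dh; split => //; exact: differentiable_cst. Qed.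

Lemma partial_real i (h : E -> R) x :
  partial i (fun y => (h y)%:C%C) x = ('D_(ee i) h x)%:C%C.
Proof.
rewrite /partial (_ : re_fun _ = h)// (_ : im_fun _ = cst 0)//.
by rewrite derive_cst.
Qed.

Lemma derive_sum_ee (h : E -> R) x v : differentiable h x ->
  'D_v h x = \sum_i v 0 i * 'D_(ee i) h x.
Proof.
move=> dh; rewrite deriveE// {1}(row_sum_delta v) linear_sum; apply: eq_bigr => i _.
by rewrite linearZ deriveE.
Qed.

Lemma is_derive_ray (h : E -> R) x v (t : R) : differentiable h (x + t *: v) ->
  is_derive t 1 (fun s : R => h (x + s *: v)) ('D_v h (x + t *: v)).
Proof.
move=> dh; set g := fun s : R => x + s *: v.
have [dZ dZE] := is_diff_scalel t v.
have dg : is_derive t 1 g v.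
  have -> : g = cst x + (fun s : R => s *: v) by [].
  apply: DeriveDef; first by apply: diff_derivable; exact: differentiableD.
  rewrite deriveD; [|exact: derivable_cst|exact: diff_derivable].
  by rewrite derive_cst add0r deriveE// dZE scale1r.
have dg' : differentiable g t by apply/derivable1_diffP; case: dg.
have dhg : differentiable (h \o g) t by exact: differentiable_comp.
apply: DeriveDef; first exact: diff_derivable.
rewrite -[LHS]/('D_1 (h \o g) t) deriveE// diff_comp//= deriveE//.
by rewrite -(deriveE _ dg'); case: dg => _ ->.
Qed.

Lemma MVT_ray (h : E -> R) x v : (forall y, differentiable h y) ->
  exists2 t : R, 0 <= t <= 1 & h (x + v) - h x = 'D_v h (x + t *: v).
Proof.
move=> dh.
have ct : {within `[0, 1], continuous (fun s => h (x + s *: v))}.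
  apply: continuous_subspaceT => s.
  case: (is_derive_ray (dh (x + s *: v))) => /derivable1_diffP D _.
  exact: differentiable_continuous D.
have [t t01 e] := @MVT_segment R (fun s => h (x + s *: v))
  (fun s => 'D_v h (x + s *: v)) 0 1 ler01 (fun s _ => is_derive_ray (dh _)) ct.
exists t; first by move: t01; rewrite in_itv.
by move: e; rewrite scale1r scale0r addr0 subr0 mulr1.
Qed.

Lemma derive_comp (phi : R -> R) (dphi : R) (h : E -> R) x v :
  is_derive (h x) 1 phi dphi -> differentiable h x ->
  differentiable (phi \o h) x /\ 'D_v (phi \o h) x = dphi * 'D_v h x.
Proof.
move=> [dp <-] dh; have dp' : differentiable phi (h x) by exact/derivable1_diffP.
have dc : differentiable (phi \o h) x by exact: differentiable_comp.
split=> //; rewrite deriveE// diff_comp//= deriveE// deriveE//.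
rewrite -[X in 'd phi (h x) X]mulr1 -[_ * 1]/(_ *: (1 : R^o)).
by rewrite linearZ/= mulrC.
Qed.

End Calculus.

(** A quadratic remainder estimate implies differentiability, and unlike a
    remainder that is only little-o it is a plain inequality. All functions
    whose derivatives are computed by hand below (coordinates, |x|^2,
    characters, Fourier transforms) satisfy one. *)
Lemma quadratic_diff (R : realType) (V W : normedModType R) (f : V -> W)
    (L : {linear V -> W}) (x : V) (M : R) : continuous L ->
  (forall v, `|f (x + v) - f x - L v| <= M * `|v| ^+ 2) ->
  differentiable f x /\ 'd f x = L :> (V -> W).
Proof.
move=> cL H.
have rem : f \o shift x = cst (f x) + L +o_ 0 id.
  apply/eqaddoP => e e0.
  have M1 : 0 < `|M| + 1 by rewrite ltr_wpDl.
  have d0 : 0 < e / (`|M| + 1) by rewrite divr_gt0.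
  apply/nbhs_normP; exists (e / (`|M| + 1)) => //= v.
  rewrite /ball_/= sub0r normrN ltr_pdivlMr// => vM.
  change (`|f (v + x) - (f x + L v)| <= e * `|v|).
  rewrite (addrC v) opprD addrA.
  rewrite (le_trans (H v))// expr2 mulrA ler_wpM2r//.
  rewrite (le_trans _ (ltW vM))// mulrC ler_wpM2l// (le_trans (ler_norm _))//.
  by rewrite lerDl.
have dE := diff_unique cL rem.
by split=> //; apply/diff_locallyP; rewrite dE.
Qed.

(** * Smooth functions: Leibniz's rule, Taylor's bound, Schwarz's theorem *)

Section Smooth.
Variables (R : realType) (n : nat).
Local Notation E := 'rV[R]_n.
Local Notation C := R[i].
Local Notation ee i := (delta_mx 0 i : E).
Implicit Types (f g : E -> C) (x v : E) (i j : 'I_n) (b : seq 'I_n).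

(** Smoothness by coinduction: it is enough to find a class of differentiable
    functions that is stable under the partial derivatives. *)
Lemma smooth_coind (A : set (E -> C)) :
  (forall f, A f -> (forall x, cdifferentiable f x) /\ forall i, A (partial i f)) ->
  forall f, A f -> smooth f.
Proof.
move=> HA f Af b; suff : A (partials b f) by move=> /HA[].
by elim: b => [//|i b /HA[_]]; exact.
Qed.

Lemma smooth_cdiff f x : smooth f -> cdifferentiable f x.
Proof. by move=> sf; exact: (sf [::]). Qed.

Lemma smooth_partials b f : smooth f -> smooth (partials b f).
Proof. by move=> sf; elim: b => [//|i b]; exact: smooth_partial. Qed.

Lemma partials_rcons b i f : partials (rcons b i) f = partials b (partial i f).
Proof. by rewrite /partials foldr_rcons. Qed.

Lemma partials_cat b b' f : partials (b ++ b') f = partials b (partials b' f).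
Proof. by rewrite /partials foldr_cat. Qed.

Section Engine.
Variables (P : Type) (D : set P) (gen : set (P -> E -> C)).

(** The families of functions, indexed by a parameter in P, obtained from the
    families in gen by sums and products with constants that do not depend on
    the parameter. If the derivatives of the generators are of this form, so
    are all derivatives, which yields smoothness and, from bounds on the
    generators, bounds on all derivatives that are uniform in the parameter.
    *)
Inductive generated : (P -> E -> C) -> Prop :=
| generated_cst c : generated (fun _ => cst c)
| generated_gen F : gen F -> generated F
| generated_add F G : generated F -> generated G -> generated (fun p => F p + G p)
| generated_mul F G : generated F -> generated G -> generated (fun p => F p * G p).

Hypothesis genP : forall F, gen F ->
  (forall p, D p -> forall x, cdifferentiable (F p) x) /\
  (forall i, exists2 G, generated G & forall p, D p -> partial i (F p) = G p).

Lemma generated_diff F : generated F -> (forall p, D p -> forall x, cdifferentiable (F p) x) /\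
  (forall i, exists2 G, generated G & forall p, D p -> partial i (F p) = G p).
Proof.
elim=> {F} [c|F /genP//|F G aF [dF pF] aG [dG pG]|F G aF [dF pF] aG [dG pG]].
- split; first by move=> p _ x; exact: cdifferentiable_cst.
  move=> i; exists (fun=> cst 0); first exact: generated_cst.
  by move=> p _; rewrite partial_cst.
- split; first by move=> p Dp x; apply: cdifferentiableD; [exact: dF|exact: dG].
  move=> i; have [F' aF' eF] := pF i; have [G' aG' eG] := pG i.
  exists (fun p => F' p + G' p); first exact: generated_add.
  move=> p Dp; apply/funext => x.
  by rewrite partialD ?eF ?eG//; [exact: dF|exact: dG].
- split; first by move=> p Dp x; apply: cdifferentiableM; [exact: dF|exact: dG].
  move=> i; have [F' aF' eF] := pF i; have [G' aG' eG] := pG i.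
  exists (fun p => F' p * G p + F p * G' p).
    by apply: generated_add; exact: generated_mul.
  move=> p Dp; apply/funext => x.
  by rewrite partialM ?eF ?eG//; [exact: dF|exact: dG].
Qed.

Lemma generated_smooth F p : generated F -> D p -> smooth (F p).
Proof.
move=> aF Dp; apply: (@smooth_coind [set f | exists2 G, generated G & f = G p]); last by exists F.
move=> f [G /generated_diff[dG pG] ->]; split; first exact: dG.
by move=> i; have [G' aG' eG'] := pG i; exists G'; rewrite ?eG'.
Qed.

Lemma generated_bound (X : set E) (w : E -> R) : (forall x, X x -> 1 <= w x) ->
  (forall F, gen F -> exists m M, 0 <= M /\
    forall p x, D p -> X x -> nc (F p x) <= M * w x ^+ m) ->
  forall F, generated F -> exists m M, 0 <= M /\
    forall p x, D p -> X x -> nc (F p x) <= M * w x ^+ m.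
Proof.
move=> w1 gb F; have w0 x : X x -> 0 <= w x.
  by move=> Xx; exact: le_trans ler01 (w1 x Xx).
elim=> {F} [c|F /gb//|F G _ [m [M [M0 hF]]] _ [m' [M' [M'0 hG]]]|
  F G _ [m [M [M0 hF]]] _ [m' [M' [M'0 hG]]]].
- exists 0%N, (nc c); split; first exact: nc_ge0.
  by move=> p x _ _; rewrite expr0 mulr1.
- exists (m + m')%N, (M + M'); split; first by rewrite addr_ge0.
  move=> p x Dp Xx; rewrite (le_trans (ncD _ _))// mulrDl lerD//.
    by rewrite (le_trans (hF _ _ Dp Xx))// ler_wpM2l// ler_weXn2l ?w1// leq_addr.
  by rewrite (le_trans (hG _ _ Dp Xx))// ler_wpM2l// ler_weXn2l ?w1// leq_addl.
- exists (m + m')%N, (M * M'); split; first by rewrite mulr_ge0.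
  move=> p x Dp Xx; rewrite [(_ * _) x]/(_ * _) ncM exprD mulrACA.
  by rewrite ler_pM ?nc_ge0 ?hF ?hG.
Qed.

(** Differential operators of order at most N with generated coefficients;
    they hide the combinatorics of the terms in Leibniz's rule. *)
Inductive diff_op (N : nat) : (P -> (E -> C) -> E -> C) -> Prop :=
| diff_op_term F b : generated F -> (size b <= N)%N -> diff_op N (fun p g => F p * partials b g)
| diff_op_add Q Q' : diff_op N Q -> diff_op N Q' -> diff_op N (fun p g => Q p g + Q' p g).

Lemma diff_op_smooth N Q p g : diff_op N Q -> D p -> smooth g -> forall x, cdifferentiable (Q p g) x.
Proof.
move=> + Dp sg; elim=> {Q} [F b aF _|Q Q' _ hQ _ hQ'] x.
  apply: cdifferentiableM; last exact: sg.
  exact: (generated_diff aF).1.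
by apply: cdifferentiableD.
Qed.

Lemma diff_op_partial N Q i : diff_op N Q -> exists2 Q', diff_op N.+1 Q' &
  forall p g, D p -> smooth g -> partial i (Q p g) = Q' p g.
Proof.
elim=> {Q} [F b aF bN|Q Q' dQ [P1 d1 e1] dQ' [P2 d2 e2]].
  have [dF /(_ i)[G aG eG]] := generated_diff aF.
  exists (fun p g => G p * partials b g + F p * partials (i :: b) g).
    by apply: diff_op_add; apply: diff_op_term => //; exact: leqW.
  move=> p g Dp sg; apply/funext => x; by rewrite (partialM _ (dF p Dp x) (sg b x)) eG.
exists (fun p g => P1 p g + P2 p g); first exact: diff_op_add.
move=> p g Dp sg; apply/funext => x; by rewrite (partialD _ (diff_op_smooth dQ Dp sg x) (diff_op_smooth dQ' Dp sg x)) e1 ?e2.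
Qed.

(** The coefficients stay among the generated families, and at most [size b]
    derivatives fall on g: this is all that estimates need. *)
Lemma leibniz b F : generated F -> exists2 Q, diff_op (size b) Q &
  forall p g, D p -> smooth g -> partials b (F p * g) = Q p g.
Proof.
move=> aF; elim: b => [|i b [Q dQ eQ]].
  exists (fun p g => F p * partials [::] g) => //.
  by apply: diff_op_term.
have [Q' dQ' eQ'] := diff_op_partial i dQ; exists Q' => // p g Dp sg.
by rewrite /= eQ// eQ'.
Qed.

End Engine.

(** The smooth functions themselves are generators, with a trivial parameter.
    *)
Lemma smoothM f g : smooth f -> smooth g -> smooth (f * g).
Proof.
move=> sf sg; apply: (@generated_smooth unit setT [set F | smooth (F tt)] _ (fun=> f * g) tt) => //.
  move=> F /= sF; split; first by move=> [] _ x; exact: smooth_cdiff.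
  move=> i; exists (fun p => partial i (F p)) => //.
  by apply: generated_gen; exact: smooth_partial.
by apply: generated_mul; apply: generated_gen.
Qed.

Lemma norm_coord x i : `|x 0 i| <= `|x|.
Proof.
rewrite [leRHS]/Num.Def.normr/= mx_normrE.
by apply/bigmax_geP; right => /=; exists (0, i).
Qed.

Lemma norm_le_coord x (M : R) : 0 <= M -> (forall i, `|x 0 i| <= M) -> `|x| <= M.
Proof.
move=> M0 H; rewrite [leLHS]/Num.Def.normr/= mx_normrE.
by apply: bigmax_le => // -[j i] _ /=; rewrite ord1.
Qed.

Lemma norm_ee i : `|ee i| <= 1.
Proof.
apply: norm_le_coord => // l; rewrite mxE eqxx/=.
by case: (_ == _); rewrite ?normr1// normr0.
Qed.

(** The mean value theorem on the segment from 0 to x loses one factor n |x|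
    and one order of derivation for each of the real and imaginary parts,
    hence the factor 2. The crude constant spares Taylor's formula in several
    variables. *)
Lemma taylor_bound M f (B : R) : smooth f -> 0 <= B ->
  (forall b, (size b < M)%N -> partials b f 0 = 0) ->
  (forall b x, size b = M -> nc (partials b f x) <= B) ->
  forall x, nc (f x) <= (2 * n%:R * `|x|) ^+ M * B.
Proof.
move=> + B0; elim: M f => [|M IH] f sf f0 fM x.
  by rewrite expr0 mul1r; exact: (fM [::]).
have bnd i (t : R) : 0 <= t <= 1 ->
    nc (partial i f (t *: x)) <= (2 * n%:R * `|x|) ^+ M * B.
  move=> /andP[t0 t1]; apply: le_trans (IH _ (smooth_partial i sf) _ _ _) _.
  - by move=> b bM; rewrite -partials_rcons f0// size_rcons.
  - by move=> b y bM; rewrite -partials_rcons fM// size_rcons bM.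
  - rewrite ler_wpM2r// lerXn2r ?nnegrE ?mulr_ge0// ler_wpM2l ?mulr_ge0//.
    by rewrite normrZ ger0_norm// ler_piMl.
have sum (h : E -> R) t : (forall y, differentiable h y) ->
    (forall i, `|'D_(ee i) h (t *: x)| <= (2 * n%:R * `|x|) ^+ M * B) ->
    `|'D_x h (t *: x)| <= n%:R * `|x| * ((2 * n%:R * `|x|) ^+ M * B).
  move=> dh hb; rewrite derive_sum_ee// (le_trans (ler_norm_sum _ _ _))//.
  rewrite -mulrA mulr_natl -[X in _ *+ X](card_ord n) -sumr_const.
  by apply: ler_sum => i _; rewrite normrM ler_pM// norm_coord.
have [t t01 et] := @MVT_ray _ _ (re_fun f) 0 x (fun y => (smooth_cdiff y sf).1).
have [s s01 es] := @MVT_ray _ _ (im_fun f) 0 x (fun y => (smooth_cdiff y sf).2).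
have f00 : f 0 = 0 by exact: (f0 [::]).
move: et es; rewrite /re_fun /im_fun f00 !add0r !subr0 -/(re_fun f) -/(im_fun f) => et es.
rewrite (le_trans (nc_le_ReIm _))// et es.
have -> : (2 * n%:R * `|x|) ^+ M.+1 * B =
    n%:R * `|x| * ((2 * n%:R * `|x|) ^+ M * B) + n%:R * `|x| * ((2 * n%:R * `|x|) ^+ M * B).
  by rewrite exprS; ring.
apply: lerD; apply: sum.
- by move=> y; exact: (smooth_cdiff y sf).1.
- by move=> i; apply: le_trans (bnd i t t01); exact: (nc_Re (partial i f (t *: x))).
- by move=> y; exact: (smooth_cdiff y sf).2.
- by move=> i; apply: le_trans (bnd i s s01); exact: (nc_Im (partial i f (s *: x))).
Qed.

Lemma derive_shift_vec (h : E -> R) a v x :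
  'D_v (fun y => h (y + a)) x = 'D_v h (x + a).
Proof.
rewrite /derive; set F := (fun t => _); set G := (fun t => _).
by suff -> : F = G by []; apply/funext => t; rewrite /F /G /= addrA.
Qed.

Lemma differentiable_shift_vec (h : E -> R) a x :
  differentiable h (x + a) -> differentiable (fun y => h (y + a)) x.
Proof.
move=> dh; by apply: (@differentiable_comp _ _ _ _ (fun y => y + a) h).
Qed.

Lemma deriveZv (h : E -> R) (t : R) v x : differentiable h x ->
  'D_(t *: v) h x = t * 'D_v h x.
Proof. by move=> dh; rewrite !deriveE// linearZ. Qed.

Lemma no_common_half (A B c : R) :
  `|A - c| < `|A - B| / 2 -> `|B - c| < `|A - B| / 2 -> False.
Proof.
move=> Ac Bc; have : `|A - B| < `|A - B|; last by rewrite ltxx.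
rewrite {1}(_ : A - B = (A - c) - (B - c)); last by rewrite opprB addrA subrK.
by rewrite (le_lt_trans (ler_normB _ _))// [ltRHS]splitr ltrD.
Qed.

(** The mean value theorem in the direction i, then in the direction j. The
    left hand side is symmetric in i and j, which gives Schwarz's theorem. *)
Lemma second_difference (h : E -> R) i j x (t : R) :
  (forall y, differentiable h y) -> (forall y, differentiable ('D_(ee i) h) y) ->
  exists2 z, `|z - x| <= 2 * `|t| &
    h (x + t *: ee i + t *: ee j) - h (x + t *: ee i) - (h (x + t *: ee j) - h x) =
    t ^+ 2 * 'D_(ee j) ('D_(ee i) h) z.
Proof.
move=> dh dih; pose g y := h (y + t *: ee j) - h y.
have dg y : differentiable g y.
  by apply: differentiableB => //; exact: differentiable_shift_vec.
have [s /andP[s0 s1] es] := MVT_ray x (t *: ee i) dg.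
set y := x + s *: (t *: ee i) in es.
have [r /andP[r0 r1] er] := MVT_ray y (t *: ee j) dih.
exists (y + r *: (t *: ee j)).
  rewrite /y addrAC (addrC x) addrK (le_trans (ler_normD _ _))//.
  rewrite mulr_natl mulr2n; apply: lerD; rewrite !scalerA normrZ normrM -[leRHS]mulr1 ler_pM ?norm_ee//.
    by rewrite ger0_norm// ler_piMl.
  by rewrite ger0_norm// ler_piMl.
move: es; rewrite /g => ->; rewrite deriveZv; last exact: dg.
rewrite deriveB; [|apply: diff_derivable; exact: differentiable_shift_vec|exact: diff_derivable].
by rewrite derive_shift_vec er deriveZv// mulrA expr2.
Qed.

(** The second difference is the same for both orders of derivation, so by
    [second_difference] the two mixed derivatives share values at points
    arbitrarily close to x, and continuity gives equality at x. *)
Lemma derive_swap (h : E -> R) i j x :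
  (forall y, differentiable h y) ->
  (forall k y, differentiable ('D_(ee k) h) y) ->
  (forall k l y, differentiable ('D_(ee k) ('D_(ee l) h)) y) ->
  'D_(ee j) ('D_(ee i) h) x = 'D_(ee i) ('D_(ee j) h) x.
Proof.
move=> dh d1 d2; apply/eqP/negPn/negP => ne.
set a := 'D_(ee j) ('D_(ee i) h); set b := 'D_(ee i) ('D_(ee j) h).
have e0 : 0 < `|a x - b x| / 2 by rewrite divr_gt0// normr_gt0 subr_eq0.
have ca := differentiable_continuous (d2 j i x).
have cb := differentiable_continuous (d2 i j x).
move/cvgrPdist_lt : ca => /(_ _ e0) /nbhs_normP[r /= r0 ar].
move/cvgrPdist_lt : cb => /(_ _ e0) /nbhs_normP[s /= s0 bs].
have [t [t0 tr ts]] : exists t : R, [/\ 0 < t, 2 * `|t| < r & 2 * `|t| < s].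
  exists (Num.min r s / 3); have m0 : 0 < Num.min r s by rewrite lt_min r0.
  have lr : Num.min r s <= r by rewrite ge_min lexx.
  have ls : Num.min r s <= s by rewrite ge_min lexx orbT.
  move: (Num.min r s) m0 lr ls => m m0 lr ls.
  by rewrite gtr0_norm ?divr_gt0//; clear -m0 lr ls; split; lra.
have [z zx ez] := second_difference j x t dh (d1 i).
have [w wx ew] := second_difference i x t dh (d1 j).
have ezw : a z = b w.
  have t20 : t ^+ 2 != 0 by rewrite sqrf_eq0 gt_eqF.
  apply: (mulfI t20); rewrite -[LHS]ez -[RHS]ew.
  by rewrite [x + _ + _ in LHS]addrAC; ring.
have za : `|a x - a z| < `|a x - b x| / 2.
  by apply: ar; rewrite /ball_/= distrC (le_lt_trans zx).
have wb : `|b x - b w| < `|a x - b x| / 2.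
  by apply: bs; rewrite /ball_/= distrC (le_lt_trans wx).
rewrite ezw in za; exact: (no_common_half za wb).
Qed.

Lemma re_partial k f : re_fun (partial k f) = 'D_(ee k) (re_fun f).
Proof. by []. Qed.

Lemma im_partial k f : im_fun (partial k f) = 'D_(ee k) (im_fun f).
Proof. by []. Qed.

Lemma partialC i j f : smooth f -> partial i (partial j f) = partial j (partial i f).
Proof.
move=> sf.
have dR y : differentiable (re_fun f) y by exact: (sf [::] y).1.
have dI y : differentiable (im_fun f) y by exact: (sf [::] y).2.
have dR1 k y : differentiable ('D_(ee k) (re_fun f)) y.
  by rewrite -re_partial; exact: (sf [:: k] y).1.
have dI1 k y : differentiable ('D_(ee k) (im_fun f)) y.
  by rewrite -im_partial; exact: (sf [:: k] y).2.
have dR2 k l y : differentiable ('D_(ee k) ('D_(ee l) (re_fun f))) y.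
  have := (sf [:: k; l] y).1; by rewrite /= re_partial re_partial; exact.
have dI2 k l y : differentiable ('D_(ee k) ('D_(ee l) (im_fun f))) y.
  have := (sf [:: k; l] y).2; by rewrite /= im_partial im_partial; exact.
apply/funext => x; apply/eqP; rewrite eq_complex; apply/andP; split; apply/eqP.
  exact: (derive_swap j i x dR dR1 dR2).
exact: (derive_swap j i x dI dI1 dI2).
Qed.

Lemma partials_partial b i f : smooth f ->
  partials b (partial i f) = partial i (partials b f).
Proof.
move=> sf; elim: b => //= j b ->.
by rewrite partialC//; exact: smooth_partials.
Qed.

Lemma quadratic_differentiable (h : E -> R) x (l : 'I_n -> R) (M : R) :
  (forall v, `|h (x + v) - h x - \sum_i v 0 i * l i| <= M * `|v| ^+ 2) ->
  differentiable h x /\ forall i, 'D_(ee i) h x = l i.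
Proof.
move=> H; pose L v := \sum_i v 0 i * l i.
have Llin : linear (L : E -> R).
  move=> a u v; rewrite /L scaler_sumr -big_split; apply: eq_bigr => i _ /=.
  by rewrite !mxE mulrDl -mulrA.
pose LM := GRing.isLinear.Build _ _ _ _ _ Llin.
pose LL : {linear E -> R} := HB.pack L LM.
have cL : continuous LL.
  move=> v; apply: differentiable_continuous => //.
  have -> : (LL : E -> R) = \sum_i (fun v => v 0 i * l i).
    by apply/funext => u; rewrite /LL/= /L fct_sumE.
  apply: differentiable_sum => i; apply: differentiableM => //.
  exact: differentiable_coord.
have [dh dE] := quadratic_diff cL H.
split=> // i; rewrite deriveE// dE /=/LL/=/L (bigD1 i)//= big1 ?addr0.
  by rewrite mxE !eqxx mul1r.
by move=> k ki; rewrite mxE eqxx (negbTE ki) mul0r.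
Qed.

Lemma quadratic_cdifferentiable f x (l : 'I_n -> C) (M : R) :
  (forall v, nc (f (x + v) - f x - \sum_i (v 0 i)%:C%C * l i) <= M * `|v| ^+ 2) ->
  cdifferentiable f x /\ forall i, partial i f x = l i.
Proof.
move=> H.
have ReE v : complex.Re (f (x + v) - f x - \sum_i (v 0 i)%:C%C * l i) =
    re_fun f (x + v) - re_fun f x - \sum_i v 0 i * complex.Re (l i).
  rewrite !raddfB/= raddf_sum; congr (_ - _); apply: eq_bigr => i _.
  by case: (l i) => a b /=; rewrite mul0r subr0.
have ImE v : complex.Im (f (x + v) - f x - \sum_i (v 0 i)%:C%C * l i) =
    im_fun f (x + v) - im_fun f x - \sum_i v 0 i * complex.Im (l i).
  rewrite !raddfB/= raddf_sum; congr (_ - _); apply: eq_bigr => i _.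
  by case: (l i) => a b /=; rewrite mul0r addr0.
have [d1 e1] := @quadratic_differentiable (re_fun f) x (fun i => complex.Re (l i)) M
  (fun v => le_trans (eq_ind _ (fun z => `|z| <= _) (nc_Re _) _ (ReE v)) (H v)).
have [d2 e2] := @quadratic_differentiable (im_fun f) x (fun i => complex.Im (l i)) M
  (fun v => le_trans (eq_ind _ (fun z => `|z| <= _) (nc_Im _) _ (ImE v)) (H v)).
by split=> // i; rewrite /partial e1 e2; case: (l i).
Qed.

End Smooth.

(** * Seminorms, continuous operators and tempered functionals *)

Section Schwartz.
Variables (R : realType) (n : nat).
Local Notation E := 'rV[R]_n.
Local Notation C := R[i].
Local Notation S := (@schwartz R n).
Implicit Types (f g : E -> C) (x v : E) (i j : 'I_n) (b : seq 'I_n) (B M K : R).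

(** There are finitely many multi-indices of bounded order, so bounds that
    exist for each of them and are monotone can be chosen uniformly. *)
Lemma uniform_multiindex (Q : seq 'I_n -> nat -> R -> Prop) :
  (forall b m m' M M', (m <= m')%N -> M <= M' -> Q b m M -> Q b m' M') ->
  (forall b, exists m M, Q b m M) ->
  forall N, exists m M, 0 <= M /\ forall b, (size b <= N)%N -> Q b m M.
Proof.
move=> + + N; elim: N Q => [|N IH] Q mono exQ.
  have [m [M q]] := exQ [::]; exists m, `|M|; split=> // -[]// _.
  by apply: mono q; rewrite ?ler_norm.
pose Q' b m M := forall i, Q (i :: b) m M.
have [|b|m [M [M0 q]]] := IH Q'.
- by move=> b m m' M M' mm' MM' q i; exact: mono (q i).
- have /choice[F FP] : forall i, exists p : nat * R, Q (i :: b) p.1 p.2.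
    by move=> i; have [m [M q]] := exQ (i :: b); exists (m, M).
  (* A sum stands for a maximum, to avoid one over a possibly empty index
     type. *)
  exists (\max_i (F i).1)%N, (\sum_i `|(F i).2|) => i; apply: mono (FP i).
    exact: leq_bigmax.
  rewrite (bigD1 i)//= (le_trans (ler_norm _))// lerDl.
  by rewrite sumr_ge0.
- have [m' [M' q']] := exQ [::]; exists (maxn m m'), (M + `|M'|).
  split; first by rewrite addr_ge0.
  move=> [_|i b bN]; last first.
    by apply: mono (q b bN i); rewrite ?leq_maxl// lerDl.
  apply: mono q'; first exact: leq_maxr.
  by rewrite (le_trans (ler_norm _))// lerDr.
Qed.

Definition weight (x : E) : R := 1 + `|x|.

Lemma weight_ge1 x : 1 <= weight x.
Proof. by rewrite lerDl. Qed.

Lemma weight_gt0 x : 0 < weight x.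
Proof. exact: lt_le_trans (weight_ge1 x). Qed.

Lemma weight_ge0 x : 0 <= weight x.
Proof. exact/ltW/weight_gt0. Qed.

Lemma weightD x v : weight (x + v) <= weight x * weight v.
Proof.
rewrite /weight mulrDl mul1r mulrDr mulr1 -addrA lerD2l addrA.
by rewrite (le_trans (ler_normD _ _))// (addrC `|v|) lerDl mulr_ge0.
Qed.

(** The seminorms used throughout: a single weight 1 + |x| instead of all
    monomials makes products and translations easy to estimate. The relation
    with a bound B replaces the supremum, which would need to be proved
    finite. *)
Definition qbound (N : nat) B f := forall b x, (size b <= N)%N ->
  weight x ^+ N * nc (partials b f x) <= B.

Lemma qbound_ge0 N B f : qbound N B f -> 0 <= B.
Proof.
move=> /(_ [::] 0 isT); apply: le_trans; rewrite mulr_ge0 ?nc_ge0//.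
by rewrite exprn_ge0// weight_ge0.
Qed.

Lemma qbound_le N N' B B' f : (N <= N')%N -> B <= B' -> qbound N' B f -> qbound N B' f.
Proof.
move=> NN BB q b x bN; rewrite (le_trans _ BB)// (le_trans _ (q b x (leq_trans bN NN)))//.
by rewrite ler_wpM2r ?nc_ge0// ler_weXn2l// weight_ge1.
Qed.

Lemma qboundE N B f b x : qbound N B f -> (size b <= N)%N ->
  nc (partials b f x) <= B / weight x ^+ N.
Proof.
by move=> q bN; rewrite ler_pdivlMr ?exprn_gt0 ?weight_gt0// mulrC q.
Qed.

Lemma qbound_lin N B B' (c : C) f g : smooth f -> smooth g ->
  qbound N B f -> qbound N B' g -> qbound N (nc c * B + B') (c *: f + g).
Proof.
move=> sf sg qf qg b x bN; rewrite partials_lin// fctE.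
rewrite (le_trans (ler_wpM2l _ (ncD _ _)))// ?exprn_ge0 ?weight_ge0// mulrDr.
by rewrite ncM mulrCA lerD ?ler_wpM2l ?nc_ge0 ?qf ?qg.
Qed.

Lemma monomial_le a x : `|monomial a x| <= weight x ^+ size a.
Proof.
rewrite /monomial; elim: a => [|i a IH]; first by rewrite big_nil normr1 expr0.
rewrite big_cons normrM exprS ler_pM// (le_trans (norm_coord x i))//.
by rewrite lerDr.
Qed.

Lemma monomial_nseq k i x : monomial (nseq k i) x = x 0 i ^+ k.
Proof.
by rewrite /monomial; elim: k => [|k IH]; rewrite ?big_nil ?expr0// big_cons exprS IH.
Qed.

Lemma exists_coord x : x = 0 \/ exists i, `|x| = `|x 0 i|.
Proof.
have [->|x0] := eqVneq x 0; [by left|right].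
have /mx_norm_neq0[[j i] /= xi] : mx_norm x != 0 by rewrite -[mx_norm x]/`|x| normr_eq0.
by exists i; rewrite -[LHS]/(mx_norm x) xi ord1.
Qed.

(** If |x| > 1, then the largest coordinate gives the power that controls the
    weight; if |x| <= 1, the constant monomial does. *)
Lemma weight_monomial N x : exists a, [/\ (size a <= N)%N,
  a = [::] \/ (exists i, a = nseq N i) & weight x ^+ N <= 2 ^+ N * `|monomial a x|].
Proof.
have [x1|x1] := leP `|x| 1.
  exists [::]; split=> //; first by left.
  rewrite /monomial big_nil normr1 mulr1 lerXn2r ?nnegrE ?weight_ge0//.
  by rewrite /weight; lra.
have [x0|[i xi]] := exists_coord x; first by rewrite x0 normr0 ltr10 in x1.
exists (nseq N i); split; [by rewrite size_nseq|by right; exists i|].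
rewrite monomial_nseq normrX -exprMn lerXn2r ?nnegrE ?weight_ge0 ?mulr_ge0//.
by rewrite -xi /weight; lra.
Qed.

Lemma rapidE a b f x M : (`|(monomial a x)%:C%C * partials b f x| <= M%:C%C) =
  (`|monomial a x| * nc (partials b f x) <= M).
Proof. by rewrite ncE lecR ncM nc_real. Qed.

Lemma schwartz_weight f b N : f \in S -> exists M, forall x,
  weight x ^+ N * nc (partials b f x) <= M.
Proof.
move=> /asboolP[_ rf].
have [M0 h0] := rf [::] b.
have /choice[F FP] : forall i, exists M, forall x,
    `|(monomial (nseq N i) x)%:C%C * partials b f x| <= M%:C%C.
  by move=> i; exact: rf.
exists (2 ^+ N * (`|M0| + \sum_i `|F i|)) => x.
have [a [_ ha wa]] := weight_monomial N x.
rewrite (le_trans (ler_wpM2r (nc_ge0 _) wa))// -mulrA ler_wpM2l ?exprn_ge0//.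
have F0 : 0 <= \sum_i `|F i| by rewrite sumr_ge0.
case: ha => [->|[i ->]].
  have := h0 x; rewrite rapidE => /le_trans; apply.
  by rewrite (le_trans (ler_norm _))// lerDl.
have := FP i x; rewrite rapidE => /le_trans; apply.
rewrite (le_trans (ler_norm _))// (bigD1 i)//= addrCA lerDl.
by rewrite addr_ge0// sumr_ge0.
Qed.

Lemma schwartz_qbound f N : f \in S -> exists B, qbound N B f.
Proof.
move=> Sf.
have [|b|_ [M [_ q]]] := @uniform_multiindex
    (fun b _ M => forall x, weight x ^+ N * nc (partials b f x) <= M) _ _ N.
- by move=> b _ _ M M' _ MM' h x; exact: le_trans (h x) MM'.
- by have [M h] := schwartz_weight b N Sf; exists 0%N, M.
- by exists M => b x bN; exact: q.
Qed.

(** Membership in the Schwartz space by coinduction: decay is only asked of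
    the functions themselves, in a class that is stable under the partial
    derivatives. *)
Lemma schwartz_coind (A : set (E -> C)) :
  (forall f, A f -> [/\ forall x, cdifferentiable f x, forall i, A (partial i f) &
     forall N, exists M, forall x, weight x ^+ N * nc (f x) <= M]) ->
  forall f, A f -> f \in S.
Proof.
move=> HA f Af; apply/asboolP; split.
  by apply: (@smooth_coind _ _ A _ f Af) => g /HA[dg pg _].
have AP b : A (partials b f) by elim: b => [//|i b /HA[_ pg _]]; exact: pg.
move=> a b; have [_ _ /(_ (size a))[M hM]] := HA _ (AP b).
exists M => x; rewrite rapidE (le_trans _ (hM x))//.
by rewrite ler_wpM2r ?nc_ge0// monomial_le.
Qed.

Lemma qbound_schwartz f : smooth f -> (forall N, exists B, qbound N B f) -> f \in S.
Proof.
move=> sf qf; apply: (@schwartz_coind [set g | exists b, g = partials b f]); last by exists [::].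
move=> _ [b ->]; split; first exact: sf.
  by move=> i; exists (i :: b).
move=> N; have [B q] := qf (maxn N (size b)); exists B => x.
rewrite (le_trans _ (q b x (leq_maxr _ _)))//.
by rewrite ler_wpM2r ?nc_ge0// ler_weXn2l ?weight_ge1// leq_maxl.
Qed.

(** The seminorms in terms of monomials, as in the topology of the space of
    test forms; see [pbound_qbound] and [qbound_pbound] for the equivalence.
    *)
Definition pbound (N : nat) B f := forall a b x, (size a <= N)%N -> (size b <= N)%N ->
  `|monomial a x| * nc (partials b f x) <= B.

Lemma pbound_qbound N B f : pbound N B f -> qbound N (2 ^+ N * B) f.
Proof.
move=> p b x bN; have [a [aN _ wa]] := weight_monomial N x.
rewrite (le_trans (ler_wpM2r (nc_ge0 _) wa))// -mulrA ler_wpM2l ?exprn_ge0//.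
exact: p.
Qed.

Lemma qbound_pbound N B f : qbound N B f -> pbound N B f.
Proof.
move=> q a b x aN bN; rewrite (le_trans _ (q b x bN))// ler_wpM2r ?nc_ge0//.
by rewrite (le_trans (monomial_le _ _))// ler_weXn2l// weight_ge1.
Qed.

(** Continuous linear operators on the Schwartz space. Functions are not
    restricted to a subtype, so linearity and bounds are asked on Schwartz
    functions only. *)
Record contop (T : (E -> C) -> E -> C) : Prop := Contop {
  contop_schwartz : forall f, f \in S -> T f \in S;
  contop_lin : forall c f g, f \in S -> g \in S -> T (c *: f + g) = c *: T f + T g;
  contop_bound : forall N, exists N' K, 0 <= K /\ forall f B, f \in S ->
    qbound N' B f -> qbound N (K * B) (T f) }.

(** Tempered distributions, as functionals on all functions of which only the
    values on Schwartz functions matter. *)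
Record tempered (L : (E -> C) -> C) : Prop := Tempered {
  tempered_lin : forall c f g, f \in S -> g \in S -> L (c *: f + g) = c * L f + L g;
  tempered_bound : exists N K, 0 <= K /\ forall f B, f \in S ->
    qbound N B f -> nc (L f) <= K * B }.

Lemma contop_comp T U : contop T -> contop U -> contop (T \o U).
Proof.
move=> [sT lT bT] [sU lU bU]; split=> [f Sf|c f g Sf Sg|N] /=.
- by apply: sT; exact: sU.
- by rewrite lU// lT// sU.
- have [N1 [K1 [K10 h1]]] := bT N; have [N2 [K2 [K20 h2]]] := bU N1.
  exists N2, (K1 * K2); split; first by rewrite mulr_ge0.
  by move=> f B Sf q; rewrite -mulrA; apply: h1; [exact: sU|exact: h2].
Qed.

Lemma contop_id : contop id.
Proof.
split=> // N; exists N, 1; split=> // f B _; by rewrite mul1r.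
Qed.

Lemma tempered_comp L T : tempered L -> contop T -> tempered (L \o T).
Proof.
move=> [lL [N [K [K0 hK]]]] [sT lT bT]; split=> [c f g Sf Sg|] /=.
  by rewrite lT// lL// sT.
have [N' [K' [K'0 h']]] := bT N; exists N', (K * K'); split; first by rewrite mulr_ge0.
by move=> f B Sf q; rewrite -mulrA; apply: hK; [exact: sT|exact: h'].
Qed.

Lemma tempered_linear_comb c L L' : tempered L -> tempered L' -> tempered (fun f => c * L f + L' f).
Proof.
move=> [lL [N [K [K0 hK]]]] [lL' [N' [K' [K'0 hK']]]]; split=> [d f g Sf Sg|].
  by rewrite lL// lL'//; ring.
exists (maxn N N'), (nc c * K + K'); split; first by rewrite addr_ge0// mulr_ge0// nc_ge0.
move=> f B Sf q; rewrite (le_trans (ncD _ _))// ncM mulrDl lerD//.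
  rewrite -mulrA ler_wpM2l ?nc_ge0// hK//.
  exact: qbound_le (leq_maxl _ _) _ q.
by rewrite hK'//; exact: qbound_le (leq_maxr _ _) _ q.
Qed.

Lemma tempered_at0 L : tempered L -> L 0 = 0.
Proof.
move=> [lL _]; have := lL 1 0 0 (rpred0 _) (rpred0 _).
rewrite scale1r addr0 mul1r => /eqP.
by rewrite -subr_eq subrr => /eqP.
Qed.

Lemma temperedZ L c f : tempered L -> f \in S -> L (c *: f) = c * L f.
Proof.
by move=> tL Sf; rewrite -[c *: f]addr0 (tempered_lin tL)// ?rpred0// tempered_at0// addr0.
Qed.

Lemma temperedD L f g : tempered L -> f \in S -> g \in S -> L (f + g) = L f + L g.
Proof. by move=> tL Sf Sg; rewrite -[f in LHS]scale1r (tempered_lin tL)// mul1r. Qed.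

Lemma temperedB L f g : tempered L -> f \in S -> g \in S -> L (f - g) = L f - L g.
Proof.
by move=> tL Sf Sg; rewrite temperedD ?rpredN// -scaleN1r temperedZ// mulN1r.
Qed.

Lemma tempered_sum (I : Type) (s : seq I) (P : pred I) (F : I -> E -> C) L :
  tempered L -> (forall k, P k -> F k \in S) ->
  L (\sum_(k <- s | P k) F k) = \sum_(k <- s | P k) L (F k).
Proof.
move=> tL SF; elim: s => [|i s IH]; first by rewrite !big_nil tempered_at0.
rewrite !big_cons; case: ifP => Pi //.
by rewrite temperedD ?IH ?SF// rpred_sum.
Qed.

Lemma contop_partial i : contop (partial i).
Proof.
split=> [f|c f g Sf Sg|N]; first exact: schwartz_partial.
  apply/funext => x; rewrite partial_lin//; apply: smooth_cdiff; exact: schwartz_smooth.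
exists N.+1, 1; split=> // f B Sf q b x bN; rewrite mul1r -partials_rcons.
have := q (rcons b i) x; rewrite size_rcons ltnS => /(_ bN); apply: le_trans.
by rewrite ler_wpM2r ?nc_ge0// exprS ler_peMl ?exprn_ge0 ?weight_ge0 ?weight_ge1.
Qed.

Section Multiplication.
Variables (P : Type) (D : set P) (gen : set (P -> E -> C)).
Hypothesis genP : forall F, gen F ->
  (forall p, D p -> forall x, cdifferentiable (F p) x) /\
  (forall i, exists2 G, generated gen G & forall p, D p -> partial i (F p) = G p).
Variables (X : set E) (w : E -> R).
Hypothesis w1 : forall x, X x -> 1 <= w x.
Hypothesis gb : forall F, gen F -> exists m M, 0 <= M /\
    forall p x, D p -> X x -> nc (F p x) <= M * w x ^+ m.

Lemma diff_op_bound N Q : diff_op gen N Q -> exists m M, 0 <= M /\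
  forall p x g B, D p -> X x -> (forall b, (size b <= N)%N -> nc (partials b g x) <= B) ->
    nc (Q p g x) <= M * w x ^+ m * B.
Proof.
have w0 x : X x -> 0 <= w x by move=> Xx; exact: le_trans ler01 (w1 Xx).
elim=> {Q} [F b aF bN|Q Q' _ [m [M [M0 hQ]]] _ [m' [M' [M'0 hQ']]]].
  have [m [M [M0 hF]]] := generated_bound w1 gb aF; exists m, M; split=> // p x g B Dp Xx hg.
  rewrite [(_ * _) x]/(_ * _) ncM ler_pM ?nc_ge0//; [exact: hF|exact: hg].
exists (m + m')%N, (M + M'); split; first by rewrite addr_ge0.
move=> p x g B Dp Xx hg; have B0 : 0 <= B by exact: le_trans (nc_ge0 _) (hg [::] isT).
rewrite (le_trans (ncD _ _))// 2!mulrDl lerD//.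
  rewrite (le_trans (hQ _ _ _ _ Dp Xx hg))// ler_wpM2r// ler_wpM2l// ler_weXn2l ?w1//.
  exact: leq_addr.
rewrite (le_trans (hQ' _ _ _ _ Dp Xx hg))// ler_wpM2r// ler_wpM2l// ler_weXn2l ?w1//.
exact: leq_addl.
Qed.

(** The weight w need not be [weight]: near the origin it will contain
    negative powers of |x|, which is why the bounds are restricted to points
    in X. *)
Lemma mul_bound F N : generated gen F -> exists m M, 0 <= M /\
  forall b, (size b <= N)%N -> forall p x g B, D p -> X x -> smooth g ->
    (forall b', (size b' <= size b)%N -> nc (partials b' g x) <= B) ->
    nc (partials b (F p * g) x) <= M * w x ^+ m * B.
Proof.
have w0 x : X x -> 0 <= w x by move=> Xx; exact: le_trans ler01 (w1 Xx).
move=> aF.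
have [|b|m [M [M0 h]]] := @uniform_multiindex (fun b m M => 0 <= M /\
   forall p x g B, D p -> X x ->
   smooth g -> (forall b', (size b' <= size b)%N -> nc (partials b' g x) <= B) ->
   nc (partials b (F p * g) x) <= M * w x ^+ m * B) _ _ N.
- move=> b m m' M M' mm MM [M0 h]; split; first exact: le_trans M0 MM.
  move=> p x g B Dp Xx sg hB.
  have B0 : 0 <= B by exact: le_trans (nc_ge0 _) (hB [::] isT).
  apply: le_trans (h p x g B Dp Xx sg hB) _; rewrite ler_wpM2r//.
  by rewrite ler_pM ?exprn_ge0 ?w0// ler_weXn2l ?w1.
- have [Q dQ eQ] := leibniz genP b aF; have [m [M [M0 h]]] := diff_op_bound dQ.
  exists m, M; split=> // p x g B Dp Xx sg hB.
  by rewrite eQ// h.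
- by exists m, M; split=> // b bN; exact: (h b bN).2.
Qed.

End Multiplication.

(** A factor of polynomial growth costs a fixed number of powers of the
    weight, which are taken from a higher seminorm of f. *)
Lemma mul_schwartz_uniform (P : Type) (D : set P) (gen : set (P -> E -> C)) F :
  (forall F, gen F ->
    (forall p, D p -> forall x, cdifferentiable (F p) x) /\
    (forall i, exists2 G, generated gen G & forall p, D p -> partial i (F p) = G p)) ->
  (forall F, gen F -> exists m M, 0 <= M /\
    forall p x, D p -> setT x -> nc (F p x) <= M * weight x ^+ m) ->
  generated gen F -> forall N, exists N' K, 0 <= K /\ forall p f B, D p -> f \in S ->
    qbound N' B f -> qbound N (K * B) (F p * f).
Proof.
move=> genP gb aF N.
have [m [M [M0 h]]] := mul_bound genP (fun x _ => weight_ge1 x) gb N aF.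
exists (N + m)%N, M; split=> // p f B Dp Sf q b x bN.
have B0 := qbound_ge0 q.
have hb b' : (size b' <= size b)%N -> nc (partials b' f x) <= B / weight x ^+ (N + m).
  by move=> b'b; rewrite (qboundE _ q)// (leq_trans b'b)// (leq_trans bN)// leq_addr.
have := h b bN p x f _ Dp Logic.I (schwartz_smooth Sf) hb.
move=> /(ler_wpM2l (exprn_ge0 N (weight_ge0 x)))/le_trans; apply.
rewrite exprD; have := weight_gt0 x; move: (weight x) => t t0.
by rewrite le_eqVlt; apply/orP; left; apply/eqP; field; rewrite !expf_neq0 ?gt_eqF.
Qed.

Lemma mul_contop (gen : set (unit -> E -> C)) F :
  (forall F, gen F ->
    (forall x, cdifferentiable (F tt) x) /\
    (forall i, exists2 G, generated gen G & partial i (F tt) = G tt)) ->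
  (forall F, gen F -> exists m M, 0 <= M /\
    forall x, nc (F tt x) <= M * weight x ^+ m) ->
  generated gen F -> contop (fun f => F tt * f).
Proof.
move=> genP gb aF.
have genP' G : gen G -> (forall p, setT p -> forall x, cdifferentiable (G p) x) /\
    (forall i, exists2 G', generated gen G' & forall p, setT p -> partial i (G p) = G' p).
  move=> /genP[dG pG]; split; first by move=> [].
  by move=> i; have [G' aG' eG'] := pG i; exists G' => // -[].
have U := mul_schwartz_uniform genP' _ aF.
have {}U N := U (fun F gF => let: ex_intro m (ex_intro M (conj M0 h)) := gb F gF in
  ex_intro _ m (ex_intro _ M (conj M0 (fun p x _ _ => match p with tt => h x end)))) N.
have sF : smooth (F tt) by exact: (generated_smooth genP' aF).
split=> [f Sf|c f g Sf Sg|N].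
- apply: qbound_schwartz; first by apply: smoothM => //; exact: schwartz_smooth.
  move=> N; have [N' [K [K0 h]]] := U N; have [B q] := schwartz_qbound N' Sf.
  by exists (K * B); exact: h.
- rewrite mulrDr; congr (_ + _); apply/funext => x; exact: mulrCA.
- have [N' [K [K0 h]]] := U N; exists N', K; split=> // f B Sf q.
  exact: h.
Qed.

Definition coordf i : E -> C := fun x => (x 0 i)%:C%C.

Lemma coord_diff i x : cdifferentiable (coordf i) x /\
  forall j, partial j (coordf i) x = (j == i)%:R.
Proof.
apply: (@quadratic_cdifferentiable _ _ _ _ _ 0) => v.
rewrite mul0r /coordf mxE (bigD1 i)//= eqxx mulr1 big1 => [|j /negbTE ->].
  by rewrite addr0 rmorphD addrAC addrK subrr nc0.
by rewrite mulr0.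
Qed.

Definition coordgen (P : Type) : set (P -> E -> C) :=
  [set F | exists i, F = fun=> coordf i].

Lemma coordgenP P (gen : set (P -> E -> C)) (D : set P) F : coordgen F ->
  (forall p, D p -> forall x, cdifferentiable (F p) x) /\
  (forall i, exists2 G, generated gen G & forall p, D p -> partial i (F p) = G p).
Proof.
move=> [i ->]; split; first by move=> p _ x; have [] := coord_diff i x.
move=> j; exists (fun=> cst (j == i)%:R); first exact: generated_cst.
by move=> p _; apply/funext => x; have [_ ->] := coord_diff i x.
Qed.

Lemma coordgen_bound P (D : set P) (X : set E) F : coordgen F -> exists m M, 0 <= M /\
  forall (p : P) x, D p -> X x -> nc (F p x) <= M * weight x ^+ m.
Proof.
move=> [i ->]; exists 1%N, 1; split=> // p x _ _.
rewrite mul1r expr1 nc_real (le_trans (norm_coord _ _))//.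
by rewrite lerDr.
Qed.

Lemma smooth_coordf i : smooth (coordf i).
Proof.
have gP F (gF : @coordgen unit F) := @coordgenP unit (@coordgen unit) setT F gF.
by apply: (@generated_smooth R n unit setT (@coordgen unit) gP (fun=> coordf i) tt) => //; apply: generated_gen; exists i.
Qed.

Lemma mul_contop_coord (F : unit -> E -> C) : generated (@coordgen unit) F ->
  contop (fun f => F tt * f).
Proof.
apply: mul_contop => G gG.
  have [dG pG] := @coordgenP unit (@coordgen unit) setT G gG; split; first exact: dG.
  by move=> i; have [G' aG' eG'] := pG i; exists G'; rewrite ?eG'.
have [m [M [M0 h]]] := @coordgen_bound unit setT setT G gG.
by exists m, M; split=> // x; exact: h.
Qed.

Lemma contop_coord i : contop (fun f => coordf i * f).
Proof.
apply: (@mul_contop_coord (fun=> coordf i)); apply: generated_gen; by exists i.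
Qed.

Lemma contopZ c : contop (fun f => c *: f).
Proof.
split=> [f Sf|d f g Sf Sg|N]; first exact: rpredZ.
  by rewrite scalerDr !scalerA mulrC.
exists N, (nc c); split; first exact: nc_ge0.
move=> f B Sf q; rewrite -[_ * B]addr0 -[c *: f]addr0.
apply: qbound_lin => //; first exact: schwartz_smooth.
  exact: smooth0.
by move=> b x _; rewrite partials0 nc0 mulr0.
Qed.

Lemma contopD T U : contop T -> contop U -> contop (fun f => T f + U f).
Proof.
move=> [sT lT bT] [sU lU bU]; split=> [f Sf|c f g Sf Sg|N].
- by rewrite rpredD ?sT ?sU.
- by rewrite lT// lU// scalerDr addrACA.
- have [N1 [K1 [K10 h1]]] := bT N; have [N2 [K2 [K20 h2]]] := bU N.
  exists (maxn N1 N2), (K1 + K2); split; first by rewrite addr_ge0.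
  move=> f B Sf q; rewrite mulrDl -[K1 * B]mul1r -nc1 -[T f]scale1r.
  apply: qbound_lin.
  + by apply: schwartz_smooth; exact: sT.
  + by apply: schwartz_smooth; exact: sU.
  + by apply: h1 => //; exact: qbound_le (leq_maxl _ _) _ q.
  + by apply: h2 => //; exact: qbound_le (leq_maxr _ _) _ q.
Qed.

Lemma contop_sum (I : Type) (s : seq I) (T : I -> (E -> C) -> E -> C) :
  (forall k, contop (T k)) -> contop (fun f => \sum_(k <- s) T k f).
Proof.
move=> cT; elim: s => [|i s IH].
  rewrite (_ : (fun _ => _) = (fun f => 0 *: f)); first exact: contopZ.
  by apply/funext => f; rewrite big_nil scale0r.
under [X in contop X]eq_fun do rewrite big_cons; exact: contopD.
Qed.

End Schwartz.

(** * Lebesgue measure on tuples *)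

Section OneDim.
Variable R : realType.
Local Notation mu := (@lebesgue_measure R).
Local Open Scope ereal_scope.

(** An integrable function of product form is needed to dominate Schwartz
    functions on tuples; (1 + |x|)^-2 has an elementary primitive on each half
    line. *)
Definition tail (x : R) : R := ((1 + `|x|) ^- 2)%R.

Lemma tail_gt0 x : (0 < tail x)%R.
Proof. by rewrite invr_gt0 exprn_gt0// ltr_wpDr. Qed.

Lemma continuous_tail : continuous tail.
Proof.
move=> x; have c1 : {for x, continuous (fun y : R => 1 + `|y|)%R}.
  by apply: cvgD; [exact: cvg_cst|exact: norm_continuous].
by apply: (continuousV _ (continuousM c1 c1)); rewrite mulf_neq0// gt_eqF// ltr_wpDr.
Qed.

Lemma integral_tail : \int[mu]_x (tail x)%:E < +oo.
Proof.
rewrite ge0_symfun_integralT; last 3 first.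
- by move=> x; exact/ltW/tail_gt0.
- exact: continuous_tail.
- by move=> x; rewrite /tail/= normrN.
rewrite (_ : [set x : R | _] = `[0%R, +oo[%classic); last first.
  by apply/seteqP; split=> x /=; rewrite in_itv/= andbT.
rewrite (@ge0_continuous_FTC2y R tail (fun x => - (1 + x)^-1)%R 0%R 0%R).
- by rewrite -EFinB -EFinM ltry.
- by move=> x _; exact/ltW/tail_gt0.
- exact/continuous_subspaceT/continuous_tail.
- rewrite -oppr0; apply: cvgN.
  have py : \forall x \near +oo%R, (0 < (1 + x : R)^-1)%R.
    by near=> x; rewrite invr_gt0 addr_gt0.
  apply/(cvgrVy py).
  rewrite (_ : unstable.inv_fun _ = (fun x : R => 1 + x)%R); first exact: cvg_addrl.
  by apply/funext => x; rewrite /= invrK.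
- move=> x x0; apply: derivableN; apply: derivableV.
    by rewrite gt_eqF// addr_gt0.
  by apply: derivableD.
- apply: cvg_at_right_filter; apply: cvgN; apply: cvgV; first by rewrite addr0 oner_neq0.
  by apply: cvgD; [exact: cvg_cst|exact: cvg_id].
- move=> x; rewrite in_itv/= andbT => x0.
  rewrite derive1E deriveN; last first.
    apply: derivableV; first by rewrite gt_eqF// addr_gt0.
    by apply: derivableD.
  rewrite deriveV; [|by rewrite gt_eqF// addr_gt0|by apply: derivableD].
  rewrite deriveD// derive_cst derive_id add0r scaleNr opprK.
  by rewrite /tail gtr0_norm// -[LHS]/(_ * 1)%R mulr1.
Unshelve. all: by end_near. Qed.

(** Lebesgue measure is characterized by the lengths of intervals, which a
    shift preserves. *)
Lemma lebesgue_measure_shift (a : R) (A : set (measurableTypeR R)) : measurable A ->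
  pushforward mu (fun x : measurableTypeR R => (x + a)%R) A = mu A.
Proof.
have mshift : measurable_fun setT (fun x : measurableTypeR R => (x + a)%R : measurableTypeR R).
  by apply: measurable_funD.
pose sh : {mfun measurableTypeR R >-> measurableTypeR R} :=
  HB.pack (fun x : measurableTypeR R => (x + a)%R : measurableTypeR R)
    (isMeasurableFun.Build _ _ _ _ _ mshift).
move=> mA; apply/esym.
apply: (@lebesgue_measure_unique R (pushforward mu sh)) => // X /ocitvP[->|[[b c] /= bc ->]].
  by rewrite !measure0.
rewrite /pushforward [X in _ = mu X](_ : _ = `](b - a)%R, (c - a)%R]%classic).
  rewrite !lebesgue_measure_itv/= !lte_fin bc ltrD2r bc -!EFinB.
  by congr (_%:E); rewrite opprB addrA subrK.
by apply/seteqP; split=> x /=; rewrite !in_itv/= ltrBlDr lerBrDr.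
Qed.

Lemma integral_shift1 (a : R) (g : measurableTypeR R -> \bar R) :
  measurable_fun setT g -> (forall x, 0 <= g x) ->
  \int[mu]_x g (x + a)%R = \int[mu]_x g x.
Proof.
move=> mg g0.
have mshift : measurable_fun setT (fun x : measurableTypeR R => (x + a)%R : measurableTypeR R).
  by apply: measurable_funD.
rewrite -[LHS](@ge0_integral_pushforward _ _ _ _ _ _ mshift mu setT g)//.
by apply: eq_measure_integral => A mA _; exact: lebesgue_measure_shift.
Qed.

End OneDim.

Section Tuples.
Variable R : realType.
Local Notation mR := (measurableTypeR R).
Local Notation mu := (@lebesgue_measure R).
Local Notation mun := (@lebesgue_tuple R).
Local Open Scope ereal_scope.

Definition row_of_tuple n (t : n.-tuple mR) : 'rV[R]_n := \row_i tnth t i.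

Definition tuple_shift n (a : 'rV[R]_n) (t : n.-tuple mR) : n.-tuple mR :=
  [tuple (tnth t i + a 0%R i)%R | i < n].

Lemma row_of_tuple_shift n a (t : n.-tuple mR) : row_of_tuple (tuple_shift a t) = (row_of_tuple t + a)%R.
Proof. by apply/rowP => i; rewrite !mxE tnth_mktuple. Qed.

Lemma measurable_tuple_shift n a : measurable_fun setT (@tuple_shift n a).
Proof.
apply/measurable_fun_tnthP => i.
rewrite (_ : _ \o _ = fun t : n.-tuple mR => (tnth t i + a 0%R i)%R); last first.
  by apply/funext => t /=; rewrite tnth_mktuple.
by apply: measurable_funD => //; exact: measurable_tnth.
Qed.

Lemma measurable_coords n (A : 'I_n -> set mR) : (forall i, measurable (A i)) ->
  measurable [set t : n.-tuple mR | forall i, A i (tnth t i)].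
Proof.
move=> mA.
have -> : [set t : n.-tuple mR | forall i, A i (tnth t i)] =
    \bigcap_(i in [set: 'I_n]) ((fun t : n.-tuple mR => tnth t i) @^-1` A i).
  by apply/seteqP; split=> t /= H i; [move=> _; exact: H|exact: (H i Logic.I)].
apply: fin_bigcap_measurable; first exact: finite_finset.
by move=> i _; rewrite -[X in measurable X]setTI; apply: measurable_tnth.
Qed.

(** The measurable sets of tuples are generated by the coordinates, not by the
    open sets, so that a continuous function needs an argument: the open set
    where it exceeds a is a countable union of cubes with rational centers. *)
Lemma measurable_row_of_tuple n (h : 'rV[R]_n -> R) : continuous h ->
  measurable_fun setT (h \o @row_of_tuple n : n.-tuple mR -> mR).
Proof.
move=> ch; apply: (measurability _ (RGenOInfty.measurableE R)).
move=> /= _ [_ [a ->]] <-; rewrite setTI.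
pose B (p : 'rV[rat]_n * nat) : set (n.-tuple mR) :=
  [set t | forall i, ball (ratr (p.1 0%R i) : R) (p.2.+1%:R^-1) (tnth t i)].
pose F p := if `[< B p `<=` (h \o @row_of_tuple n) @^-1` `]a, +oo[%classic >] then B p else set0.
suff -> : (h \o @row_of_tuple n) @^-1` `]a, +oo[%classic = \bigcup_p F p.
  apply: countable_bigcupT_measurable; first exact: countableP.
  move=> p; rewrite /F; case: asboolP => _ //.
  apply: (@measurable_coords n (fun i => ball (ratr (p.1 0%R i) : R) (p.2.+1%:R^-1))).
  by move=> i; apply: open_measurable; apply: ball_open; rewrite invr_gt0.
apply/seteqP; split=> [t /=|t [p _]]; last first.
  by rewrite /F; case: asboolP => // sB Bt; exact: sB.
rewrite in_itv/= andbT => ah.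
have := ch (row_of_tuple t); move/cvgrPdist_lt => /(_ (h (row_of_tuple t) - a)%R).
rewrite subr_gt0 => /(_ ah)/nbhs_normP[e /= e0 He].
have [k ke] : exists k : nat, (k.+1%:R^-1 < e / 2)%R.
  exists (Num.truncn (e / 2)^-1); rewrite invf_plt ?posrE ?divr_gt0//.
  exact: truncnS_gt.
have /choice[q Hq] : forall i : 'I_n, exists q : rat, (`|ratr q - (tnth t i : R)| < k.+1%:R^-1)%R.
  move=> i; have d0 : (0 < k.+1%:R^-1 :> R)%R by rewrite invr_gt0.
  have [|q] := @rat_in_itvoo R (tnth t i) (tnth t i + k.+1%:R^-1)%R.
    by rewrite ltrDl.
  rewrite in_itv/= => /andP[q1 q2]; exists q.
  by rewrite ger0_norm ?subr_ge0 ?ltW// ltrBlDl.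
exists (\row_i q i, k) => //; rewrite /F; case: asboolP => [_ i|H].
  by rewrite /ball/= mxE.
exfalso; apply: H => s Bs /=; rewrite in_itv/= andbT.
have : (`|h (row_of_tuple t) - h (row_of_tuple s)| < h (row_of_tuple t) - a)%R.
  apply: He; rewrite /ball_/=.
  have ke' : (k.+1%:R^-1 + k.+1%:R^-1 < e)%R by rewrite [ltRHS]splitr ltrD.
  apply: le_lt_trans ke'; apply: norm_le_coord; first by rewrite addr_ge0.
  move=> i; rewrite !mxE; have := Bs i; rewrite /ball/= mxE => si.
  have := Hq i; rewrite distrC => ti.
  rewrite -(subrKA (ratr (q i))) (le_trans (ler_normD _ _))// lerD// ltW//.
by move=> /(le_lt_trans (ler_norm _)); rewrite ltrD2l ltrN2.
Qed.

Definition box n (r : R) : set (n.-tuple mR) := 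
  [set t | forall i, (`|(tnth t i : R)| <= r)%R].

Lemma measurable_box n r : measurable (@box n r).
Proof.
have -> : @box n r = 
    [set t : n.-tuple mR | forall i, `[(- r)%R, r]%classic (tnth t i)].
  by apply/seteqP; split=> t H i; have := H i; rewrite /= in_itv/= -ler_norml.
by apply: (@measurable_coords n (fun=> `[(- r)%R, r]%classic)).
Qed.

Lemma lebesgue_tupleS n : mun n.+1 =
  pushforward (mu \x^ mun n) (@tcons R n) :> (set _ -> \bar R).
Proof. by []. Qed.

Lemma measure_box n (r : R) : (0 <= r)%R -> mun n (@box n r) = ((2 * r) ^+ n)%:E.
Proof.
move=> r0; elim: n => [|n IH].
  by rewrite expr0 /= diracE mem_set// => -[].
rewrite lebesgue_tupleS /pushforward.
have -> : @tcons R n @^-1` @box n.+1 r = `[(- r)%R, r]%classic `*` @box n r.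
  apply/seteqP; split=> -[x t] /=.
    move=> H; split; first by have := H ord0; rewrite in_itv/= -ler_norml.
    by move=> i; have := H (lift ord0 i); rewrite tnthS.
  rewrite in_itv/= -ler_norml => -[xr tr] i.
  by case: (unliftP ord0 i) => [j|] ->; rewrite ?tnthS.
rewrite product_measure2E//; last exact: measurable_box.
transitivity (mu `[(- r)%R, r]%classic * ((2 * r) ^+ n)%:E); first by congr (_ * _).
rewrite (@lebesgue_measure_itv R) /= lte_fin exprS EFinM; congr (_ * _).
rewrite -EFinB opprK; case: ltP; first by rewrite mulr_natl mulr2n.
move=> rr; have -> : r = 0%R by apply/eqP; rewrite eq_le r0 andbT; lra.
by rewrite mulr0.
Qed.

Lemma sigma_finite_tuple n : sigma_finite setT (mun n).
Proof.
exists (fun k => @box n k%:R).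
  apply/esym; rewrite -subTset => t _.
  exists (Num.truncn (`|row_of_tuple t|)).+1 => // i /=.
  rewrite (_ : tnth t i = row_of_tuple t 0%R i); last by rewrite mxE.
  by rewrite (le_trans (norm_coord _ _))// ltW// truncnS_gt.
by move=> k; split; [exact: measurable_box|rewrite measure_box ?ltry].
Qed.

(** A copy of the measure of the tuples on which sigma-finiteness, proved
    here, can be registered, as Tonelli's theorem asks for. *)
Definition muN n : set (n.-tuple mR) -> \bar R := mun n.

Arguments muN : clear implicits.

HB.instance Definition _ n := Measure.copy (muN n) (mun n).
HB.instance Definition _ n := @Measure_isSigmaFinite.Build _ _ _ (muN n) (@sigma_finite_tuple n).

Lemma tonelli_tuple n (f : n.+1.-tuple mR -> \bar R) : measurable_fun setT f ->
  (forall t, 0 <= f t) ->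
  \int[mun n.+1]_t f t = \int[mun n]_t \int[mu]_x f (tcons (x, t)).
Proof.
move=> mf f0.
transitivity (\int[mu \x^ muN n]_p f (tcons p)).
  rewrite -[RHS](@ge0_integral_pushforward _ _ _ _ _ _ (@measurable_tcons R n) (mu \x^ muN n) setT f)//.
transitivity (\int[mu \x muN n]_p f (tcons p)).
  apply: eq_measure_integral => A mA _; apply/esym; apply: product_measure_unique => //.
  by move=> B C mB mC; exact: (@product_measure2E _ _ _ _ R mu (muN n)).
apply: (fubini_tonelli2 (fun p => f (tcons p))) => //.
exact: (measurableT_comp mf (@measurable_tcons R n)).
Qed.

Lemma measurable_tonelli n (f : n.+1.-tuple mR -> \bar R) : measurable_fun setT f ->
  (forall t, 0 <= f t) ->
  measurable_fun setT (fun t : n.-tuple mR => \int[mu]_x f (tcons (x, t))).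
Proof.
move=> mf f0; apply: (measurable_fun_fubini_tonelli_G (fun p => f (tcons p))) => //.
exact: (measurableT_comp mf (@measurable_tcons R n)).
Qed.

Lemma tuple_shift_tcons n (a : 'rV[R]_n.+1) (x : mR) (t : n.-tuple mR) :
  tuple_shift a (tcons (x, t)) =
  tcons ((x + a 0 ord0)%R, tuple_shift (\row_i a 0 (lift ord0 i))%R t).
Proof.
apply: eq_from_tnth => i; rewrite tnth_mktuple.
case: (unliftP ord0 i) => [j|] ->; last by [].
by rewrite !tnthS tnth_mktuple mxE.
Qed.

(** By induction on the dimension: Tonelli's theorem separates the first
    coordinate, where the invariance is that of the Lebesgue measure of R. *)
Lemma integral_tuple_shift n (a : 'rV[R]_n) (f : n.-tuple mR -> \bar R) :
  measurable_fun setT f -> (forall t, 0 <= f t) ->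
  \int[mun n]_t f (tuple_shift a t) = \int[mun n]_t f t.
Proof.
elim: n a f => [|n IH] a f mf f0.
  by apply: eq_integral => t _; rewrite tuple0 [t]tuple0.
have mfa := measurableT_comp mf (measurable_tuple_shift a).
have fa0 t : 0 <= f (tuple_shift a t) by [].
rewrite (tonelli_tuple mf f0) (tonelli_tuple mfa fa0).
pose G (t : n.-tuple mR) := \int[mu]_x f (tcons (x, t)).
have mG : measurable_fun setT G by exact: measurable_tonelli.
have G0 t : 0 <= G t by apply: integral_ge0.
transitivity (\int[mun n]_t G (tuple_shift (\row_i a 0 (lift ord0 i))%R t)); last exact: IH.
apply: eq_integral => t _.
pose g (x : mR) := f (tcons (x, tuple_shift (\row_i a 0 (lift ord0 i))%R t)).
have mg : measurable_fun setT g.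
  apply: (measurableT_comp mf).
  apply: (measurableT_comp (@measurable_tcons R n)).
  exact: measurable_pair2.
transitivity (\int[mu]_x g (x + a 0%R ord0)%R); last by apply: (@integral_shift1 R (a 0%R ord0) g mg) => x; exact: f0.
apply: eq_integral => x _; by rewrite /g; congr f; exact: tuple_shift_tcons.
Qed.

Definition tails n (x : 'rV[R]_n) : R := (\prod_i tail (x 0 i))%R.

Lemma tails_gt0 n (x : 'rV[R]_n) : (0 < tails x)%R.
Proof. by apply: prodr_gt0 => i _; exact: tail_gt0. Qed.

Lemma continuous_tails n : continuous (@tails n).
Proof.
move=> x.
suff H (s : seq 'I_n) : {for x, continuous (fun y : 'rV[R]_n => \prod_(i <- s) tail (y 0 i))%R}.
  exact: H.
elim: s => [|i s IH].
  rewrite (_ : (fun _ => _) = cst 1%R); first exact: cst_continuous.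
  by apply/funext => y; rewrite big_nil.
rewrite (_ : (fun _ => _) =
    (fun y : 'rV[R]_n => tail (y 0 i) * \prod_(i <- s) tail (y 0 i))%R); last first.
  by apply/funext => y; rewrite big_cons.
have ci : {for x, continuous (@tail R \o (fun y : 'rV[R]_n => y 0%R i))}.
  by apply: continuous_comp; [exact: coord_continuous|exact: continuous_tail].
exact: (continuousM ci IH).
Qed.

Lemma integral_tails n : \int[mun n]_t (tails (row_of_tuple t))%:E < +oo.
Proof.
elim: n => [|n IH].
  have -> : (fun t => (tails (row_of_tuple t))%:E) = cst 1 :> (0.-tuple mR -> \bar R).
    by apply/funext => t; rewrite /tails big_ord0.
  by rewrite integral_cst// mul1e /= diracE mem_set// ltry.
rewrite tonelli_tuple; last 2 first.
- apply/measurable_EFinP; apply: measurable_row_of_tuple; exact: continuous_tails.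
- by move=> t; rewrite lee_fin ltW// tails_gt0.
have -> : (fun t : n.-tuple mR => \int[mu]_x (tails (row_of_tuple (tcons (x, t))))%:E) =
    fun t => (tails (row_of_tuple t))%:E * \int[mu]_x (tail x)%:E.
  apply/funext => t; rewrite -ge0_integralZl//.
  - apply: eq_integral => x _; rewrite /tails big_ord_recl -EFinM mulrC; congr (_ * _)%:E.
      by apply: eq_bigr => i _; rewrite !mxE tnthS.
    by rewrite mxE.
  - apply/measurable_EFinP; apply: continuous_measurable_fun; exact: continuous_tail.
  - by move=> x _; rewrite lee_fin ltW// tail_gt0.
  - by rewrite lee_fin ltW// tails_gt0.
rewrite ge0_integralZr//.
- rewrite lte_mul_pinfty//.
  + by apply: integral_ge0 => t _; rewrite lee_fin ltW// tails_gt0.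
  + rewrite ge0_fin_numE//; apply: integral_ge0 => t _; rewrite lee_fin ltW// tails_gt0//.
  + exact: integral_tail.
- apply/measurable_EFinP; apply: measurable_row_of_tuple; exact: continuous_tails.
- by move=> t _; rewrite lee_fin ltW// tails_gt0.
- by apply: integral_ge0 => t _; rewrite lee_fin ltW// tail_gt0.
Qed.

End Tuples.

(** * The integral of Schwartz functions *)

Section Integral.
Variables (R : realType) (n : nat).
Local Notation E := 'rV[R]_n.
Local Notation C := R[i].
Local Notation S := (@schwartz R n).
Local Notation mR := (measurableTypeR R).
Local Notation mun := (@lebesgue_tuple R).
Local Notation I := (@cintegral R n).
Implicit Types (f g : E -> C) (h : E -> R) (x v : E) (B M K : R).

Lemma weight_tails x : (weight x ^+ (n.*2))^-1 <= tails x.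
Proof.
rewrite /tails /tail prodfV lef_pV2 ?posrE ?exprn_gt0 ?weight_gt0//; last first.
  by apply: prodr_gt0 => i _; rewrite exprn_gt0// ltr_wpDr.
rewrite -mul2n exprM -[X in _ ^+ X]card_ord -prodr_const; apply: ler_prod => i _.
rewrite exprn_ge0 ?addr_ge0//= lerXn2r ?nnegrE ?weight_ge0 ?addr_ge0//.
by rewrite lerD2l norm_coord.
Qed.

Definition rintegral h : R := Rintegral (mun n) setT (fun t => h (row_of_tuple t)).

Definition tails_mass : R := fine (\int[mun n]_t (tails (row_of_tuple t))%:E)%E.

Lemma tails_massE : (\int[mun n]_t (tails (row_of_tuple t))%:E)%E = tails_mass%:E.
Proof.
rewrite /tails_mass fineK// ge0_fin_numE; first exact: integral_tails.
by apply: integral_ge0 => t _; rewrite lee_fin ltW// tails_gt0.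
Qed.

Lemma tails_mass_ge0 : 0 <= tails_mass.
Proof.
by rewrite fine_ge0//; apply: integral_ge0 => t _; rewrite lee_fin ltW// tails_gt0.
Qed.

(** The weight to the power 2 n dominates the product of the n factors (1 +
    |x_i|)^2 in [tails], so such a function is integrable. *)
Definition dominated h M := continuous h /\ forall x, `|h x| <= M / weight x ^+ (n.*2).

Lemma dominated_tails h M x : dominated h M -> `|h x| <= M * tails x.
Proof.
move=> [_ hM]; have M0 : 0 <= M.
  have := le_trans (normr_ge0 _) (hM 0); rewrite /weight normr0 addr0 expr1n divr1//.
by rewrite (le_trans (hM x))// ler_wpM2l// weight_tails.
Qed.

Lemma measurable_EFin_row_of_tuple h : continuous h ->
  measurable_fun setT (fun t : n.-tuple mR => (h (row_of_tuple t))%:E).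
Proof. by move=> ch; apply/measurable_EFinP; exact: measurable_row_of_tuple. Qed.

Lemma integral_dominated h M : dominated h M ->
  (\int[mun n]_t `|(h (row_of_tuple t))%:E| <= (M * tails_mass)%:E)%E.
Proof.
move=> dh; have M0 : 0 <= M.
  have := le_trans (normr_ge0 _) (dh.2 0); rewrite /weight normr0 addr0 expr1n divr1//.
rewrite EFinM -tails_massE -ge0_integralZl//; last 2 first.
- by apply: measurable_EFin_row_of_tuple; exact: continuous_tails.
- by move=> t _; rewrite lee_fin ltW// tails_gt0.
apply: ge0_le_integral => //.
- by apply: measurableT_comp => //; apply: measurable_EFin_row_of_tuple; exact: dh.1.
- exact: (measurable_funeM M%:E (measurable_EFin_row_of_tuple (@continuous_tails R n))).
- by move=> t _; rewrite -EFinM lee_fin; exact: dominated_tails.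
Qed.

Lemma integrable_dominated h M : dominated h M ->
  (mun n).-integrable setT (EFin \o (fun t => h (row_of_tuple t))).
Proof.
move=> dh; apply/integrableP; split.
  by apply: measurable_EFin_row_of_tuple; exact: dh.1.
exact: le_lt_trans (integral_dominated dh) (ltry _).
Qed.

Lemma rintegral_bound h M : dominated h M -> `|rintegral h| <= M * tails_mass.
Proof.
move=> dh; have ih := integrable_dominated dh.
rewrite (le_trans (le_normr_Rintegral measurableT ih))//.
rewrite -lee_fin (le_trans _ (integral_dominated dh))//.
rewrite /Rintegral fineK//.
rewrite ge0_fin_numE; last by apply: integral_ge0 => t _; rewrite lee_fin.
by apply: le_lt_trans (integral_dominated dh) (ltry _).
Qed.

Lemma dominatedD a h h' M M' : dominated h M -> dominated h' M' ->
  dominated (fun x => a * h x + h' x) (`|a| * M + M').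
Proof.
move=> [ch hM] [ch' hM']; split.
  move=> x; apply: continuousD (ch' x).
  by apply: continuousM (ch x); exact: cst_continuous.
move=> x; rewrite mulrDl (le_trans (ler_normD _ _))// lerD//.
by rewrite normrM -mulrA ler_wpM2l.
Qed.

Lemma rintegral_lin a h h' M M' : dominated h M -> dominated h' M' ->
  rintegral (fun x => a * h x + h' x) = a * rintegral h + rintegral h'.
Proof.
move=> dh dh'; rewrite /rintegral RintegralD//.
- by rewrite RintegralZl//; exact: integrable_dominated dh.
- have d0 : dominated (fun=> 0) 0.
    split; first exact: cst_continuous.
    by move=> x; rewrite normr0 mul0r.
  have := integrable_dominated (dominatedD a dh d0).
  by under eq_fun do rewrite addr0.
- exact: integrable_dominated dh'.
Qed.

Lemma rintegral_shift h a : continuous h -> rintegral (fun x => h (x + a)) = rintegral h.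
Proof.
move=> ch; rewrite /rintegral /Rintegral; congr fine.
pose F (t : n.-tuple mR) := (h (row_of_tuple t))%:E.
have mF : measurable_fun setT F by exact: measurable_EFin_row_of_tuple.
have -> : (fun t : n.-tuple mR => (h (row_of_tuple t + a))%:E) = fun t => F (tuple_shift a t).
  by apply/funext => t; rewrite /F row_of_tuple_shift.
set Fa := fun t => F (tuple_shift a t).
have eP : (\int[mun n]_t Fa^\+ t = \int[mun n]_t F^\+ t)%E.
  rewrite -(integral_tuple_shift a (measurable_funepos mF)); last by [].
  by apply: eq_integral => t _; rewrite !funeposE.
have eN : (\int[mun n]_t Fa^\- t = \int[mun n]_t F^\- t)%E.
  rewrite -(integral_tuple_shift a (measurable_funeneg mF)); last by [].
  by apply: eq_integral => t _; rewrite !funenegE.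
by rewrite integralE eP eN -integralE.
Qed.

(** If the integral were 0, the positive function h would vanish almost
    everywhere, and a cube would have measure 0. *)
Lemma rintegral_gt0 h M : dominated h M -> (forall x, 0 < h x) -> 0 < rintegral h.
Proof.
move=> dh h0.
have I0 : 0 <= rintegral h by apply: Rintegral_ge0 => t _; rewrite ltW.
rewrite lt_neqAle I0 andbT; apply/negP => /eqP e.
have fi : ((\int[mun n]_t (h (row_of_tuple t))%:E) \is a fin_num)%E.
  rewrite ge0_fin_numE; last by apply: integral_ge0 => t _; rewrite lee_fin ltW.
  have := le_lt_trans (integral_dominated dh) (ltry _).
  by under eq_integral do rewrite /= gtr0_norm//.
have eI : (\int[mun n]_t `|(h (row_of_tuple t))%:E| = 0)%E.
  transitivity ((\int[mun n]_t (h (row_of_tuple t))%:E)%E).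
    by apply: eq_integral => t _; rewrite /= gtr0_norm.
  by rewrite -(fineK fi) [X in X%:E](esym e).
have /(ae_eq_integral_abs _ measurableT (measurable_EFin_row_of_tuple dh.1)) [N [mN N0 HN]] := eI.
have NT : N = setT.
  rewrite -subTset; apply: subset_trans HN => t _ /= H.
  by have := H Logic.I; move=> [] /eqP; rewrite gt_eqF.
have : (mun n (@box R n 1) <= mun n N)%E.
  rewrite le_measure ?inE//; first exact: measurable_box.
  by rewrite NT.
rewrite measure_box// N0 lee_fin leNgt exprn_gt0// mulr1.
Qed.

Lemma cintegralE f : I f = Complex (rintegral (re_fun f)) (rintegral (im_fun f)).
Proof. by []. Qed.

Definition cdominated f M := dominated (re_fun f) M /\ dominated (im_fun f) M.

Lemma cdominatedP f M : (forall x, cdifferentiable f x) ->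
  (forall x, nc (f x) <= M / weight x ^+ (n.*2)) -> cdominated f M.
Proof.
move=> df fM; split; split.
- by move=> x; apply: differentiable_continuous; exact: (df x).1.
- by move=> x; exact: le_trans (nc_Re _) (fM x).
- by move=> x; apply: differentiable_continuous; exact: (df x).2.
- by move=> x; exact: le_trans (nc_Im _) (fM x).
Qed.

Lemma schwartz_dominated f : f \in S -> exists M, cdominated f M.
Proof.
move=> Sf; have [B q] := schwartz_qbound (n.*2) Sf; exists B.
apply: cdominatedP => x; first exact/smooth_cdiff/schwartz_smooth.
exact: (qboundE (b := [::]) x q).
Qed.

Lemma cintegral_bound f M : cdominated f M -> nc (I f) <= 2 * tails_mass * M.
Proof.
move=> [d1 d2]; rewrite cintegralE (le_trans (nc_le_ReIm _))//=.
have := rintegral_bound d1; have := rintegral_bound d2.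
move: (rintegral _) (rintegral _) => a b; rewrite (mulrC M); lra.
Qed.

Lemma cintegral_lin c f g M M' : cdominated f M -> cdominated g M' ->
  I (c *: f + g) = c * I f + I g.
Proof.
move=> [f1 f2] [g1 g2]; rewrite !cintegralE re_fun_lin im_fun_lin.
case: c => a b /=.
have e1 : rintegral (a *: re_fun f + (- b *: im_fun f + re_fun g)) =
    a * rintegral (re_fun f) + (- b * rintegral (im_fun f) + rintegral (re_fun g)).
  by rewrite -(rintegral_lin (- b) f2 g1) -(rintegral_lin a f1 (dominatedD (- b) f2 g1)).
have e2 : rintegral (a *: im_fun f + (b *: re_fun f + im_fun g)) =
    a * rintegral (im_fun f) + (b * rintegral (re_fun f) + rintegral (im_fun g)).
  by rewrite -(rintegral_lin b f1 g2) -(rintegral_lin a f2 (dominatedD b f1 g2)).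
by rewrite e1 e2; apply/eqP; rewrite eq_complex/= !addrA mulNr !eqxx.
Qed.

Lemma tempered_cintegral : tempered I.
Proof.
split=> [c f g Sf Sg|].
  have [M fM] := schwartz_dominated Sf; have [M' gM'] := schwartz_dominated Sg.
  exact: cintegral_lin fM gM'.
exists (n.*2), (2 * tails_mass); split; first by rewrite mulr_ge0// tails_mass_ge0.
move=> f B Sf q; apply: cintegral_bound; apply: cdominatedP => x.
  exact/smooth_cdiff/schwartz_smooth.
exact: (qboundE (b := [::]) x q).
Qed.

Definition translate (a : E) f : E -> C := fun x => f (x + a).

Lemma cintegral_translate a f : f \in S -> I (translate a f) = I f.
Proof.
move=> Sf; have [M [[c1 _] [c2 _]]] := schwartz_dominated Sf.
by rewrite !cintegralE -(rintegral_shift a c1) -(rintegral_shift a c2).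
Qed.

Lemma translate_cdiff a f x : cdifferentiable f (x + a) ->
  cdifferentiable (translate a f) x /\
  forall i, partial i (translate a f) x = partial i f (x + a).
Proof.
move=> [d1 d2]; split; first by split; [exact: (differentiable_shift_vec d1)|exact: (differentiable_shift_vec d2)].
move=> i; rewrite /partial -(derive_shift_vec (re_fun f)) -(derive_shift_vec (im_fun f)).
by [].
Qed.

Lemma schwartz_translate a f : f \in S -> translate a f \in S.
Proof.
move=> Sf; apply: (@schwartz_coind _ _ [set g | exists2 f, f \in S & g = translate a f]); last by exists f.
move=> _ [g Sg ->]; have sg := schwartz_smooth Sg; split.
- by move=> x; have [] := translate_cdiff (smooth_cdiff (x + a) sg).
- move=> i; exists (partial i g); first exact: schwartz_partial.
  by apply/funext => x; have [_ ->] := translate_cdiff (smooth_cdiff (x + a) sg).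
- move=> N; have [M gM] := schwartz_weight [::] N Sg; exists (weight (- a) ^+ N * M) => x.
  have -> : weight x = weight (x + a + - a) by rewrite addrK.
  rewrite (le_trans (ler_wpM2r (nc_ge0 _) (lerXn2r _ _ _ (weightD _ _))))// ?nnegrE ?mulr_ge0 ?weight_ge0//.
  by rewrite exprMn mulrAC mulrC ler_wpM2l ?exprn_ge0 ?weight_ge0//; exact: gM.
Qed.

End Integral.

Section IBP.
Variables (R : realType) (n : nat).
Local Notation E := 'rV[R]_n.
Local Notation C := R[i].
Local Notation ee i := (delta_mx 0 i : E).
Local Notation S := (@schwartz R n).
Local Notation I := (@cintegral R n).
Implicit Types (f g : E -> C) (h : E -> R) (x v : E) (B M K : R).

Lemma small_eq0 (a K : R) : 0 <= a -> (forall t, 0 < t -> t <= 1 -> a <= t * K) -> a = 0.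
Proof.
move=> a0 H; apply/eqP; rewrite eq_le a0 andbT leNgt; apply/negP => ap.
have K0 : 0 < K by have := H 1 ltr01 (lexx _); rewrite mul1r; exact: lt_le_trans.
have Kn : K != 0 by rewrite gt_eqF.
have t0 : 0 < Num.min 1 (a / (2 * K)).
  by rewrite lt_min ltr01 divr_gt0// mulr_gt0.
have t1 : Num.min 1 (a / (2 * K)) <= 1 by rewrite ge_min lexx.
have := H _ t0 t1; apply/negP; rewrite -ltNge.
have : Num.min 1 (a / (2 * K)) <= a / (2 * K) by rewrite ge_min lexx orbT.
move=> /(ler_wpM2r (ltW K0))/le_lt_trans; apply.
have -> : a / (2 * K) * K = a / 2 by field.
by rewrite ltr_pdivrMr// mulr_natr mulr2n ltrDl.
Qed.

Lemma second_order_real h i x (t A : R) : 0 <= t -> (forall y, differentiable h y) ->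
  (forall y, differentiable ('D_(ee i) h) y) ->
  (forall s : R, 0 <= s <= t -> `|'D_(ee i) ('D_(ee i) h) (x + s *: ee i)| <= A) ->
  `|h (x + t *: ee i) - h x - t * 'D_(ee i) h x| <= t ^+ 2 * A.
Proof.
move=> t0 dh dih HA.
have [s /andP[s0 s1] ->] := MVT_ray x (t *: ee i) dh.
rewrite deriveZv// -mulrBr scalerA normrM (ger0_norm t0) expr2 -mulrA ler_wpM2l//.
have [r /andP[r0 r1] ->] := MVT_ray x ((s * t) *: ee i) dih.
rewrite deriveZv// scalerA normrM (ger0_norm (mulr_ge0 s0 t0)).
apply: ler_pM => //; first exact: mulr_ge0.
  by rewrite ler_piMl.
apply: HA; rewrite !mulr_ge0//= mulrA ler_piMl//.
by rewrite mulr_ile1.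
Qed.

(** By translation invariance the integral of (f (x + t e_i) - f x) / t is 0,
    and this quotient differs from the derivative by O(t) times an integrable
    function. This proof spares the fundamental theorem of calculus and a
    second use of Fubini's theorem. *)
Lemma cintegral_partial i f : f \in S -> I (partial i f) = 0.
Proof.
move=> Sf; have sf := schwartz_smooth Sf.
have [B q] := schwartz_qbound ((n.*2).+2) Sf.
have B0 := qbound_ge0 q.
apply/eqP; rewrite -nc_eq0; apply/eqP.
apply: (@small_eq0 _ (2 * tails_mass R n * (2 * (B * 2 ^+ (n.*2))))); first exact: nc_ge0.
move=> t t0 t1.
(* The integral of g is - t times that of the derivative, and g is O(t^2). *)
pose g := translate (t *: ee i) f - f - t%:C%C *: partial i f.
have Sg : g \in S by rewrite !rpredB ?rpredZ ?schwartz_partial// schwartz_translate.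
have Ig : I g = - (t%:C%C * I (partial i f)).
  have tI := tempered_cintegral R n.
  rewrite (temperedB tI) ?rpredB ?rpredZ ?schwartz_partial ?schwartz_translate//.
  rewrite (temperedB tI) ?schwartz_translate// (temperedZ _ tI) ?schwartz_partial//.
  by rewrite cintegral_translate// subrr sub0r.
have gb x : nc (g x) <= (t ^+ 2 * (2 * (B * 2 ^+ (n.*2)))) / weight x ^+ (n.*2).
  have A (s : R) : 0 <= s <= t -> nc (partial i (partial i f) (x + s *: ee i)) <=
      B * 2 ^+ (n.*2) / weight x ^+ (n.*2).
    move=> /andP[s0 st].
    have := q [:: i; i] (x + s *: ee i) isT.
    set y := x + s *: ee i => qy.
    have wxy : weight x ^+ (n.*2) <= weight y ^+ (n.*2) * 2 ^+ (n.*2).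
      rewrite -exprMn lerXn2r ?nnegrE ?mulr_ge0 ?weight_ge0//.
      have -> : x = y + - (s *: ee i) by rewrite addrK.
      rewrite (le_trans (weightD _ _))// ler_wpM2l ?weight_ge0//.
      rewrite /weight normrN normrZ ger0_norm// (_ : 2 = 1 + 1)// lerD2l.
      by rewrite mulr_ile1 ?norm_ee// (le_trans st).
    rewrite ler_pdivlMr ?exprn_gt0 ?weight_gt0//.
    rewrite (le_trans (ler_wpM2l (nc_ge0 _) wxy))// mulrA ler_wpM2r ?exprn_ge0//.
    rewrite (le_trans _ qy)// mulrC ler_wpM2r ?nc_ge0// ler_weXn2l ?weight_ge1//.
    by rewrite (leq_trans (leqnSn _))// leqnSn.
  have Re := @second_order_real (re_fun f) i x t (B * 2 ^+ (n.*2) / weight x ^+ (n.*2))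
     (ltW t0) (fun y => (sf [::] y).1) (fun y => (sf [:: i] y).1)
     (fun s hs => le_trans (nc_Re (partial i (partial i f) (x + s *: ee i))) (A s hs)).
  have Im := @second_order_real (im_fun f) i x t (B * 2 ^+ (n.*2) / weight x ^+ (n.*2))
     (ltW t0) (fun y => (sf [::] y).2) (fun y => (sf [:: i] y).2)
     (fun s hs => le_trans (nc_Im (partial i (partial i f) (x + s *: ee i))) (A s hs)).
  have ReE : complex.Re (g x) = re_fun f (x + t *: ee i) - re_fun f x - t * 'D_(ee i) (re_fun f) x.
    rewrite -[g x]/(f (x + t *: ee i) - f x - t%:C%C * partial i f x).
    by rewrite !ReB Re_realM.
  have ImE : complex.Im (g x) = im_fun f (x + t *: ee i) - im_fun f x - t * 'D_(ee i) (im_fun f) x.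
    rewrite -[g x]/(f (x + t *: ee i) - f x - t%:C%C * partial i f x).
    by rewrite !ImB Im_realM.
  rewrite (le_trans (nc_le_ReIm _))// ReE ImE (le_trans (lerD Re Im))//.
  by move: (weight x ^+ _)^-1 => w; rewrite le_eqVlt; apply/orP; left; apply/eqP; ring.
have := cintegral_bound (cdominatedP (fun x => smooth_cdiff x (schwartz_smooth Sg)) gb).
rewrite Ig ncN ncM nc_real gtr0_norm// expr2.
set K := 2 * (B * _) => H; rewrite -(ler_pM2l t0) (le_trans H)//.
by rewrite le_eqVlt; apply/orP; left; apply/eqP; ring.
Qed.

End IBP.

(** * The Gaussian *)

Section Gauss.
Variables (R : realType) (n : nat).
Local Notation E := 'rV[R]_n.
Local Notation C := R[i].
Local Notation ee i := (delta_mx 0 i : E).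
Local Notation S := (@schwartz R n).
Implicit Types (f g : E -> C) (h : E -> R) (x v : E) (B M K : R).

Definition sq (x : E) : R := \sum_i x 0 i ^+ 2.

Lemma sq_ge0 x : 0 <= sq x.
Proof. by apply: sumr_ge0 => i _; rewrite sqr_ge0. Qed.

Lemma norm_le_sq x : `|x| ^+ 2 <= sq x.
Proof.
have [->|[i ->]] := exists_coord x; first by rewrite normr0 expr0n/= sq_ge0.
rewrite real_normK ?num_real// /sq (bigD1 i)//= lerDl.
by apply: sumr_ge0 => j _; rewrite sqr_ge0.
Qed.

Lemma sq_le_norm x : sq x <= n%:R * `|x| ^+ 2.
Proof.
rewrite mulr_natl -[X in _ *+ X](card_ord n) -sumr_const; apply: ler_sum => i _.
by rewrite -[leLHS]real_normK ?num_real// lerXn2r ?nnegrE// norm_coord.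
Qed.

Lemma sq_diff x : differentiable sq x /\ forall i, 'D_(ee i) sq x = 2 * x 0 i.
Proof.
apply: (@quadratic_differentiable _ _ _ _ _ n%:R) => v.
have -> : sq (x + v) - sq x - \sum_i v 0 i * (2 * x 0 i) = sq v.
  rewrite /sq -!sumrB; apply: eq_bigr => i _; rewrite mxE; ring.
by rewrite ger0_norm ?sq_ge0// sq_le_norm.
Qed.

Definition gauss (x : E) : C := (expR (- (2^-1) * sq x))%:C%C.

Lemma expR_sq_diff (c : R) x : differentiable (fun y => expR (c * sq y)) x /\
  forall i, 'D_(ee i) (fun y => expR (c * sq y)) x = 2 * c * x 0 i * expR (c * sq x).
Proof.
have [ds es] := sq_diff x.
have dcs : differentiable (c *: sq) x by exact: differentiableZ.
have D v := derive_comp v (is_derive_expR (c * sq x)) dcs.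
split; first exact: (D 0).1.
move=> i; have [_ ->] := D (ee i).
rewrite deriveZ; last exact: diff_derivable.
by rewrite es /GRing.scale/=; ring.
Qed.

Lemma cdifferentiable_gauss x : cdifferentiable gauss x.
Proof. by apply: cdifferentiable_real; exact: (expR_sq_diff _ x).1. Qed.

Lemma partial_gauss i : partial i gauss = (- 1) *: (coordf i * gauss).
Proof.
apply/funext => x; rewrite partial_real (expR_sq_diff _ x).2.
rewrite -[RHS]/(- 1 * ((x 0 i)%:C%C * gauss x)) /gauss -rmorphM/=.
by rewrite mulN1r -rmorphN/=; congr (_%:C%C); field.
Qed.

(** With m = N + 1, 1 + t is at most d exp (c t^2 / m) for a large enough d,
    since exp y >= 1 + y; then take m-th powers. *)
Lemma exp_poly_bound N (c : R) : 0 < c -> exists M : R, forall t : R, 0 <= t ->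
  (1 + t) ^+ N * expR (- c * t ^+ 2) <= M.
Proof.
move=> c0; pose m := N.+1; pose d := Num.max 2 (m%:R / c).
have m0 : 0 < m%:R :> R by rewrite ltr0n.
exists (d ^+ m) => t t0.
have t20 : 0 <= t ^+ 2 by exact: sqr_ge0.
have d2 : 2 <= d by rewrite le_max lexx.
have dm : m%:R / c <= d by rewrite le_max lexx orbT.
have key : 1 + t <= d * expR (c * t ^+ 2 / m%:R).
  have e1 : 1 + c * t ^+ 2 / m%:R <= expR (c * t ^+ 2 / m%:R) by exact: expR_ge1Dx.
  have : d * (1 + c * t ^+ 2 / m%:R) <= d * expR (c * t ^+ 2 / m%:R).
    by rewrite ler_wpM2l// (le_trans _ d2).
  apply: le_trans; rewrite mulrDr mulr1.
  have : t ^+ 2 <= d * (c * t ^+ 2 / m%:R).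
    have -> : d * (c * t ^+ 2 / m%:R) = (d * (c / m%:R)) * t ^+ 2.
      by rewrite !mulrA; ring.
    rewrite ler_peMl// -[c / _]invf_div ler_pdivlMr ?mul1r// divr_gt0//.
  have := sqr_ge0 (t - 1); move: (d * _) d2 => u; move: (d) => w; nra.
have -> : - c * t ^+ 2 = - (c * t ^+ 2) by rewrite mulNr.
rewrite expRN ler_pdivrMr ?expR_gt0//.
have -> : expR (c * t ^+ 2) = expR (c * t ^+ 2 / m%:R) ^+ m.
  by rewrite -expRM_natl; congr expR; field; rewrite gt_eqF.
rewrite -exprMn (@le_trans _ _ ((1 + t) ^+ m))//.
  by rewrite ler_weXn2l// lerDl.
by rewrite lerXn2r ?nnegrE ?addr_ge0// (le_trans _ key)// addr_ge0.
Qed.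

(** The products of polynomials with the Gaussian are stable under the partial
    derivatives. *)
Lemma schwartz_gauss : gauss \in S.
Proof.
pose gen := @coordgen R n unit.
have genP F (gF : gen F) := @coordgenP R n unit gen setT F gF.
apply: (@schwartz_coind _ _ [set f | exists2 F, generated gen F & f = F tt * gauss]); last first.
  exists (fun=> cst 1); first exact: generated_cst.
  by apply/funext => x; rewrite -[RHS]/(1 * gauss x) mul1r.
move=> _ [F aF ->]; have [dF pF] := generated_diff genP aF; split.
- by move=> x; apply: cdifferentiableM; [exact: dF|exact: cdifferentiable_gauss].
- move=> i; have [G aG eG] := pF i.
  exists (fun p => G p + cst (- 1) * ((fun=> coordf i) p * F p)).
    apply: generated_add => //; apply: (@generated_mul _ _ _ _ (fun=> cst (-1))); first exact: generated_cst.
    by apply: (@generated_mul _ _ _ _ (fun=> coordf i)) => //; apply: generated_gen; exists i.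
  apply/funext => x; rewrite partialM; [|exact: dF|exact: cdifferentiable_gauss].
  rewrite eG// partial_gauss.
  rewrite -[(_ *: _) x]/(- 1 * (coordf i x * gauss x)).
  rewrite -[RHS]/((G tt x + - 1 * (coordf i x * F tt x)) * gauss x).
  move: (G tt x) (F tt x) (coordf i x) (gauss x) => a b c d; ring.
- move=> N.
  have [m [M [M0 hM]]] := generated_bound (fun x _ => weight_ge1 x)
    (@coordgen_bound R n unit setT setT) aF.
  have [K hK] := @exp_poly_bound (N + m) 2^-1 ltac:(by rewrite invr_gt0).
  exists (M * K) => x.
  rewrite -[(_ * _) x]/(F tt x * gauss x) ncM nc_real gtr0_norm ?expR_gt0//.
  rewrite mulrA (mulrC (_ ^+ N)).
  have := hM tt x Logic.I Logic.I => /(ler_wpM2r (exprn_ge0 N (weight_ge0 x)))/(ler_wpM2r (expR_ge0 (- 2^-1 * sq x))).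
  move/le_trans; apply; rewrite -!mulrA ler_wpM2l//.
  rewrite mulrA -exprD addnC (le_trans _ (hK `|x| (normr_ge0 _)))//.
  rewrite ler_wpM2l ?exprn_ge0 ?weight_ge0// ler_expR.
  by rewrite !mulNr lerN2 ler_wpM2l ?invr_ge0// norm_le_sq.
Qed.

Lemma gauss_neq0 x : gauss x != 0.
Proof. by rewrite -nc_eq0 nc_real normr_eq0 gt_eqF// expR_gt0. Qed.

Lemma gauss0 : gauss 0 = 1.
Proof.
by rewrite /gauss /sq big1 ?mulr0 ?expR0// => i _; rewrite mxE expr0n.
Qed.

Lemma cintegral_gauss : @cintegral R n gauss != 0.
Proof.
have [M [dM _]] := schwartz_dominated schwartz_gauss.
have := rintegral_gt0 dM (fun x => expR_gt0 _).
rewrite cintegralE eq_complex negb_and => H.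
by rewrite gt_eqF.
Qed.

End Gauss.

(** * The Fourier transform *)

Section Character.
Variables (R : realType) (n : nat).
Local Notation E := 'rV[R]_n.
Local Notation C := R[i].
Implicit Types (f g : E -> C) (h : E -> R) (x v xi : E) (B M K : R).

(** Starting from |cos| <= 1, each bound follows from the previous one by the
    mean value theorem. *)
Lemma cos1_bound_pos (x : R) : 0 <= x -> `|sin x| <= x /\ `|cos x - 1| <= x /\
  `|cos x - 1| <= x ^+ 2 /\ `|sin x - x| <= x ^+ 2.
Proof.
have cwin (f : R -> R) a : continuous f -> {within `[0, a], continuous f}.
  by move=> cf; apply: continuous_subspaceT.
have S1 (y : R) : 0 <= y -> `|sin y| <= y.
  move=> y0; have [c _] := MVT_segment y0 (fun z _ => is_derive_sin z) (cwin _ _ (@continuous_sin R)).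
  rewrite sin0 !subr0 => ->; rewrite normrM (ger0_norm y0) ler_piMl// cos_max//.
have C1 (y : R) : 0 <= y -> `|cos y - 1| <= y /\ `|cos y - 1| <= y ^+ 2.
  move=> y0; have [c] := MVT_segment y0 (fun z _ => is_derive_cos z) (cwin _ _ (@continuous_cos R)).
  rewrite in_itv/= => /andP[c0 cy]; rewrite cos0 subr0 => ->.
  rewrite normrM normrN (ger0_norm y0); split; first by rewrite ler_piMl// sin_max.
  by rewrite expr2 ler_wpM2r// (le_trans (S1 c c0)).
move=> x0; have [c1 c2] := C1 x x0; split; [exact: S1|split=> //; split=> //].
have d z : z \in `]0, x[ -> is_derive z 1 (fun z : R => sin z - z) (cos z - 1).
  by move=> _; apply: is_deriveB.
have cs : continuous (fun z : R => sin z - z).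
  by move=> z; apply: cvgB; [exact: continuous_sin|exact: cvg_id].
have [c] := MVT_segment x0 d (cwin _ _ cs).
rewrite in_itv/= => /andP[c0 cx]; rewrite sin0 !subr0 => ->.
rewrite normrM (ger0_norm x0) expr2 ler_wpM2r//.
by rewrite (le_trans (C1 c c0).1).
Qed.

Lemma trig_bound (x : R) : `|cos x - 1| <= x ^+ 2 /\ `|sin x - x| <= x ^+ 2.
Proof.
have [x0|x0] := leP 0 x.
  by have [_ [_ ?]] := cos1_bound_pos x0.
have [|_ [_ [H1 H2]]] := @cos1_bound_pos (- x); first by rewrite oppr_ge0 ltW.
move: H1 H2; rewrite cosN sinN sqrrN => H1.
by rewrite -opprD normrN.
Qed.

(** This is exp (- i t). *)
Definition cexp (t : R) : C := Complex (cos t) (- sin t).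

Lemma cexpD s t : cexp (s + t) = cexp s * cexp t.
Proof.
apply/eqP; rewrite eq_complex/= cosD sinD; apply/andP; split; apply/eqP; ring.
Qed.

Lemma cexp0 : cexp 0 = 1.
Proof. by rewrite /cexp cos0 sin0 oppr0. Qed.

Lemma nc_cexp t : nc (cexp t) = 1.
Proof. by rewrite /= sqrrN cos2Dsin2 sqrtr1. Qed.

Lemma cexp_bound t : nc (cexp t - 1 + 'i%C * t%:C%C) <= 2 * t ^+ 2.
Proof.
have [c s] := trig_bound t; rewrite (le_trans (nc_le_ReIm _))//.
rewrite mulr_natl mulr2n lerD//=.
  by move: c; congr (`|_| <= _); ring.
by move: s; rewrite -normrN; congr (`|_| <= _); ring.
Qed.

Definition dot (x y : E) : R := \sum_i x 0 i * y 0 i.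

Lemma dotC x y : dot x y = dot y x.
Proof. by apply: eq_bigr => i _; rewrite mulrC. Qed.

Lemma dotDr (x y z : E) : dot x (y + z) = dot x y + dot x z.
Proof. by rewrite -big_split; apply: eq_bigr => i _; rewrite mxE mulrDr. Qed.

Lemma dot_bound x y : `|dot x y| <= n%:R * (`|x| * `|y|).
Proof.
rewrite (le_trans (ler_norm_sum _ _ _))// mulr_natl -[X in _ *+ X](card_ord n) -sumr_const.
by apply: ler_sum => i _; rewrite normrM ler_pM ?norm_coord.
Qed.

(** The character x |-> exp (- i xi.x). *)
Definition chr xi : E -> C := fun x => cexp (dot xi x).

Lemma chrD xi v x : chr (xi + v) x = chr xi x * chr v x.
Proof. by rewrite /chr dotC dotDr cexpD ![dot x _]dotC. Qed.

Lemma chrC xi x : chr xi x = chr x xi.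
Proof. by rewrite /chr dotC. Qed.

Lemma chr0 x : chr 0 x = 1.
Proof. by rewrite /chr /dot big1 ?cexp0// => i _; rewrite mxE mul0r. Qed.

Lemma nc_chr xi x : nc (chr xi x) = 1.
Proof. exact: nc_cexp. Qed.

Lemma chr_diff xi x : cdifferentiable (chr xi) x /\
  forall i, partial i (chr xi) x = - 'i%C * (xi 0 i)%:C%C * chr xi x.
Proof.
apply: (@quadratic_cdifferentiable _ _ _ _ _ (2 * (n%:R * `|xi|) ^+ 2)) => v.
have -> : \sum_i (v 0 i)%:C%C * (- 'i%C * (xi 0 i)%:C%C * chr xi x) =
    - ('i%C * (dot xi v)%:C%C) * chr xi x.
  rewrite /dot rmorph_sum/= -mulNr mulr_sumr mulr_suml; apply: eq_bigr => i _.
  by rewrite rmorphM/=; ring.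
have -> : chr xi (x + v) = chr xi x * cexp (dot xi v) by rewrite /chr dotDr cexpD.
have -> : chr xi x * cexp (dot xi v) - chr xi x - - ('i%C * (dot xi v)%:C%C) * chr xi x =
    chr xi x * (cexp (dot xi v) - 1 + 'i%C * (dot xi v)%:C%C) by ring.
rewrite ncM nc_chr mul1r (le_trans (cexp_bound _))// -mulrA -exprMn ler_wpM2l//.
rewrite -[leLHS]real_normK ?num_real// lerXn2r ?nnegrE ?mulr_ge0//.
by rewrite -mulrA dot_bound.
Qed.

Lemma contop_chr xi : contop (fun f => chr xi * f).
Proof.
apply: (@mul_contop _ _ [set fun=> chr xi] (fun=> chr xi)); last exact: generated_gen.
- move=> F /= ->; split; first by move=> x; have [] := chr_diff xi x.
  move=> i; exists ((fun p => cst (- 'i%C * (xi 0 i)%:C%C) * chr xi)).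
    apply: (@generated_mul _ _ _ _ (fun=> cst _) (fun=> chr xi)); [exact: generated_cst|exact: generated_gen].
  by apply/funext => x; have [_ ->] := chr_diff xi x.
- move=> F /= ->; exists 0%N, 1; split=> // x.
  by rewrite expr0 mulr1 nc_chr.
Qed.

End Character.

Section Fourier.
Variables (R : realType) (n : nat).
Local Notation E := 'rV[R]_n.
Local Notation C := R[i].
Local Notation S := (@schwartz R n).
Local Notation I := (@cintegral R n).
Implicit Types (f g : E -> C) (h : E -> R) (x v xi : E) (B M K : R).

Definition fourier f : E -> C := fun xi => I (chr xi * f).
Local Notation F := fourier.

Let tI := tempered_cintegral R n.

Lemma schwartz_chr xi f : f \in S -> chr xi * f \in S.
Proof. exact: (contop_schwartz (contop_chr xi)). Qed.

Lemma schwartz_coord i f : f \in S -> coordf i * f \in S.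
Proof. exact: (contop_schwartz (contop_coord R i)). Qed.

Lemma fourier_lin c f g : f \in S -> g \in S -> F (c *: f + g) = c *: F f + F g.
Proof.
move=> Sf Sg; apply/funext => xi; rewrite /fourier.
rewrite (contop_lin (contop_chr xi))//.
by rewrite (tempered_lin tI) ?schwartz_chr.
Qed.

Lemma fourierZ c f : f \in S -> F (c *: f) = c *: F f.
Proof.
move=> Sf; have := fourier_lin c Sf (rpred0 _).
rewrite addr0 => ->; rewrite -[RHS]addr0; congr (_ + _); apply/funext => xi.
by rewrite /fourier mulr0 (tempered_at0 tI).
Qed.

(** The remainder of the character at first order is at most 2 (v.x)^2, so the
    quadratic remainder estimate holds with two more powers of the weight. *)
Lemma fourier_diff f xi : f \in S -> cdifferentiable (F f) xi /\
  forall i, partial i (F f) xi = F (- 'i%C *: (coordf i * f)) xi.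
Proof.
move=> Sf; have [B q] := schwartz_qbound ((n.*2).+2) Sf.
have B0 := qbound_ge0 q.
apply: (@quadratic_cdifferentiable _ _ _ _ _ (2 * tails_mass R n * (2 * n%:R ^+ 2 * B))) => v.
pose T i := chr xi * (- 'i%C *: (coordf i * f)).
have ST i : T i \in S by rewrite schwartz_chr// rpredZ// schwartz_coord.
(* g is the remainder at first order of the integrand as a function of xi. *)
pose g := chr (xi + v) * f - chr xi * f - \sum_i (v 0 i)%:C%C *: T i.
have Sg : g \in S.
  by rewrite !rpredB ?schwartz_chr// rpred_sum// => i _; rewrite rpredZ.
have -> : F f (xi + v) - F f xi - \sum_i (v 0 i)%:C%C * F (- 'i%C *: (coordf i * f)) xi = I g.
  have SS : \sum_i (v 0 i)%:C%C *: T i \in S by rewrite rpred_sum// => i _; rewrite rpredZ.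
  rewrite (temperedB tI) ?rpredB ?schwartz_chr// (temperedB tI) ?schwartz_chr//.
  rewrite (tempered_sum _ tI); last by move=> i _; rewrite rpredZ.
  by congr (_ - _); apply: eq_bigr => i _; rewrite (temperedZ _ tI).
have gE x : g x = chr xi x * (cexp (dot v x) - 1 + 'i%C * (dot v x)%:C%C) * f x.
  rewrite -[g x]/(chr (xi + v) x * f x - chr xi x * f x - (\sum_i (v 0 i)%:C%C *: T i) x).
  rewrite fct_sumE chrD -/(cexp (dot v x)) -/(chr v x).
  have -> : \sum_i ((v 0 i)%:C%C *: T i) x = - ('i%C * (dot v x)%:C%C) * (chr xi x * f x).
    rewrite /dot rmorph_sum/= -mulNr mulr_sumr mulr_suml; apply: eq_bigr => i _.
    rewrite -[LHS]/((v 0 i)%:C%C * (chr xi x * (- 'i%C * ((x 0 i)%:C%C * f x)))) rmorphM/=; ring.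
  rewrite /chr; ring.
apply: le_trans (@cintegral_bound _ _ g (`|v| ^+ 2 * (2 * n%:R ^+ 2 * B)) _) _; last first.
  by rewrite le_eqVlt; apply/orP; left; apply/eqP; ring.
apply: cdominatedP => x; first exact/smooth_cdiff/schwartz_smooth.
rewrite gE !ncM nc_chr mul1r.
have d2 : dot v x ^+ 2 <= n%:R ^+ 2 * (`|v| ^+ 2 * weight x ^+ 2).
  rewrite -!exprMn -[leLHS]real_normK ?num_real// lerXn2r ?nnegrE ?mulr_ge0 ?weight_ge0//.
  by rewrite (le_trans (dot_bound _ _))// !ler_wpM2l// lerDr.
have fx : nc (f x) <= B / weight x ^+ ((n.*2).+2) := qboundE (b := [::]) x q isT.
apply: le_trans (ler_pM (nc_ge0 _) (nc_ge0 _) (cexp_bound _) fx) _.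
have w0 := weight_gt0 x.
apply: le_trans (ler_wpM2r _ (ler_wpM2l _ d2)) _ => //.
  by rewrite divr_ge0// exprn_ge0// weight_ge0.
have -> : weight x ^+ n.*2.+2 = weight x ^+ n.*2 * weight x ^+ 2 by rewrite -exprD addn2.
move: (weight x) w0 => w w0.
have wn : w ^+ n.*2 != 0 by rewrite expf_neq0// gt_eqF.
move: (w ^+ n.*2) wn => u un.
rewrite le_eqVlt; apply/orP; left; apply/eqP; field; rewrite un gt_eqF//.
Qed.

Lemma partial_fourier i f : f \in S -> partial i (F f) = F (- 'i%C *: (coordf i * f)).
Proof. by move=> Sf; apply/funext => xi; have [_ ->] := fourier_diff xi Sf. Qed.

(** Integration by parts: the integral of the i-th derivative of exp (- i
    xi.x) f vanishes. *)
Lemma coord_fourier i f : f \in S -> coordf i * F f = F (- 'i%C *: partial i f).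
Proof.
move=> Sf; have sf := schwartz_smooth Sf; apply/funext => xi.
have Spf := schwartz_partial i Sf.
have e : partial i (chr xi * f) =
    (- 'i%C * (xi 0 i)%:C%C) *: (chr xi * f) + chr xi * partial i f.
  apply/funext => x; have [dc pc] := chr_diff xi x.
  rewrite (partialM i dc (smooth_cdiff x sf)) pc.
  rewrite -[RHS]/((- 'i%C * (xi 0 i)%:C%C) * (chr xi x * f x) + chr xi x * partial i f x).
  by rewrite mulrA.
have := cintegral_partial i (schwartz_chr xi Sf).
rewrite e (tempered_lin tI) ?schwartz_chr// => /eqP.
rewrite addrC addr_eq0 => /eqP H.
rewrite fourierZ// -[RHS]/(- 'i%C * I (chr xi * partial i f)) H.
rewrite -[LHS]/((xi 0 i)%:C%C * I (chr xi * f)).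
have ii : 'i%C * 'i%C = -1 :> C by rewrite -expr2 sqr_i.
transitivity (- ('i%C * 'i%C) * (xi 0 i)%:C%C * I (chr xi * f)); first by rewrite ii opprK mul1r.
ring.
Qed.

(** The operators that correspond to multiplication by the monomial of index b
    on the other side of the Fourier transform; likewise [Xop] for
    derivatives. *)
Definition Dop b f := foldr (fun i g => - 'i%C *: partial i g) f b.
Definition Xop b f := foldr (fun i g => - 'i%C *: (coordf i * g)) f b.

Lemma contop_Dop b : contop (Dop b).
Proof.
elim: b => [|i b IH]; first exact: contop_id.
apply: (@contop_comp _ _ (fun g => - 'i%C *: partial i g) (Dop b)) => //.
apply: (@contop_comp _ _ (fun g => - 'i%C *: g) (partial i)); [exact: contopZ|exact: contop_partial].
Qed.

Lemma contop_Xop b : contop (Xop b).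
Proof.
elim: b => [|i b IH]; first exact: contop_id.
apply: (@contop_comp _ _ (fun g => - 'i%C *: (coordf i * g)) (Xop b)) => //.
apply: (@contop_comp _ _ (fun g => - 'i%C *: g) (fun g => coordf i * g)); [exact: contopZ|exact: (contop_coord R)].
Qed.

Lemma partials_fourier b f : f \in S -> partials b (F f) = F (Xop b f).
Proof.
move=> Sf; elim: b => [//|i b IH]; rewrite [LHS]/= IH partial_fourier//.
exact: (contop_schwartz (contop_Xop b)).
Qed.

Lemma monomial_fourier a f xi : f \in S -> (monomial a xi)%:C%C * F f xi = F (Dop a f) xi.
Proof.
move=> Sf; elim: a => [|i a IH]; first by rewrite /monomial big_nil mul1r.
have SD := contop_schwartz (contop_Dop a) Sf.
rewrite [RHS]/= -(coord_fourier i SD) -[RHS]/((xi 0 i)%:C%C * F (Dop a f) xi) -IH.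
by rewrite /monomial big_cons rmorphM mulrA.
Qed.

Lemma fourier_sup f B xi : f \in S -> qbound n.*2 B f -> nc (F f xi) <= 2 * tails_mass R n * B.
Proof.
move=> Sf q; apply: cintegral_bound; apply: cdominatedP => x.
  exact/smooth_cdiff/schwartz_smooth/schwartz_chr.
by rewrite -[(_ * _) x]/(chr xi x * f x) ncM nc_chr mul1r; exact: (qboundE (b := [::]) x q).
Qed.

(** A monomial times a derivative of F f is the Fourier transform of a
    continuous operator applied to f, and F is bounded by the integral. *)
Lemma fourier_pbound N : exists N' K, 0 <= K /\ forall f B, f \in S ->
  qbound N' B f -> pbound N (K * B) (F f).
Proof.
pose Q a b m M := 0 <= M /\ forall f B xi, f \in S -> qbound m B f ->
  `|monomial a xi| * nc (partials b (F f) xi) <= M * B.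
have mono a b m m' M M' : (m <= m')%N -> M <= M' -> Q a b m M -> Q a b m' M'.
  move=> mm MM [M0 H]; split; first exact: le_trans MM.
  move=> f B xi Sf q; have B0 := qbound_ge0 q.
  by rewrite (le_trans (H f B xi Sf (qbound_le mm (lexx _) q)))// ler_wpM2r.
have base a b : exists m M, Q a b m M.
  have c := contop_comp (contop_Dop a) (contop_Xop b).
  have [m [K [K0 H]]] := contop_bound c n.*2.
  exists m, (2 * tails_mass R n * K); split; first by rewrite !mulr_ge0// tails_mass_ge0.
  move=> f B xi Sf q; rewrite partials_fourier// -nc_real -ncM monomial_fourier; last first.
    exact: (contop_schwartz (contop_Xop b)).
  rewrite -mulrA; apply: fourier_sup; first exact: (contop_schwartz c).
  exact: H.
have step a : exists m M, 0 <= M /\ forall b, (size b <= N)%N -> Q a b m M.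
  by apply: uniform_multiindex => // b; exact: mono.
have [|m [M [M0 H]]] := @uniform_multiindex R n
  (fun a m M => 0 <= M /\ forall b, (size b <= N)%N -> Q a b m M) _ step N.
  move=> a m m' M M' mm MM [M0 H]; split; first exact: le_trans MM.
  by move=> b bN; apply: mono (H b bN).
exists m, M; split=> // f B Sf q a b xi aN bN.
by have [_ HH] := H a aN; have [_ ->] := HH b bN.
Qed.

Lemma contop_fourier : contop F.
Proof.
have qF N : exists N' K, 0 <= K /\ forall f B, f \in S ->
    qbound N' B f -> qbound N (K * B) (F f).
  have [m [M [M0 H]]] := fourier_pbound N; exists m, (2 ^+ N * M).
  split; first by rewrite mulr_ge0// exprn_ge0.
  by move=> f B Sf q; rewrite -mulrA; apply: pbound_qbound; exact: H.
split=> // [f Sf|c f g Sf Sg]; last exact: fourier_lin.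
apply: qbound_schwartz.
  move=> b x; rewrite partials_fourier//.
  by have [] := fourier_diff x (contop_schwartz (contop_Xop b) Sf).
move=> N; have [m [M [M0 H]]] := qF N; have [B q] := schwartz_qbound m Sf.
by exists (M * B); exact: H.
Qed.

Lemma schwartz_fourier f : f \in S -> F f \in S.
Proof. exact: (contop_schwartz contop_fourier). Qed.

Lemma fourier_translate a f : f \in S -> F f = chr a * F (translate a f).
Proof.
move=> Sf; apply/funext => xi.
rewrite -[RHS]/(chr a xi * I (chr xi * translate a f)) /fourier.
rewrite -(cintegral_translate a (schwartz_chr xi Sf)).
rewrite -(temperedZ _ tI) ?schwartz_chr ?schwartz_translate//.
congr (I _); apply/funext => x.
rewrite -[LHS]/(chr xi (x + a) * f (x + a)).
rewrite -[RHS]/(chr a xi * (chr xi x * f (x + a))).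
by rewrite chrC chrD chrC mulrA (chrC a) mulrC [chr xi x * _]mulrC mulrC.
Qed.

End Fourier.

(** * The regularized inverse of |x|^2 *)

Section Division.
Variables (R : realType) (n : nat).
Local Notation E := 'rV[R]_n.
Local Notation C := R[i].
Local Notation S := (@schwartz R n).
Local Notation ee i := (delta_mx 0 i : E).
Local Notation sqE := (@sq R n).
Implicit Types (f g : E -> C) (h : E -> R) (x v xi : E) (B M e : R) (b : seq 'I_n).

(** The regularized inverse 1 / (|x|^2 + e). *)
Definition reg_inv e : E -> C := fun x => ((sq x + e)^-1)%:C%C.

Lemma sq_gt0 e x : 0 < e -> 0 < sq x + e.
Proof. by move=> e0; rewrite ltr_wpDl// sq_ge0. Qed.

Lemma reg_inv_diff e x : 0 < e -> cdifferentiable (reg_inv e) x /\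
  forall i, partial i (reg_inv e) x = (- 2)%:C%C * (coordf i x * (reg_inv e x * reg_inv e x)).
Proof.
move=> e0; have [ds es] := sq_diff x.
have dse : differentiable (sqE + cst e) x by exact: differentiableD.
have ne : (sqE + cst e) x != 0 by rewrite gt_eqF// sq_gt0.
split; first by apply: cdifferentiable_real; exact: differentiableV.
move=> i; rewrite partial_real.
have -> : 'D_(ee i) (fun y => (sq y + e)^-1) x = - (sq x + e) ^- 2 *: (2 * x 0 i).
  transitivity ('D_(ee i) (fun y => ((sqE + cst e) y)^-1) x); first by [].
  rewrite deriveV//; last exact: diff_derivable.
  rewrite deriveD; [|exact: diff_derivable|exact: derivable_cst].
  by rewrite derive_cst addr0 es.
rewrite /reg_inv /coordf -!rmorphM/=; congr (_%:C%C).
rewrite /GRing.scale/=.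
have : sq x + e != 0 by [].
by move: (sq x + e) => s s0; field.
Qed.

Lemma nc_reg_inv e x : 0 < e -> nc (reg_inv e x) = (sq x + e)^-1.
Proof. by move=> e0; rewrite nc_real gtr0_norm// invr_gt0 sq_gt0. Qed.

Section Gen.
Variables (P : Type) (D : set P) (ep : P -> R).
Hypothesis ep0 : forall p, D p -> 0 < ep p.

(** The parameter p stands for the value ep p of the regularization: bounds
    for families generated by these are uniform in it. *)
Definition reg_inv_gen : set (P -> E -> C) := [set F | coordgen F \/ F = fun p => reg_inv (ep p)].

Lemma reg_inv_genP F : reg_inv_gen F ->
  (forall p, D p -> forall x, cdifferentiable (F p) x) /\
  (forall i, exists2 G, generated reg_inv_gen G & forall p, D p -> partial i (F p) = G p).
Proof.
move=> [gF|->]; first exact: coordgenP.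
split; first by move=> p Dp x; have [] := reg_inv_diff x (ep0 Dp).
move=> i.
exists (fun p => cst ((- 2)%:C%C) * ((fun=> coordf i) p * (reg_inv (ep p) * reg_inv (ep p)))).
  have ah : generated reg_inv_gen (fun p => reg_inv (ep p)) by apply: generated_gen; right.
  apply: (@generated_mul _ _ _ _ (fun=> cst _)); first exact: generated_cst.
  apply: (@generated_mul _ _ _ _ (fun=> coordf i)); last exact: generated_mul.
  by apply: generated_gen; left; exists i.
by move=> p Dp; apply/funext => x; have [_ ->] := reg_inv_diff x (ep0 Dp).
Qed.

Lemma generated_reg_inv : generated reg_inv_gen (fun p => reg_inv (ep p)).
Proof. by apply: generated_gen; right. Qed.

End Gen.

Lemma contop_reg_inv e : 0 < e -> contop (fun f => reg_inv e * f).
Proof.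
move=> e0.
have e0' (p : unit) : setT p -> 0 < e by [].
apply: (@mul_contop _ _ (reg_inv_gen (fun _ : unit => e)) (fun=> reg_inv e)); last exact: generated_reg_inv.
  move=> F /(reg_inv_genP e0')[dF pF]; split; first exact: dF.
  by move=> i; have [G aG eG] := pF i; exists G; rewrite ?eG.
move=> F [cF|->].
  have [m [M [M0 H]]] := @coordgen_bound _ _ unit setT setT F cF.
  by exists m, M; split=> // x; exact: H.
exists 0%N, (e^-1); split; first by rewrite invr_ge0 ltW.
move=> x; rewrite expr0 mulr1 nc_reg_inv// lef_pV2 ?posrE ?sq_gt0//.
by rewrite lerDr sq_ge0.
Qed.

(** The functions whose jet of order K at 0 vanishes, called flat below. *)
Definition jet0 (K : nat) f := forall b, (size b < K)%N -> partials b f 0 = 0.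

Lemma jet0_le K K' f : (K <= K')%N -> jet0 K' f -> jet0 K f.
Proof. by move=> KK H b bK; apply: H; exact: leq_trans KK. Qed.

(** By Leibniz's rule each term of a derivative of the product contains a
    derivative of g of no larger order. *)
Lemma jet0_mul (P : Type) (D : set P) (gen : set (P -> E -> C)) (F : P -> E -> C) (p : P) K g :
  (forall F, gen F ->
    (forall p, D p -> forall x, cdifferentiable (F p) x) /\
    (forall i, exists2 G, generated gen G & forall p, D p -> partial i (F p) = G p)) ->
  D p -> generated gen F -> smooth g -> jet0 K g -> jet0 K (F p * g).
Proof.
move=> genP Dp aF sg jg b bK.
have [Q dQ ->] := leibniz genP b aF => //.
elim: dQ => {Q} [G b' aG bb|Q Q' _ h _ h'].
  rewrite -[LHS]/(G p 0 * partials b' g 0) jg ?mulr0//.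
  exact: leq_ltn_trans bb bK.
by rewrite -[LHS]/(Q p g 0 + Q' p g 0) h h' addr0.
Qed.

Lemma jet0_reg_inv e K g : 0 < e -> smooth g -> jet0 K g -> jet0 K (reg_inv e * g).
Proof.
move=> e0 sg jg.
have e0' (p : unit) : setT p -> 0 < e by [].
exact: (@jet0_mul unit setT _ (fun=> reg_inv e) tt K g (reg_inv_genP e0') Logic.I (generated_reg_inv _) sg jg).
Qed.

Lemma jet0_coord i K g : smooth g -> jet0 K g -> jet0 K (coordf i * g).
Proof.
move=> sg jg.
apply: (@jet0_mul unit setT (@coordgen R n unit) (fun=> coordf i) tt K g) => //.
  by move=> F; exact: coordgenP.
by apply: generated_gen; exists i.
Qed.

Lemma jet0_sum (s : seq 'I_n) K (G : 'I_n -> E -> C) : (forall i, smooth (G i)) ->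
  (forall i, jet0 K (G i)) -> jet0 K (\sum_(i <- s) G i).
Proof.
move=> sG jG b bK; rewrite partials_sum// fct_sumE big1// => i _.
exact: jG.
Qed.

(** A derivative of order at most N of the product is bounded by derivatives
    of g times w^m, where w = (1 + |x|)^2 / |x| controls the coordinates and,
    uniformly in e, the regularized inverse. For |x| >= 1, w is a polynomial
    factor. For |x| < 1, w is of order 1 / |x|, but g and its derivatives of
    order at most N are O(|x|^m) by Taylor's bound if the jet of g of order N
    + m + 1 vanishes. *)
Lemma reg_inv_uniform N : exists K N' M, 0 <= M /\ forall e g B, 0 < e -> g \in S -> jet0 K g ->
  qbound N' B g -> qbound N (M * B) (reg_inv e * g).
Proof.
pose w (x : E) : R := weight x ^+ 2 / `|x|.
pose D : set R := [set e | 0 < e]; pose X : set E := [set x | x != 0].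
have w1 x : X x -> 1 <= w x.
  move=> x0; rewrite /w ler_pdivlMr ?normr_gt0// mul1r expr2.
  by rewrite (@le_trans _ _ (weight x))// ?lerDr// ler_peMl ?weight_ge0 ?weight_ge1.
have gb F : reg_inv_gen id F -> exists m M, 0 <= M /\ forall p x, D p -> X x -> nc (F p x) <= M * w x ^+ m.
  move=> [cF|->].
    have [m [M [M0 H]]] := @coordgen_bound _ _ R D X F cF.
    exists m, M; split=> // p x Dp Xx; rewrite (le_trans (H p x Dp Xx))// ler_wpM2l//.
    rewrite lerXn2r ?nnegrE ?weight_ge0 ?(le_trans ler01 (w1 x Xx))//.
    rewrite /w ler_pdivlMr ?normr_gt0// expr2 ler_wpM2l ?weight_ge0//.
    by rewrite lerDr.
  exists 2%N, 1; split=> // e x e0 x0; rewrite nc_reg_inv// mul1r.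
  have n0 : 0 < `|x| by rewrite normr_gt0.
  have s0 : 0 < `|x| ^+ 2 by rewrite exprn_gt0.
  apply: (@le_trans _ _ (`|x| ^+ 2)^-1).
    rewrite lef_pV2 ?posrE ?sq_gt0// (le_trans (norm_le_sq x))//.
    by rewrite lerDl ltW.
  rewrite -exprVn lerXn2r ?nnegrE ?invr_ge0 ?(le_trans ler01 (w1 x _))//.
  by rewrite /w ler_peMl ?invr_ge0// exprn_ege1// weight_ge1.
have genP F (gF : reg_inv_gen id F) := @reg_inv_genP R D id (fun p Dp => Dp) F gF.
have [m [M [M0 H]]] := mul_bound genP w1 gb N (generated_reg_inv id).
(* The two terms of the constant are for |x| >= 1 and |x| < 1; in the latter,
   w <= 4 / |x| and Taylor's bound give (4 / |x|)^m (2 n |x|)^m. *)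
exists (N + m).+1, (N + m.*2)%N, (M + 2 ^+ N * M * (8 * n%:R) ^+ m).
have M'0 : 0 <= 2 ^+ N * M * (8 * n%:R) ^+ m by rewrite !mulr_ge0 ?exprn_ge0 ?mulr_ge0.
split; first by rewrite addr_ge0.
move=> e g B e0 Sg jg q b x bN; have sg := schwartz_smooth Sg.
have B0 := qbound_ge0 q.
have [->|x0] := eqVneq x 0.
  rewrite (jet0_reg_inv e0 sg jg); first by rewrite nc0 mulr0 mulr_ge0// addr_ge0.
  by rewrite ltnS (leq_trans bN)// leq_addr.
have n0 : 0 < `|x| by rewrite normr_gt0.
have wN0 : 0 <= weight x ^+ N by rewrite exprn_ge0// weight_ge0.
have [x1|x1] := leP 1 `|x|.
  have hg b' : (size b' <= size b)%N -> nc (partials b' g x) <= B / weight x ^+ (N + m.*2).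
    by move=> b'b; rewrite (qboundE x q)// (leq_trans b'b)// (leq_trans bN)// leq_addr.
  have wx : w x ^+ m <= weight x ^+ (m.*2).
    rewrite -mul2n exprM lerXn2r ?nnegrE ?exprn_ge0 ?weight_ge0 ?(le_trans ler01 (w1 x _))//.
    by rewrite /w ler_pdivrMr// ler_peMr// exprn_ge0// weight_ge0.
  rewrite (le_trans (ler_wpM2l wN0 (H b bN e x g _ e0 x0 sg hg)))//.
  apply: (@le_trans _ _ (M * B)); last by rewrite ler_wpM2r// lerDl.
  have p1 : 0 < weight x ^+ N by rewrite exprn_gt0// weight_gt0.
  have p2 : 0 < weight x ^+ m.*2 by rewrite exprn_gt0// weight_gt0.
  rewrite exprD; move: (weight x ^+ N) p1 (weight x ^+ m.*2) p2 wx => u u0 t t0 wx.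
  apply: (@le_trans _ _ (u * (M * t * (B / (u * t))))).
    apply: (ler_wpM2l (ltW u0)); apply: ler_wpM2r; last exact: ler_wpM2l.
    by rewrite divr_ge0// mulr_ge0// ltW.
  by rewrite le_eqVlt; apply/orP; left; apply/eqP; field; rewrite !gt_eqF.
have hg b' : (size b' <= size b)%N -> nc (partials b' g x) <= (2 * n%:R * `|x|) ^+ m * B.
  move=> b'b; apply: taylor_bound => //; first exact: smooth_partials.
    move=> b'' b''m; rewrite -partials_cat jg// size_cat addnC ltnS.
    by rewrite leq_add// ?(leq_trans b'b)// ltnW.
  move=> b'' y b''m; rewrite -partials_cat.
  have sz : (size (b'' ++ b') <= N + m.*2)%N.
    rewrite size_cat b''m addnC leq_add ?(leq_trans b'b)//.
    by rewrite -addnn leq_addr.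
  apply: le_trans (q _ y sz); rewrite ler_peMl ?nc_ge0//.
  by rewrite exprn_ege1// weight_ge1.
rewrite (le_trans (ler_wpM2l wN0 (H b bN e x g _ e0 x0 sg hg)))//.
have wx2 : weight x <= 2 by rewrite /weight; lra.
have wx : w x <= 4 / `|x|.
  rewrite /w ler_pM2r ?invr_gt0// (_ : 4 = 2 ^+ 2); last by rewrite -natrX.
  by rewrite lerXn2r ?nnegrE ?weight_ge0.
apply: (@le_trans _ _ (2 ^+ N * (M * (4 / `|x|) ^+ m * ((2 * n%:R * `|x|) ^+ m * B)))).
  apply: ler_pM => //.
  - apply: mulr_ge0; first by apply: mulr_ge0 => //; apply: exprn_ge0; exact: le_trans ler01 (w1 x x0).
    by apply: mulr_ge0 => //; apply: exprn_ge0; rewrite !mulr_ge0.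
  - by rewrite lerXn2r ?nnegrE ?weight_ge0.
  - rewrite ler_wpM2r ?mulr_ge0 ?exprn_ge0 ?mulr_ge0// ler_wpM2l//.
    have wp : 0 <= w x := le_trans ler01 (w1 x x0).
    by apply: lerXn2r => //; rewrite nnegrE//; exact: divr_ge0.
apply: (@le_trans _ _ (2 ^+ N * M * (8 * n%:R) ^+ m * B)); last first.
  by rewrite ler_wpM2r// lerDr.
have -> : (8 * n%:R) ^+ m = (4 / `|x|) ^+ m * (2 * n%:R * `|x|) ^+ m :> R.
  by rewrite -exprMn; congr (_ ^+ m); field; rewrite gt_eqF.
by move: ((4 / `|x|) ^+ m) (_ ^+ m) => u t; rewrite le_eqVlt; apply/orP; left; apply/eqP; ring.
Qed.

(** Multiplication by |x|^2, written as a sum so that its continuity is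
    immediate. *)
Definition mul_sq g : E -> C := \sum_i coordf i * (coordf i * g).

Lemma mul_sqE g x : mul_sq g x = (sq x)%:C%C * g x.
Proof.
rewrite /mul_sq fct_sumE /sq rmorph_sum/= mulr_suml; apply: eq_bigr => i _.
by rewrite rmorphXn/= expr2 -mulrA.
Qed.

Lemma contop_mul_sq : contop mul_sq.
Proof.
apply: contop_sum => i.
by apply: (@contop_comp _ _ (fun g => coordf i * g) (fun g => coordf i * g)); exact: contop_coord.
Qed.

Lemma reg_inv_mul_sq e g : 0 < e -> reg_inv e * mul_sq g = g - e%:C%C *: (reg_inv e * g).
Proof.
move=> e0; apply/funext => x.
rewrite -[LHS]/(reg_inv e x * mul_sq g x) -[RHS]/(g x - e%:C%C * (reg_inv e x * g x)) mul_sqE /reg_inv.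
have s0 : (sq x + e)%:C%C != 0 :> C by rewrite eq_complex/= eqxx andbT gt_eqF// sq_gt0.
rewrite fmorphV/= rmorphD/= in s0 *.
by field.
Qed.

Lemma jet0_mul_sq K g : smooth g -> jet0 K g -> jet0 K (mul_sq g).
Proof.
have sc i f : smooth f -> smooth (coordf i * f).
  by move=> sf; apply: smoothM => //; exact: smooth_coordf.
move=> sg jg; apply: jet0_sum => i; first exact/sc/sc.
by apply: jet0_coord; [exact: sc|exact: jet0_coord].
Qed.

(** Write f = |x|^2 h f + e h f with h = 1 / (|x|^2 + e). L kills the first
    term, and the second one is O(e) because h f is bounded uniformly in e. *)
Lemma tempered_jet0 L : tempered L -> (forall g, g \in S -> L (mul_sq g) = 0) ->
  exists K, forall f, f \in S -> jet0 K f -> L f = 0.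
Proof.
move=> tL L0; have [N [A [A0 HA]]] := tempered_bound tL.
have [K [N' [M [M0 HM]]]] := reg_inv_uniform N; exists K => f Sf jf.
have [B q] := schwartz_qbound N' Sf.
apply/eqP; rewrite -nc_eq0; apply/eqP.
apply: (@small_eq0 R _ (A * (M * B))); first exact: nc_ge0.
move=> e e0 _; have ch := contop_reg_inv e0.
have Shf := contop_schwartz ch Sf.
have fE : f = mul_sq (reg_inv e * f) + e%:C%C *: (reg_inv e * f).
  have -> : mul_sq (reg_inv e * f) = reg_inv e * mul_sq f.
    by apply/funext => x; rewrite -[RHS]/(reg_inv e x * mul_sq f x) !mul_sqE; exact: mulrCA.
  by rewrite reg_inv_mul_sq// subrK.
have SR : mul_sq (reg_inv e * f) \in S := contop_schwartz contop_mul_sq Shf.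
have -> : L f = e%:C%C * L (reg_inv e * f).
  rewrite {1}fE (temperedD tL)//; last exact: rpredZ.
  by rewrite L0// add0r (temperedZ _ tL).
rewrite ncM nc_real gtr0_norm// ler_wpM2l//; first exact: ltW.
by apply: HA => //; exact: HM.
Qed.

End Division.

(** * Functionals supported at the origin *)

Section JetAlgebra.
Variables (R : realType) (n : nat).
Local Notation E := 'rV[R]_n.
Local Notation C := R[i].
Local Notation S := (@schwartz R n).
Implicit Types (f g : E -> C) (h : E -> R) (x v xi : E) (B M e : R) (b : seq 'I_n).

Definition deriv_at0 b f : C := partials b f 0.

Lemma tempered_deriv_at0 b : tempered (deriv_at0 b).
Proof.
split=> [c f g Sf Sg|].
  by rewrite /deriv_at0 partials_lin//; exact: schwartz_smooth.
exists (size b), 1; split=> // f B Sf q; rewrite mul1r.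
apply: le_trans (q b 0 (leqnn _)); rewrite ler_peMl ?nc_ge0//.
by rewrite exprn_ege1// weight_ge1.
Qed.

Lemma qboundZ N B (c : C) f : smooth f -> qbound N B f -> qbound N (nc c * B) (c *: f).
Proof.
move=> sf q; rewrite -[c *: f]addr0 -[nc c * B]addr0.
apply: qbound_lin => //; first exact: smooth0.
by move=> b x _; rewrite partials0 nc0 mulr0.
Qed.

(** One derivative at a time: either the functional of index b vanishes on all
    functions flat with respect to s, or there is such a function on which it
    is 1, and a multiple of it can be subtracted. *)
Lemma jet_projection (s : seq (seq 'I_n)) : exists P, [/\ contop P,
  forall f, f \in S -> forall b, b \in s -> deriv_at0 b (P f) = 0 &
  forall f, f \in S -> (forall b, b \in s -> deriv_at0 b f = 0) -> P f = f].
Proof.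
elim: s => [|b s [P [cP P0 P1]]]; first by exists id; split=> //; exact: contop_id.
have [[f0 [Sf0 s0 b0]]|no] := pselect (exists f0, [/\ f0 \in S,
    forall b', b' \in s -> deriv_at0 b' f0 = 0 & deriv_at0 b f0 != 0]); last first.
  exists P; split=> // f Sf; last first.
    by move=> fb; apply: P1 => // b' b's; apply: fb; rewrite inE b's orbT.
  move=> b'; rewrite inE => /predU1P[->|]; last exact: P0.
  apply/eqP/negPn/negP => ne; apply: no; exists (P f); split=> //.
    exact: (contop_schwartz cP).
  exact: P0.
have tb := tempered_deriv_at0 b.
pose f1 := (deriv_at0 b f0)^-1 *: f0.
have Sf1 : f1 \in S by rewrite rpredZ.
have f1b : deriv_at0 b f1 = 1 by rewrite /f1 (temperedZ _ tb Sf0) mulVf.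
have f1s b' : b' \in s -> deriv_at0 b' f1 = 0.
  by move=> b's; rewrite /f1 (temperedZ _ (tempered_deriv_at0 b') Sf0) (s0 _ b's) mulr0.
pose G f := (- deriv_at0 b (P f)) *: f1.
have cG : contop G.
  have tP := tempered_comp tb cP.
  split=> [f Sf|c f g Sf Sg|N]; first by rewrite rpredZ.
    have e : deriv_at0 b (P (c *: f + g)) = c * deriv_at0 b (P f) + deriv_at0 b (P g) := tempered_lin tP c Sf Sg.
    by rewrite /G e opprD scalerDl -mulrN -scalerA.
  have [N' [A [A0 HA]]] := tempered_bound tP; have [B1 q1] := schwartz_qbound N Sf1.
  have B10 := qbound_ge0 q1.
  exists N', (A * B1); split; first by rewrite mulr_ge0.
  move=> f B Sf q; have B0 := qbound_ge0 q.
  have := qboundZ (- deriv_at0 b (P f)) (schwartz_smooth Sf1) q1.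
  apply: qbound_le => //; rewrite ncN mulrAC ler_wpM2r//.
  exact: HA.
exists (fun f => P f + G f); split; first exact: contopD.
- move=> f Sf b'; have SP := contop_schwartz cP Sf.
  rewrite inE => /predU1P[->|b's].
    by rewrite (temperedD tb) ?rpredZ// /G (temperedZ _ tb)// f1b mulr1 subrr.
  have tb' := tempered_deriv_at0 b'.
  by rewrite (temperedD tb') ?rpredZ// /G (temperedZ _ tb')// f1s// mulr0 addr0 P0.
- move=> f Sf fb; rewrite /G P1//; last first.
    by move=> b' b's; apply: fb; rewrite inE b's orbT.
  by rewrite fb ?inE ?eqxx// oppr0 scale0r addr0.
Qed.

(** A functional that vanishes where finitely many others do is a linear
    combination of them; the induction is that of [jet_projection]. *)
Lemma jet_span (s : seq (seq 'I_n)) L : tempered L ->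
  (forall f, f \in S -> (forall b, b \in s -> deriv_at0 b f = 0) -> L f = 0) ->
  exists cs : seq (C * seq 'I_n), forall f, f \in S -> L f = \sum_(p <- cs) p.1 * deriv_at0 p.2 f.
Proof.
elim: s L => [|b s IH] L tL L0.
  by exists [::] => f Sf; rewrite big_nil L0.
have tb := tempered_deriv_at0 b.
have [[f0 [Sf0 s0 b0]]|no] := pselect (exists f0, [/\ f0 \in S,
    forall b', b' \in s -> deriv_at0 b' f0 = 0 & deriv_at0 b f0 != 0]).
  pose c := L f0 / deriv_at0 b f0.
  pose L' f := - c * deriv_at0 b f + L f.
  have tL' : tempered L' by exact: tempered_linear_comb.
  have [|cs csP] := IH L' tL'.
    move=> f Sf fs.
    have SZ : - (deriv_at0 b f / deriv_at0 b f0) *: f0 \in S by rewrite rpredZ.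
    have SD : - (deriv_at0 b f / deriv_at0 b f0) *: f0 + f \in S by rewrite rpredD.
    have : L (- (deriv_at0 b f / deriv_at0 b f0) *: f0 + f) = 0.
      apply: L0 => // b'; rewrite inE => /predU1P[->|b's].
        by rewrite (tempered_lin tb _ Sf0 Sf) mulNr divfK// addNr.
      by rewrite (tempered_lin (tempered_deriv_at0 b') _ Sf0 Sf) (s0 _ b's) (fs _ b's) mulr0 addr0.
    rewrite (tempered_lin tL _ Sf0 Sf) => e; rewrite /L' /c -[RHS]e; congr (_ + _).
    by rewrite !mulNr; congr (- _); rewrite mulrC mulrCA mulrC.
  exists ((c, b) :: cs) => f Sf; rewrite big_cons -csP//= /L'.
  by rewrite mulNr addrA subrr add0r.
apply: IH => // f Sf fs; apply: L0 => // b'; rewrite inE => /predU1P[->|]; last exact: fs.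
by apply/eqP/negPn/negP => ne; apply: no; exists f.
Qed.

Definition jets (K : nat) : seq (seq 'I_n) :=
  flatten [seq [seq val t | t <- enum {: k.-tuple 'I_n}] | k <- iota 0 K].

Lemma mem_jets K b : (b \in jets K) = (size b < K)%N.
Proof.
apply/flatten_mapP/idP => [[k]|bK].
  by rewrite mem_iota/= add0n => kK /mapP[t _ ->]; rewrite size_tuple.
exists (size b); first by rewrite mem_iota.
by apply/mapP; exists (in_tuple b); rewrite ?mem_enum.
Qed.

Lemma jet0P K f : jet0 K f <-> forall b, b \in jets K -> deriv_at0 b f = 0.
Proof.
by split=> [jf b|jf b bK]; [rewrite mem_jets; exact: jf|apply: jf; rewrite mem_jets].
Qed.

(** Euler's operator, of which the derivatives at 0 are eigenvectors, with the
    order as eigenvalue. *)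
Definition euler f : E -> C := \sum_i coordf i * partial i f.

Lemma contop_euler : contop euler.
Proof.
apply: contop_sum => i.
apply: (@contop_comp _ _ (fun g => coordf i * g) (partial i)).
  exact: contop_coord.
exact: contop_partial.
Qed.

Lemma partials_euler b f : smooth f ->
  partials b (euler f) = \sum_i coordf i * partials b (partial i f) + (size b)%:R *: partials b f.
Proof.
move=> sf; elim: b => [|j b IH]; first by rewrite scale0r addr0.
have sb i : smooth (partials b (partial i f)) by apply: smooth_partials; exact: smooth_partial.
have sci i : smooth (coordf i * partials b (partial i f)).
  by apply: smoothM => //; exact: smooth_coordf.
have ss : smooth (\sum_i coordf i * partials b (partial i f)) by exact: smooth_sum.
have sbf : smooth (partials b f) by exact: smooth_partials.
rewrite [LHS]/= IH addrC -[LHS]/(partials [:: j] _) partials_lin// partials_sum//.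
rewrite -[partials [:: j] (partials b f)]/(partials (j :: b) f).
have -> : \sum_i partials [:: j] (coordf i * partials b (partial i f)) =
    \sum_i coordf i * partials (j :: b) (partial i f) + partials (j :: b) f.
  have -> : partials (j :: b) f = \sum_i cst (j == i)%:R * partials b (partial i f).
    apply/funext => x; rewrite fct_sumE (bigD1 j)//= big1 => [|i /negbTE ne].
      by rewrite addr0 -[RHS]/((j == j)%:R * partials b (partial j f) x) eqxx mul1r partials_partial.
    by rewrite -[LHS]/((j == i)%:R * partials b (partial i f) x) eq_sym ne mul0r.
  rewrite -big_split; apply: eq_bigr => i _; apply/funext => x.
  have [dc pc] := @coord_diff R n i x.
  by rewrite [LHS](partialM j dc (smooth_cdiff x (sb i))) pc addrC.
rewrite addrCA; congr (_ + _).
by rewrite -[X in _ + X]scale1r -scalerDl natr1.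
Qed.

Lemma deriv_at0_euler b f : smooth f -> deriv_at0 b (euler f) = (size b)%:R * deriv_at0 b f.
Proof.
move=> sf; rewrite /deriv_at0 partials_euler//.
rewrite -[LHS]/((\sum_i coordf i * partials b (partial i f)) 0 + (size b)%:R * partials b f 0).
rewrite fct_sumE big1 ?add0r// => i _.
by rewrite -[LHS]/(((0 : E) 0 i)%:C%C * _) mxE mul0r.
Qed.

(** L kills |x|^2 f, so it is a combination of derivatives at 0. L also kills
    the range of Euler's operator E, so that it is unchanged by composition
    with the factors 1 - E / k, and the product of these for k = 1, ..., m
    annihilates the derivatives of order 1 to m at 0. *)
Lemma tempered_delta L : tempered L -> (forall i f, f \in S -> L (coordf i * f) = 0) ->
  exists c, forall f, f \in S -> L f = c * f 0.
Proof.
move=> tL L0.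
have Scf i f : f \in S -> coordf i * f \in S by exact: (contop_schwartz (contop_coord R i)).
have LR g : g \in S -> L (mul_sq g) = 0.
  move=> Sg; rewrite /mul_sq (tempered_sum _ tL); last by move=> i _; exact/Scf/Scf.
  by rewrite big1// => i _; exact/L0/Scf.
have [K LK] := tempered_jet0 tL LR.
have [cs csP] : exists cs : seq (C * seq 'I_n), forall f, f \in S -> L f = \sum_(p <- cs) p.1 * deriv_at0 p.2 f.
  by apply: (@jet_span (jets K)) => // f Sf /jet0P; exact: LK.
have LE f : f \in S -> L (euler f) = 0.
  move=> Sf; rewrite /euler (tempered_sum _ tL); last by move=> i _; apply: Scf; exact: schwartz_partial.
  by rewrite big1// => i _; apply: L0; exact: schwartz_partial.
(* The factor 1 - E / (k + 1). *)
pose T k f := (- (k.+1%:R)^-1) *: euler f + f.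
have ST k f : f \in S -> T k f \in S.
  by move=> Sf; rewrite rpredD// rpredZ// (contop_schwartz contop_euler).
pose Q ks f := foldr T f ks.
have SQ ks f : f \in S -> Q ks f \in S by move=> Sf; elim: ks => //= k ks; exact: ST.
have LQ ks f : f \in S -> L (Q ks f) = L f.
  move=> Sf; elim: ks => //= k ks IH.
  have SE : euler (Q ks f) \in S := contop_schwartz contop_euler (SQ ks f Sf).
  by rewrite (tempered_lin tL)// ?SQ// LE ?SQ// mulr0 add0r.
have dQ ks b f : f \in S -> deriv_at0 b (Q ks f) = (\prod_(k <- ks) (1 - (size b)%:R / k.+1%:R)) * deriv_at0 b f.
  move=> Sf; elim: ks => [|k ks IH] /=; first by rewrite big_nil mul1r.
  have SE : euler (Q ks f) \in S := contop_schwartz contop_euler (SQ ks f Sf).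
  rewrite (tempered_lin (tempered_deriv_at0 b))// ?SQ// deriv_at0_euler; last exact/schwartz_smooth/SQ.
  by rewrite IH big_cons; ring.
pose m := \max_(p <- cs) size p.2.
exists (\sum_(p <- cs | size p.2 == 0%N) p.1) => f Sf.
rewrite -(LQ (iota 0 m))// csP ?SQ// mulr_suml [RHS]big_mkcond/=.
apply: eq_big_seq => -[c b] pcs /=; rewrite dQ//.
have bm : (size b <= m)%N by rewrite /m (big_rem _ pcs)/= leq_maxl.
case: eqP => [b0|/eqP b0].
  rewrite big1_seq; last by move=> k _; rewrite b0 mul0r subr0.
  by rewrite mul1r /deriv_at0 (size0nil b0).
have bpos : (0 < size b)%N by rewrite lt0n.
rewrite (big_rem (size b).-1)/=; last by rewrite mem_iota/= add0n prednK.
by rewrite prednK// divff ?pnatr_eq0// subrr !mul0r mulr0.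
Qed.

End JetAlgebra.

(** * Fourier inversion *)

Section GaussODE.
Variables (R : realType) (n : nat).
Local Notation E := 'rV[R]_n.
Local Notation C := R[i].
Implicit Types (f g : E -> C) (x v xi : E).

Definition inv_gauss (x : E) : C := (expR (2^-1 * sq x))%:C%C.

Lemma inv_gauss_diff x : cdifferentiable inv_gauss x /\
  forall i, partial i inv_gauss x = coordf i x * inv_gauss x.
Proof.
have [d e] := @expR_sq_diff R n 2^-1 x.
split; first exact: cdifferentiable_real.
move=> i; rewrite partial_real e /coordf /inv_gauss -rmorphM/=; congr (_%:C%C).
by field.
Qed.

Lemma smooth_inv_gauss : smooth inv_gauss.
Proof.
pose gen : set (unit -> E -> C) := [set G | coordgen G \/ G = fun=> inv_gauss].
apply: (@generated_smooth R n unit setT gen _ (fun=> inv_gauss) tt) => //; last by apply: generated_gen; right.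
move=> G [cG|->]; first exact: coordgenP.
split; first by move=> _ _ x; have [] := inv_gauss_diff x.
move=> i; exists (fun p => (fun=> coordf i) p * (fun=> inv_gauss) p).
  by apply: (@generated_mul _ _ _ _ (fun=> coordf i) (fun=> inv_gauss)); apply: generated_gen; [left; exists i|right].
by move=> _ _; apply/funext => x; have [_ ->] := inv_gauss_diff x.
Qed.

Lemma smooth_cst (c : C) : smooth (cst c : E -> C).
Proof.
have gP F (gF : @coordgen R n unit F) := @coordgenP R n unit (@coordgen R n unit) setT F gF.
by apply: (@generated_smooth R n unit setT (@coordgen R n unit) gP (fun=> cst c) tt) => //; exact: generated_cst.
Qed.

Lemma inv_gauss_gauss x : inv_gauss x * @gauss R n x = 1.
Proof.
by rewrite /inv_gauss /gauss -rmorphM/= -expRD mulNr addrN expR0.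
Qed.

(** The quotient of a solution by the Gaussian has zero gradient. *)
Lemma gauss_ode f : smooth f -> (forall i, partial i f = - (coordf i * f)) ->
  f = f 0 *: @gauss R n.
Proof.
move=> sf Hf.
have s1 : smooth (f * inv_gauss) by apply: smoothM => //; exact: smooth_inv_gauss.
have g0 : inv_gauss 0 = 1.
  by rewrite /inv_gauss /sq big1 ?mulr0 ?expR0// => i _; rewrite mxE expr0n.
pose G := (- f 0) *: cst 1 + f * inv_gauss.
have sG : smooth G by apply: smooth_lin => //; exact: smooth_cst.
have G0 : G 0 = 0.
  by rewrite -[LHS]/(- f 0 * 1 + f 0 * inv_gauss 0) g0 !mulr1 addNr.
have dG i x : partial i G x = 0.
  rewrite /G partial_lin; [|exact: cdifferentiable_cst|exact: smooth_cdiff].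
  rewrite partial_cst mulr0 add0r.
  have [dg pg] := inv_gauss_diff x.
  rewrite partialM//; last exact: smooth_cdiff.
  rewrite pg Hf -[(- _) x]/(- (coordf i x * f x)).
  by move: (coordf i x) (f x) (inv_gauss x) => u v w; ring.
have H x : nc (G x) <= (2 * n%:R * `|x|) ^+ 1 * 0.
  apply: taylor_bound => //.
    by move=> b; case: b.
  move=> b y; case: b => [//|i [|//]] _.
  by rewrite [partials _ _]/= dG nc0.
apply/funext => x; have := H x; rewrite mulr0 => Gx.
have : G x = 0 by apply/eqP; rewrite -nc_eq0 eq_le Gx nc_ge0.
rewrite -[G x]/(- f 0 * 1 + f x * inv_gauss x) mulr1 addrC => /eqP; rewrite subr_eq0 => /eqP e.
rewrite -[RHS]/(f 0 * gauss x) -e -mulrA.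
by rewrite inv_gauss_gauss mulr1.
Qed.

End GaussODE.

Section Inversion.
Variables (R : realType) (n : nat).
Local Notation E := 'rV[R]_n.
Local Notation C := R[i].
Local Notation S := (@schwartz R n).
Local Notation F := (@fourier R n).
Local Notation I := (@cintegral R n).
Implicit Types (f g : E -> C) (h : E -> R) (x v xi : E) (B M e : R) (b : seq 'I_n).

Let tI := tempered_cintegral R n.

Lemma fourier0 f : F f 0 = I f.
Proof.
congr (I _); apply/funext => x; rewrite -[LHS]/(chr 0 x * f x) chr0 mul1r//.
Qed.

Lemma ii1 : 'i%C * - 'i%C = 1 :> C.
Proof. by rewrite mulrN -expr2 sqr_i opprK. Qed.

Lemma fourier_coord i f : f \in S -> F (coordf i * f) = 'i%C *: partial i (F f).
Proof.
move=> Sf; rewrite partial_fourier// fourierZ ?(contop_schwartz (contop_coord R i))//.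
by rewrite scalerA ii1 scale1r.
Qed.

(** f |-> int F f is a multiple c of the evaluation at 0 by [tempered_delta],
    because F (x_i f) is a derivative. Translating f gives the formula at
    every point. The Gaussian satisfies a system of equations that F
    preserves, so F multiplies it by its integral, which is positive, and c is
    not 0. *)
Lemma fourier_double : exists2 c, c != 0 & forall f, f \in S -> forall a, F (F f) (- a) = c * f a.
Proof.
have tL : tempered (I \o F) := tempered_comp tI (contop_fourier R n).
have [|c cP] := tempered_delta tL.
  move=> i f Sf /=; rewrite fourier_coord//.
  rewrite (temperedZ _ tI) ?schwartz_partial ?schwartz_fourier//.
  by rewrite cintegral_partial ?mulr0// schwartz_fourier.
exists c; last first.
  move=> f Sf a; have St := schwartz_translate a Sf.
  transitivity ((I \o F) (translate a f)); last first.
    by rewrite cP// /translate add0r.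
  rewrite /= (fourier_translate a Sf) /fourier; congr (I _); apply/funext => x.
  rewrite -[LHS]/(chr (- a) x * (chr a x * F (translate a f) x)).
  by rewrite mulrA -chrD addNr chr0 mul1r.
have Sg := schwartz_gauss R n.
set ga := @gauss R n in Sg *.
have cg i : partial i (F ga) = - (coordf i * F ga).
  rewrite coord_fourier// partial_fourier// partial_gauss scalerA.
  rewrite !fourierZ ?schwartz_coord//.
  by rewrite mulrN1 opprK scaleNr.
have gE : F ga = F ga 0 *: ga.
  apply: gauss_ode => //; exact/schwartz_smooth/schwartz_fourier.
have ga0 : ga 0 = 1 by exact: gauss0.
have := cP ga Sg; rewrite /= gE fourier0 (temperedZ _ tI)// ga0 mulr1 => <-.
by rewrite mulf_neq0// cintegral_gauss.
Qed.

Lemma fourier4 : exists2 c, c != 0 & forall f, f \in S -> F (F (F (F f))) = c *: f.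
Proof.
have [c c0 cP] := fourier_double; exists (c * c); first by rewrite mulf_neq0.
move=> f Sf; apply/funext => x.
rewrite -[x]opprK cP ?schwartz_fourier//.
by rewrite cP// opprK mulrA.
Qed.

Lemma fourier_sum (G : 'I_n -> E -> C) : (forall i, G i \in S) ->
  F (\sum_i G i) = \sum_i F (G i).
Proof.
move=> SG; apply/funext => xi; transitivity (\sum_i F (G i) xi); last by rewrite fct_sumE.
have t := tempered_comp tI (contop_chr xi).
exact: (tempered_sum (index_enum 'I_n) (P := xpredT) t (fun i _ => SG i)).
Qed.

Lemma fourier_mul_sq g : g \in S -> F (mul_sq g) = laplacian (F g).
Proof.
move=> Sg; rewrite /laplacian /mul_sq fourier_sum => [|i]; last by rewrite !schwartz_coord.
rewrite -sumrN; apply: eq_bigr => i _.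
rewrite !fourier_coord ?schwartz_coord//.
have sF := schwartz_smooth (schwartz_fourier Sg).
rewrite -[X in partial i X]addr0 -[partial i (_ + _)]/(partials [:: i] _).
rewrite partials_lin ?partials0 ?addr0; [|exact: smooth_partial|exact: smooth0].
by rewrite scalerA -expr2 sqr_i scaleN1r.
Qed.

Lemma fourier_laplacian g : g \in S -> F (laplacian g) = mul_sq (F g).
Proof.
move=> Sg; rewrite /laplacian /mul_sq -scaleN1r.
rewrite fourierZ; last by rewrite rpred_sum// => i _; exact/schwartz_partial/schwartz_partial.
rewrite fourier_sum => [|i]; last exact/schwartz_partial/schwartz_partial.
rewrite scaler_sumr; apply: eq_bigr => i _.
rewrite coord_fourier// fourierZ ?schwartz_partial//.
have -> u : coordf i * (- 'i%C *: u) = - 'i%C *: (coordf i * u).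
  by apply/funext => x; exact: mulrCA.
rewrite coord_fourier ?schwartz_partial// fourierZ; last exact/schwartz_partial/schwartz_partial.
by rewrite scalerA mulrNN -expr2 sqr_i.
Qed.

(** F has an inverse since its fourth power is a nonzero multiple of the
    identity. *)
Lemma fourier_inverse : exists G, [/\ contop G, forall f, f \in S -> F (G f) = f,
  forall f, f \in S -> G (F f) = f & forall f, f \in S -> G (mul_sq f) = laplacian (G f)].
Proof.
have [c c0 cP] := fourier4.
have cF := contop_fourier R n.
have SF f : f \in S -> F f \in S by exact: contop_schwartz.
exists (fun f => c^-1 *: F (F (F f))); split.
- apply: (@contop_comp _ _ (fun f => c^-1 *: f) (fun f => F (F (F f)))); first exact: contopZ.
  by apply: (@contop_comp _ _ F (fun f => F (F f))) => //; apply: (@contop_comp _ _ F F).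
- move=> f Sf; rewrite fourierZ; last exact/SF/SF/SF.
  by rewrite cP// scalerA mulVf// scale1r.
- by move=> f Sf; rewrite cP// scalerA mulVf// scale1r.
- move=> f Sf.
  rewrite fourier_mul_sq// fourier_laplacian ?SF// fourier_mul_sq ?SF//.
  have sF : smooth (F (F (F f))) by exact/schwartz_smooth/SF/SF/SF.
  rewrite -[in RHS](addr0 (c^-1 *: _)) laplacian_lin//; last exact: smooth0.
  suff -> : laplacian (0 : E -> C) = 0 by rewrite addr0.
  by rewrite /laplacian big1 ?oppr0// => i _; exact: (@partials0 R n [:: i; i]).
Qed.

End Inversion.

(** * Division of tempered distributions by |x|^2 *)

Section Limits.
Variable R : realType.
Implicit Types (M : R).

Definition eps (m : nat) : R := m.+1%:R^-1.

Lemma eps_gt0 m : 0 < eps m.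
Proof. by rewrite invr_gt0. Qed.

Lemma eps_le k m : (k <= m)%N -> eps m <= eps k.
Proof. by move=> km; rewrite lef_pV2 ?posrE// ler_nat ltnS. Qed.

(** A sequence that is Lipschitz with respect to 1 / (m + 1) converges at the
    same rate. The limit is constructed as the supremum of the lower bounds u
    k - eps k M. *)
Lemma real_limit (u : nat -> R) M : (forall m k, `|u m - u k| <= `|eps m - eps k| * M) ->
  exists l, forall m, `|u m - l| <= eps m * M.
Proof.
move=> H.
have lo k m : (k <= m)%N -> u m + eps m * M <= u k + eps k * M /\ u k - eps k * M <= u m - eps m * M.
  move=> km; have := H m k; rewrite (ler0_norm (_ : eps m - eps k <= 0)) ?subr_le0 ?eps_le//.
  rewrite ler_norml opprB mulrBl; lra.
have M0 m : 0 <= eps m * M.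
  have := le_trans (normr_ge0 _) (H 0%N 1%N).
  have e01 : 0 < `|eps 0 - eps 1|.
    by rewrite normr_gt0 subr_eq0 gt_eqF// ltf_pV2 ?posrE// ltr_nat.
  by rewrite pmulr_rge0// => ?; rewrite mulr_ge0// ltW// eps_gt0.
have up k m : u k - eps k * M <= u m + eps m * M.
  have [km|mk] := leqP k m.
    by have [_ h] := lo k m km; have := M0 m; lra.
  by have [h _] := lo m k (ltnW mk); have := M0 k; lra.
pose A := [set u k - eps k * M | k in [set: nat]].
exists (sup A) => m; rewrite ler_distlC.
have A0 : A !=set0 by exists (u 0%N - eps 0 * M); exists 0%N.
have ubA k : ubound A (u k + eps k * M) by move=> _ [j _ <-]; exact: up.
have h1 : sup A <= u m + eps m * M by apply: ge_sup => // _ [j _ <-]; exact: up.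
have h2 : u m - eps m * M <= sup A.
  by apply: ub_le_sup; [exists (u 0%N + eps 0 * M); exact: ubA|exists m].
by apply/andP; split; lra.
Qed.

Lemma complex_limit (u : nat -> R[i]) M :
  (forall m k, nc (u m - u k) <= `|eps m - eps k| * M) ->
  exists l, forall m, nc (u m - l) <= eps m * (2 * M).
Proof.
move=> H.
have [|a ha] := @real_limit (fun m => complex.Re (u m)) M.
  by move=> m k; rewrite -ReB; exact: le_trans (nc_Re _) (H m k).
have [|b hb] := @real_limit (fun m => complex.Im (u m)) M.
  by move=> m k; rewrite -ImB; exact: le_trans (nc_Im _) (H m k).
exists (Complex a b) => m; rewrite (le_trans (nc_le_ReIm _))// ReB ImB/=.
have := ha m; have := hb m; move: (eps m * (2 * M)) (eps m * M) (mulrCA (eps m) 2 M).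
by move=> s t ->; lra.
Qed.

Lemma small_eps_eq0 (a M : R) : 0 <= a -> (forall m, a <= eps m * M) -> a = 0.
Proof.
move=> a0 H; apply/eqP; rewrite eq_le a0 andbT leNgt; apply/negP => ap.
have M0 : 0 < M.
  by have := lt_le_trans ap (H 0%N); rewrite /eps invr1 mul1r.
pose m := Num.truncn (M / a).
have := H m; rewrite /eps mulrC ler_pdivlMr//; apply/negP; rewrite -ltNge.
by rewrite -ltr_pdivrMl// mulrC truncnS_gt.
Qed.

Lemma limit_unique (u : nat -> R[i]) l l' M M' :
  (forall m, nc (u m - l) <= eps m * M) -> (forall m, nc (u m - l') <= eps m * M') -> l = l'.
Proof.
move=> H H'; apply/eqP; rewrite -subr_eq0 -nc_eq0; apply/eqP.
apply: (@small_eps_eq0 _ (M' + M)); first exact: nc_ge0.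
move=> m; rewrite mulrDr (_ : l - l' = (u m - l') - (u m - l)); last by ring.
by rewrite (le_trans (ncD _ _))// ncN lerD.
Qed.

End Limits.

Section DivisionTheorem.
Variables (R : realType) (n : nat).
Local Notation E := 'rV[R]_n.
Local Notation C := R[i].
Local Notation S := (@schwartz R n).
Implicit Types (f g : E -> C) (x : E) (B M e : R) (b : seq 'I_n).

(** The resolvent identity, which makes T (g / (|x|^2 + e)) Lipschitz in e. *)
Lemma reg_inv_sub e e' g : 0 < e -> 0 < e' ->
  reg_inv e * g - reg_inv e' * g = (e' - e)%:C%C *: (reg_inv e * (reg_inv e' * g)).
Proof.
move=> e0 e'0; apply/funext => x.
rewrite -[LHS]/(reg_inv e x * g x - reg_inv e' x * g x).
rewrite -[RHS]/((e' - e)%:C%C * (reg_inv e x * (reg_inv e' x * g x))).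
rewrite -mulrBl !mulrA; congr (_ * _); rewrite /reg_inv -rmorphB -!rmorphM/=; congr (_%:C%C).
have s0 := sq_gt0 x e0; have s1 := sq_gt0 x e'0.
by field; rewrite !gt_eqF.
Qed.

(** U g is the limit of T (P g / (|x|^2 + e)), where P is a projection onto
    flat functions. For flat f, P (|x|^2 f) = |x|^2 f and |x|^2 f / (|x|^2 +
    e) tends to f, so that T and U o |x|^2 agree on f. *)
Lemma tempered_division T : tempered T -> exists U cs, tempered U /\
  forall f, f \in S -> T f = U (mul_sq f) + \sum_(p <- (cs : seq (C * seq 'I_n))) p.1 * deriv_at0 p.2 f.
Proof.
move=> tT; have [N [A [A0 HA]]] := tempered_bound tT.
have [K1 [N1 [M1 [M10 H1]]]] := @reg_inv_uniform R n N.
have [K2 [N2 [M2 [M20 H2]]]] := @reg_inv_uniform R n N1.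
(* K1 serves the bounds on one regularized inverse, K2 those on a product of
   two, which occurs in the resolvent identity. *)
pose K := maxn K1 K2.
have [P [cP P0 P1]] := jet_projection R (jets n K).
have SP g : g \in S -> P g \in S by exact: contop_schwartz.
have PK g : g \in S -> jet0 K (P g) by move=> Sg; apply/jet0P; exact: P0.
have Sh e g : 0 < e -> g \in S -> reg_inv e * g \in S.
  by move=> e0; exact: (contop_schwartz (contop_reg_inv n e0)).
pose u g m : C := T (reg_inv (eps R m) * P g).
have lip g B : g \in S -> qbound N2 B (P g) ->
    forall m k, nc (u g m - u g k) <= `|eps R m - eps R k| * (A * (M1 * (M2 * B))).
  move=> Sg q m k; have em := eps_gt0 R m; have ek := eps_gt0 R k.
  rewrite /u -(temperedB tT) ?Sh ?SP// reg_inv_sub// (temperedZ _ tT) ?Sh ?SP//.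
  rewrite ncM nc_real distrC ler_wpM2l//.
  apply: HA; first by rewrite !Sh ?SP.
  apply: H1 => //; first by rewrite Sh ?SP.
    apply: jet0_reg_inv => //; first exact/schwartz_smooth/SP.
    exact: jet0_le (leq_maxl _ _) (PK g Sg).
  apply: H2 => //; first exact: SP.
  exact: jet0_le (leq_maxr _ _) (PK g Sg).
(* The limit is defined on all functions, with an arbitrary value off the
   Schwartz space. *)
have ex g : exists l, g \in S -> exists M, forall m, nc (u g m - l) <= eps R m * M.
  case: (boolP (g \in S)) => Sg; last by exists 0.
  have [B q] := schwartz_qbound N2 (SP g Sg).
  have [l hl] := complex_limit (lip g B Sg q).
  by exists l => _; exists (2 * (A * (M1 * (M2 * B)))).
have /choice[U HU] := ex.
have ulin c f g m : f \in S -> g \in S -> u (c *: f + g) m = c * u f m + u g m.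
  move=> Sf Sg; rewrite /u (contop_lin cP)//.
  by rewrite (contop_lin (contop_reg_inv n (eps_gt0 R m))) ?SP// (tempered_lin tT) ?Sh ?SP ?eps_gt0.
have tU : tempered U.
  split=> [c f g Sf Sg|].
    have [Mf hf] := HU f Sf; have [Mg hg] := HU g Sg.
    have [|Mh hh] := HU (c *: f + g); first by rewrite rpredD ?rpredZ.
    apply: (@limit_unique _ (u (c *: f + g)) _ _ Mh (nc c * Mf + Mg)) => // m.
    rewrite ulin// (_ : _ - _ = c * (u f m - U f) + (u g m - U g)); last by ring.
    rewrite (le_trans (ncD _ _))// ncM mulrDr lerD// mulrCA ler_wpM2l ?nc_ge0//.
  have [N3 [M3 [M30 H3]]] := contop_bound cP (maxn N1 N2).
  exists N3, (A * (M1 * M3) + 2 * (A * (M1 * (M2 * M3)))).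
  split; first by rewrite addr_ge0 ?mulr_ge0.
  move=> f B Sf q; have qP := H3 f B Sf q.
  have q1 := qbound_le (leq_maxl N1 N2) (lexx _) qP.
  have q2 := qbound_le (leq_maxr N1 N2) (lexx _) qP.
  have [l hl] := complex_limit (lip f _ Sf q2).
  have [Mf hf] := HU f Sf.
  have -> : U f = l by exact: limit_unique hf hl.
  have -> : l = u f 0%N - (u f 0%N - l) by rewrite subKr.
  rewrite (le_trans (ncD _ _))// ncN mulrDl lerD//.
    rewrite -!mulrA; apply: HA; first by rewrite Sh ?SP ?eps_gt0.
    apply: H1; rewrite ?eps_gt0 ?SP//.
    exact: jet0_le (leq_maxl _ _) (PK f Sf).
  by have := hl 0%N; rewrite /eps invr1 mul1r !mulrA.
have UT f : f \in S -> jet0 K f -> U (mul_sq f) = T f.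
  move=> Sf jf; have SR : mul_sq f \in S := contop_schwartz (contop_mul_sq R n) Sf.
  have [Mf hf] := HU _ SR.
  have [B q] := schwartz_qbound N1 Sf.
  apply: (@limit_unique _ (u (mul_sq f)) _ _ Mf (A * (M1 * B))) => // m.
  have e0 := eps_gt0 R m.
  rewrite /u P1//; last first.
    by apply/jet0P; apply: jet0_mul_sq => //; exact: schwartz_smooth.
  rewrite reg_inv_mul_sq// (temperedB tT) ?rpredZ ?Sh// (temperedZ _ tT) ?Sh//.
  rewrite addrAC subrr add0r ncN ncM nc_real gtr0_norm// ler_wpM2l ?(ltW e0)//.
  apply: HA; first exact: Sh.
  by apply: H1 => //; exact: jet0_le (leq_maxl _ _) jf.
have tUR := tempered_comp tU (contop_mul_sq R n).
have tD := tempered_linear_comb (-1) tUR tT.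
have [|cs csP] := jet_span (s := jets n K) tD.
  move=> f Sf /jet0P jf /=; rewrite UT//; first by rewrite mulN1r addNr.
exists U, cs; split=> // f Sf; rewrite -csP//= mulN1r addrA subrr add0r//.
Qed.

End DivisionTheorem.

(** * Polynomials as functions *)

Section Polynomials.
Variables (R : realType) (n : nat).
Local Notation E := 'rV[R]_n.
Local Notation C := R[i].
Local Notation S := (@schwartz R n).
Local Notation I := (@cintegral R n).
Local Notation poly := (mpoly.mpoly n C).
Local Notation pf := (@polynomial_fun R n).
Local Notation mderiv := mpoly.mderiv.
Local Notation X_ i := (mpoly.mpolyX C (mpoly.mnm1 i)).
Local Notation lap := (@polynomial_laplacian R n).
Implicit Types (f g : E -> C) (x : E) (p q : poly) (b : seq 'I_n) (m : mpoly.multinom n).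

Let tI := tempered_cintegral R n.

(** An induction principle on polynomials that goes well with the calculus of
    functions, where sums and products are differentiated. *)
Lemma mpoly_generated (P : poly -> Prop) : (forall c, P (mpoly.mpolyC n c)) ->
  (forall i, P (X_ i)) -> (forall p q, P p -> P q -> P (p + q)) ->
  (forall p q, P p -> P q -> P (p * q)) -> forall p, P p.
Proof.
move=> PC PX PD PM.
have P1 : P 1 by rewrite -[1](mpoly.mpolyC1 n); exact: PC.
apply: mpoly.mpolyind; first by rewrite -[0](mpoly.mpolyC0 n); exact: PC.
move=> c m p _ _ Pp; apply: (PD _ _ _ Pp); rewrite -mpoly.mul_mpolyC; apply: (PM _ _ (PC c)).
rewrite mpoly.mpolyXE_id; elim/big_rec: _ => // i q _ Pq; apply: (PM _ _ _ Pq).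
elim: (mpoly.fun_of_multinom m i) => [|k IH]; first by rewrite expr0.
by rewrite exprS; apply: PM.
Qed.

Lemma polynomial_funC c : pf (mpoly.mpolyC n c) = cst c.
Proof. by apply/funext => x; exact: mpoly.mevalC. Qed.

Lemma polynomial_fun1 : pf 1 = 1.
Proof. by apply/funext => x; exact: mpoly.meval1. Qed.

Lemma polynomial_fun0 : pf 0 = 0.
Proof. by apply/funext => x; exact: mpoly.meval0. Qed.

Lemma polynomial_funX i : pf (X_ i) = coordf i.
Proof. by apply/funext => x; exact: mpoly.mevalXU. Qed.

Lemma polynomial_funD p q : pf (p + q) = pf p + pf q.
Proof. by apply/funext => x; exact: mpoly.mevalD. Qed.

Lemma polynomial_funN p : pf (- p) = - pf p.
Proof. by apply/funext => x; exact: mpoly.mevalN. Qed.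

Lemma polynomial_funM p q : pf (p * q) = pf p * pf q.
Proof. by apply/funext => x; exact: mpoly.mevalM. Qed.

Lemma polynomial_funZ c p : pf (c *: p) = c *: pf p.
Proof. by apply/funext => x; exact: mpoly.mevalZ. Qed.

Lemma polynomial_fun_sum (T : Type) (s : seq T) (P : T -> poly) :
  pf (\sum_(t <- s) P t) = \sum_(t <- s) pf (P t).
Proof.
by elim: s => [|t s IH]; rewrite ?big_nil ?polynomial_fun0// !big_cons polynomial_funD IH.
Qed.

Lemma generated_polynomial_fun p : generated (@coordgen R n unit) (fun=> pf p).
Proof.
elim/mpoly_generated: p => [c|i|p q hp hq|p q hp hq].
- by rewrite polynomial_funC; exact: generated_cst.
- by rewrite polynomial_funX; apply: generated_gen; exists i.
- by rewrite polynomial_funD; exact: (generated_add hp hq).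
- by rewrite polynomial_funM; exact: (generated_mul hp hq).
Qed.

Lemma polynomial_fun_diff p x : cdifferentiable (pf p) x /\
  forall j, partial j (pf p) x = pf (mderiv j p) x.
Proof.
elim/mpoly_generated: p => [c|i|p q [dp hp] [dq hq]|p q [dp hp] [dq hq]].
- rewrite polynomial_funC; split=> [|j]; first exact: cdifferentiable_cst.
  by rewrite partial_cst mpoly.mderivC polynomial_fun0.
- rewrite polynomial_funX; have [d e] := @coord_diff R n i x; split=> // j.
  have eU := mpoly.addmK (mpoly.mnm1 i) (@mpoly.mnm0 n); rewrite mpoly.add0m in eU.
  rewrite e mpoly.mderivX mpoly.mnm1E polynomial_funZ eq_sym.
  case: eqP => [<-|_]; last by rewrite scale0r.
  by rewrite scale1r eU mpoly.mpolyX0 polynomial_fun1.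
- rewrite polynomial_funD; split=> [|j]; first exact: cdifferentiableD.
  by rewrite partialD// hp hq mpoly.mderivD polynomial_funD.
- rewrite polynomial_funM; split=> [|j]; first exact: cdifferentiableM.
  by rewrite partialM// hp hq mpoly.mderivM polynomial_funD !polynomial_funM.
Qed.

Lemma partial_polynomial_fun j p : partial j (pf p) = pf (mderiv j p).
Proof. by apply/funext => x; have [_ ->] := polynomial_fun_diff p x. Qed.

Lemma contop_polynomial p : contop (fun f => pf p * f).
Proof. exact: (mul_contop_coord (generated_polynomial_fun p)). Qed.

Lemma schwartz_polynomial p f : f \in S -> pf p * f \in S.
Proof. exact: (contop_schwartz (contop_polynomial p)). Qed.

Lemma tempered_polynomial p : tempered (fun f => I (pf p * f)).
Proof. exact: (tempered_comp tI (contop_polynomial p)). Qed.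

Lemma cintegral_partial_polynomial i p f : f \in S ->
  I (pf p * partial i f) = - I (pf (mderiv i p) * f).
Proof.
move=> Sf; have := cintegral_partial i (schwartz_polynomial p Sf).
have -> : partial i (pf p * f) = pf (mderiv i p) * f + pf p * partial i f.
  apply/funext => x; have [d e] := polynomial_fun_diff p x.
  by rewrite partialM// ?e//; exact: smooth_cdiff (schwartz_smooth Sf).
rewrite (temperedD tI); try by apply: schwartz_polynomial => //; exact: schwartz_partial.
by move=> /eqP; rewrite addrC addr_eq0 => /eqP.
Qed.

(** Two integrations by parts. *)
Lemma cintegral_polynomial_laplacian p f : f \in S ->
  I (pf p * laplacian f) = I (pf (lap p) * f).
Proof.
move=> Sf; have S2 i : partial i (partial i f) \in S by exact/schwartz_partial/schwartz_partial.
rewrite /laplacian /polynomial_laplacian -!sumrN polynomial_fun_sum.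
rewrite mulr_sumr mulr_suml.
rewrite !(tempered_sum _ tI); last 2 first.
- by move=> i _; rewrite polynomial_funN mulNr rpredN; exact: schwartz_polynomial.
- by move=> i _; rewrite mulrN rpredN; exact: schwartz_polynomial.
apply: eq_bigr => i _; rewrite polynomial_funN mulNr mulrN.
have IN g : g \in S -> I (- g) = - I g.
  by move=> Sg; rewrite -scaleN1r (temperedZ _ tI)// mulN1r.
rewrite !IN ?schwartz_polynomial//; congr (- _).
rewrite cintegral_partial_polynomial ?schwartz_partial//.
by rewrite cintegral_partial_polynomial// opprK.
Qed.

End Polynomials.

(** * The Laplacian on polynomials and on tempered distributions *)

Section HarmonicPolynomials.
Variables (R : realType) (n : nat).
Local Notation E := 'rV[R]_n.
Local Notation C := R[i].
Local Notation S := (@schwartz R n).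
Local Notation F := (@fourier R n).
Local Notation I := (@cintegral R n).
Local Notation poly := (mpoly.mpoly n C).
Local Notation pf := (@polynomial_fun R n).
Local Notation mderiv := mpoly.mderiv.
Local Notation X_ i := (mpoly.mpolyX C (mpoly.mnm1 i)).
Local Notation lap := (@polynomial_laplacian R n).
Implicit Types (f g : E -> C) (x : E) (p q : poly) (b : seq 'I_n) (m : mpoly.multinom n).

Let tI := tempered_cintegral R n.

Lemma polynomial_fun_at0 p : pf p 0 = mpoly.mcoeff mpoly.mnm0 p.
Proof.
elim/mpoly_generated: p => [c|i|p q hp hq|p q hp hq].
- by rewrite polynomial_funC mpoly.mcoeffC eqxx mulr1.
- by rewrite polynomial_funX mpoly.mcoeffX mpoly.mnm1_eq0 /coordf mxE.
- by rewrite polynomial_funD mpoly.mcoeffD -hp -hq.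
- by rewrite polynomial_funM rmorphM/= -hp -hq.
Qed.

(** The coefficients are derivatives at 0, up to factorials. *)
Lemma polynomial_fun_inj p : pf p = 0 -> p = 0.
Proof.
move=> p0; apply/mpoly.mpolyP => m; rewrite mpoly.mcoeff0.
have H s : pf (foldr (@mpoly.mderiv n C) p s) = 0.
  elim: s => [//|i s IH] /=; rewrite -partial_polynomial_fun IH.
  exact: (@partials0 R n [:: i]).
have := polynomial_fun_at0 (mpoly.mderivm m p).
rewrite mpoly.mderivm_foldr H -mpoly.mderivm_foldr mpoly.mcoeff_mderivm mpoly.addm0.
move=> /esym/eqP; rewrite mulrn_eq0 => /orP[|/eqP//].
rewrite eqn0Ngt prodn_gt0// => i.
by rewrite ffact_gt0.
Qed.

(** Testing against exp (- i xi.x) times the Gaussian shows that the Fourier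
    transform of p times the Gaussian vanishes. *)
Lemma cintegral_polynomial_inj p : (forall f, f \in S -> I (pf p * f) = 0) -> p = 0.
Proof.
move=> H; apply: polynomial_fun_inj.
have [G [cG _ GF _]] := fourier_inverse R n.
have Sg := schwartz_gauss R n; have Spg := schwartz_polynomial p Sg.
have F0 : F (pf p * @gauss R n) = 0.
  apply/funext => xi; rewrite /fourier mulrCA; apply: H; exact: schwartz_chr.
have G0 : G 0 = 0.
  have := contop_lin cG 1 (rpred0 S) (rpred0 S).
  by rewrite !scale1r addr0 => /eqP; rewrite -subr_eq0 opprD addrA subrr sub0r oppr_eq0 => /eqP.
have := GF _ Spg; rewrite F0 G0 => /esym e.
apply/funext => x; apply/eqP.
have /eqP : pf p x * @gauss R n x = 0 by rewrite -[LHS]/((pf p * @gauss R n) x) e.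
by rewrite mulf_eq0 (negbTE (gauss_neq0 x)) orbF.
Qed.

Lemma polynomial_laplacian_lin (c : C) p q : lap (c *: p + q) = c *: lap p + lap q.
Proof.
rewrite /polynomial_laplacian scalerN -opprD; congr (- _).
by rewrite scaler_sumr -big_split; apply: eq_bigr => mu _; rewrite !linearP.
Qed.

(** Induction on the degree in the variables other than i0: the Laplacian of
    x_i0^2 x^m is - (m_i0 + 2) (m_i0 + 1) x^m plus monomials of smaller degree
    in the other variables. *)
Lemma polynomial_laplacian_monomial_surj (i0 : 'I_n) m :
  exists p, lap p = mpoly.mpolyX C m.
Proof.
have im0 : exists p, lap p = 0.
  by exists 0; rewrite /polynomial_laplacian big1 ?oppr0// => i _; rewrite !linear0.
have imL (c : C) p q : (exists p', lap p' = p) -> (exists q', lap q' = q) ->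
    exists r, lap r = c *: p + q.
  by move=> [p' <-] [q' <-]; exists (c *: p' + q'); rewrite polynomial_laplacian_lin.
have [D le_D] := ubnP (\sum_(i < n | i != i0) mpoly.fun_of_multinom m i)%N.
elim: D m le_D => // D IH m; rewrite ltnS => mD.
pose m' := mpoly.mnm_add (mpoly.mnm_add m (mpoly.mnm1 i0)) (mpoly.mnm1 i0).
have dd i k : mderiv i (mderiv i (mpoly.mpolyX C k)) =
    ((mpoly.fun_of_multinom k i) * (mpoly.fun_of_multinom k i).-1)%:R *:
    mpoly.mpolyX C (mpoly.mnm_sub (mpoly.mnm_sub k (mpoly.mnm1 i)) (mpoly.mnm1 i)).
  rewrite mpoly.mderivX mpoly.mderivZ mpoly.mderivX scalerA mpoly.mnmBE mpoly.mnm1E eqxx.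
  by rewrite subn1 natrM.
have rest : exists r, lap r = \sum_(i < n | i != i0) mderiv i (mderiv i (mpoly.mpolyX C m')).
  elim/big_rec: _ => // i q ii0 [r <-]; rewrite dd.
  have m'i : mpoly.fun_of_multinom m' i = mpoly.fun_of_multinom m i.
    by rewrite !mpoly.mnmDE mpoly.mnm1E eq_sym (negbTE ii0) !addn0.
  rewrite m'i; case mi : (mpoly.fun_of_multinom m i) => [|[|e]].
  - by rewrite mul0n scale0r add0r; exists r.
  - by rewrite muln0 scale0r add0r; exists r.
  apply: imL; last by exists r.
  apply: IH; apply: leq_trans mD.
  rewrite (bigD1 i)//= [X in (_ < X)%N](bigD1 i)//= !mpoly.mnmBE mpoly.mnm1E eqxx m'i mi.
  rewrite !subn1/= -addSn leq_add// leq_sum// => j /andP[j0 ji].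
  by rewrite !mpoly.mnmBE !mpoly.mnmDE !mpoly.mnm1E ![_ == j]eq_sym (negbTE ji) (negbTE j0) !subn0 !addn0.
have [r rE] := rest.
pose c : C := ((mpoly.fun_of_multinom m i0).+2 * (mpoly.fun_of_multinom m i0).+1)%:R.
have c0 : c != 0 by rewrite pnatr_eq0.
exists (- c^-1 *: (mpoly.mpolyX C m' + r)).
have -> : lap (- c^-1 *: (mpoly.mpolyX C m' + r)) = - c^-1 *: lap (mpoly.mpolyX C m' + r).
  have l0 : lap 0 = 0 by rewrite /polynomial_laplacian big1 ?oppr0// => i _; rewrite !linear0.
  by rewrite -[X in lap X]addr0 polynomial_laplacian_lin l0 addr0.
rewrite -[mpoly.mpolyX C m']scale1r polynomial_laplacian_lin rE scale1r.
rewrite [X in X + _]/polynomial_laplacian (bigD1 i0)//= opprD subrK dd.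
rewrite /m' !mpoly.addmK !mpoly.mnmDE mpoly.mnm1E eqxx !addn1/= -/c.
by rewrite scaleNr scalerN opprK scalerA mulVf// scale1r.
Qed.

Lemma polynomial_laplacian_surj (i0 : 'I_n) q : exists p, lap p = q.
Proof.
elim/mpoly.mpolyind: q => [|c m q _ _ [p <-]].
  by exists 0; rewrite /polynomial_laplacian big1 ?oppr0// => i _; rewrite !linear0.
have [r <-] := polynomial_laplacian_monomial_surj i0 m.
by exists (c *: r + p); rewrite polynomial_laplacian_lin.
Qed.

(** The polynomial (- i x)^b, in the order of the factors used by [Xop]. *)
Definition Xpoly b : poly := foldr (fun i q => - 'i%C *: (X_ i * q)) 1 b.

Lemma Xop_polynomial b f : Xop b f = pf (Xpoly b) * f.
Proof.
elim: b => [|i b IH]; first by rewrite polynomial_fun1 mul1r.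
rewrite [LHS]/= IH polynomial_funZ polynomial_funM polynomial_funX.
by apply/funext => x; rewrite -[LHS]/(- 'i%C * (_ * (_ * _))) -[RHS]/(- 'i%C * (_ * _) * _) !mulrA.
Qed.

Lemma deriv_at0_fourier b f : f \in S -> deriv_at0 b (F f) = I (pf (Xpoly b) * f).
Proof. by move=> Sf; rewrite /deriv_at0 partials_fourier// fourier0 Xop_polynomial. Qed.

Lemma deriv_at0_fourier_sum (cs : seq (C * seq 'I_n)) f : f \in S ->
  \sum_(p <- cs) p.1 * deriv_at0 p.2 (F f) = I (pf (\sum_(p <- cs) p.1 *: Xpoly p.2) * f).
Proof.
move=> Sf; rewrite polynomial_fun_sum mulr_suml (tempered_sum _ tI); last first.
  by move=> p _; apply: schwartz_polynomial.
apply: eq_bigr => p _; rewrite deriv_at0_fourier// polynomial_funZ.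
have -> : (p.1 *: pf (Xpoly p.2)) * f = p.1 *: (pf (Xpoly p.2) * f).
  by apply/funext => x; exact/esym/mulrA.
by rewrite (temperedZ _ tI)// schwartz_polynomial.
Qed.

(** Divide T o F^-1 by |x|^2. The remainder is the integral against a
    polynomial on the side of T, which is the Laplacian of a polynomial q; the
    integral against q is then the missing part of U. *)
Lemma laplacian_distribution_surj T : (0 < n)%N -> tempered T ->
  exists U, tempered U /\ forall f, f \in S -> U (laplacian f) = T f.
Proof.
move=> n0 tT; have [G [cG FG GF GR]] := fourier_inverse R n.
have [U [cs [tU UE]]] := tempered_division (tempered_comp tT cG).
have [q qE] := polynomial_laplacian_surj (Ordinal n0) (\sum_(p <- cs) p.1 *: Xpoly p.2).
exists (fun f => 1 * I (pf q * f) + (U \o F) f); split.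
  by apply: tempered_linear_comb; [exact: tempered_polynomial|exact: (tempered_comp tU (contop_fourier R n))].
move=> f Sf; have SF := schwartz_fourier Sf.
rewrite mul1r cintegral_polynomial_laplacian// qE -deriv_at0_fourier_sum//= fourier_laplacian//.
by rewrite addrC -UE//= GF.
Qed.

(** T o F^-1 kills the multiples of |x|^2, so it is a combination of
    derivatives at 0, and T is the integral against a polynomial. Its
    Laplacian integrates to 0 against all Schwartz functions. *)
Lemma laplacian_distribution_ker T : tempered T ->
  (forall f, f \in S -> T (laplacian f) = 0) ->
  exists2 p, lap p = 0 & forall f, f \in S -> T f = I (pf p * f).
Proof.
move=> tT T0; have [G [cG FG GF GR]] := fourier_inverse R n.
have SG f : f \in S -> G f \in S by exact: contop_schwartz.
have tTG := tempered_comp tT cG.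
have [f Sf|K TK] := tempered_jet0 tTG; first by rewrite /= GR// T0// SG.
have [cs csP] : exists cs : seq (C * seq 'I_n), forall f, f \in S ->
    (T \o G) f = \sum_(p <- cs) p.1 * deriv_at0 p.2 f.
  by apply: (@jet_span _ _ (jets n K)) => // f Sf /jet0P; exact: TK.
have TE f : f \in S -> T f = I (pf (\sum_(p <- cs) p.1 *: Xpoly p.2) * f).
  by move=> Sf; rewrite -deriv_at0_fourier_sum// -csP ?schwartz_fourier//= GF.
exists (\sum_(p <- cs) p.1 *: Xpoly p.2) => //.
apply: cintegral_polynomial_inj => f Sf.
by rewrite -cintegral_polynomial_laplacian// -TE ?T0// schwartz_laplacian.
Qed.

End HarmonicPolynomials.

(** * Alternating forms are determined by their values on frames *)

Section AlternatingFormBasis.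
Variables (R : realType) (n k : nat).
Local Notation C := R[i].
Implicit Types (w : 'M[R]_(k, n) -> C) (A B : 'M[R]_(k, n)) (u v : 'rV[R]_n) (I J : k.-tuple 'I_n).

Definition set_row A (i : 'I_k) v : 'M[R]_(k, n) :=
  \matrix_(a, b) if a == i then v 0 b else A a b.

Lemma row_set_row A i v : row i (set_row A i v) = v.
Proof. by apply/rowP => b; rewrite !mxE eqxx. Qed.

Lemma row_set_row_neq A i v a : a != i -> row a (set_row A i v) = row a A.
Proof. by move=> /negbTE ne; apply/rowP => b; rewrite !mxE ne. Qed.

Lemma set_row_row A i : set_row A i (row i A) = A.
Proof. by apply/matrixP => a b; rewrite !mxE; case: eqP => [->|]. Qed.

Lemma set_rowC A i j u v : i != j -> set_row (set_row A i u) j v = set_row (set_row A j v) i u.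
Proof.
move=> ij; apply/matrixP => a b; rewrite !mxE.
have [->|//] := eqVneq a j; by rewrite eq_sym (negbTE ij).
Qed.

Lemma set_row_lin w A i (c d : R) u v : multilinear w ->
  w (set_row A i (c *: u + d *: v)) = c%:C%C * w (set_row A i u) + d%:C%C * w (set_row A i v).
Proof.
move=> mw; apply: (mw _ _ _ i); first by rewrite !row_set_row.
  by apply/matrixP => a b; rewrite !mxE eq_sym (negbTE (neq_lift _ _)).
by apply/matrixP => a b; rewrite !mxE eq_sym (negbTE (neq_lift _ _)).
Qed.

Lemma set_row_basis w A i : multilinear w ->
  (forall c, w (set_row A i (delta_mx 0 c)) = 0) -> forall v, w (set_row A i v) = 0.
Proof.
move=> mw H v; have w0 : w (set_row A i 0) = 0.
  by have := set_row_lin A i 0 0 0 0 mw; rewrite !scale0r addr0 !mul0r addr0.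
rewrite (row_sum_delta v); elim/big_rec: _ => // c u _ wu.
by rewrite -[u]scale1r set_row_lin// H wu !mulr0 addr0.
Qed.

(** Expand the rows on the standard basis one after the other: m is the number
    of leading rows that are still arbitrary. *)
Lemma multilinear_frames w : multilinear w ->
  (forall I, w (frame R I) = 0) -> w = 0.
Proof.
move=> mw H; apply/funext => A.
suff K m : forall A, (forall i : 'I_k, (m <= i)%N -> exists c, row i A = delta_mx 0 c) -> w A = 0.
  by apply: (K k A) => i; rewrite leqNgt ltn_ord.
elim: m => [|m IH] {}A HA.
  have /choice[c cP] : forall i : 'I_k, exists c, row i A = delta_mx 0 c by move=> i; exact: HA.
  rewrite -(H [tuple c i | i < k]); congr (w _); apply/row_matrixP => i.
  by rewrite cP; apply/rowP => j; rewrite !mxE tnth_mktuple eqxx eq_sym.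
have [mk|km] := ltnP m k; last first.
  by apply: IH => i mi; have := leq_ltn_trans km (leq_ltn_trans mi (ltn_ord i)); rewrite ltnn.
rewrite -(set_row_row A (Ordinal mk)); apply: set_row_basis => // c; apply: IH => i mi.
have [->|ne] := eqVneq i (Ordinal mk); first by exists c; rewrite row_set_row.
rewrite row_set_row_neq//; apply: HA.
by rewrite ltn_neqAle mi andbT; apply: contra_neq ne => e; apply: val_inj.
Qed.

Lemma alternate_swap w A i j : multilinear w -> alternate w -> i != j ->
  w (xrow i j A) = - w A.
Proof.
move=> mw aw ij; pose P u v := set_row (set_row A i u) j v.
have PE u v : w (P u v) = - w (P v u).
  have z u' : w (P u' u') = 0.
    apply: (aw _ i j ij); rewrite row_set_row row_set_row_neq// row_set_row//.
  have e : w (P (1 *: u + 1 *: v) (1 *: u + 1 *: v)) = w (P u v) + w (P v u).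
    rewrite /P set_row_lin// ![set_row (set_row A i (_ + _)) j _]set_rowC// !set_row_lin//.
    rewrite -![set_row (set_row A j _) i _]set_rowC// -!/(P _ _) !z !mul1r.
    by rewrite add0r addr0 addrC.
  by apply/eqP; rewrite -addr_eq0 -e z.
have -> : xrow i j A = P (row j A) (row i A).
  apply/matrixP => a b; rewrite !mxE; case: tpermP => [->|->|/eqP/negbTE ai /eqP/negbTE aj].
  - by rewrite (negbTE ij) eqxx.
  - by rewrite eqxx.
  - by rewrite ai aj.
by rewrite PE /P !set_row_row.
Qed.

Lemma alternate_perm w A s : multilinear w -> alternate w -> w A = 0 ->
  w (row_perm s A) = 0.
Proof.
move=> mw aw; have [ts -> _] := prod_tpermP s.
elim: ts A => [|[i j] ts IH] A wA; first by rewrite big_nil row_perm1.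
rewrite big_cons row_permM /=.
have [->|ij] := eqVneq i j; first by rewrite tperm1 row_perm1 IH.
by rewrite -[row_perm (tperm i j) _]/(xrow i j _) alternate_swap// IH// oppr0.
Qed.

(** Multilinearity reduces to frames; a frame with a repeated index is killed,
    and any other one is a permutation of an increasing frame. *)
Lemma altform_ext (u v : altform R n k) :
  (forall I, increasing I -> u (frame R I) = v (frame R I)) -> u = v.
Proof.
move=> H; apply/eqP; rewrite -subr_eq0; apply/eqP/altform_inj.
have /asboolP[mw aw] := altform_subproof (u - v).
apply: multilinear_frames => // I.
have [uI|/negP nI] := boolP (uniq I); last first.
  apply: contra_notP nI => nz; apply/tuple_uniqP => i1 i2 e.
  apply/eqP/negPn/negP => ne; apply: nz; apply: aw ne _.
  by apply/rowP => b; rewrite !mxE e.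
pose I' := [tuple of sort (relpre val leq) I].
have /tuple_permP[s sE] : perm_eq I I' by rewrite perm_sym perm_sort.
have -> : frame R I = row_perm s (frame R I').
  by apply/matrixP => a b; rewrite !mxE (val_inj sE) tnth_mktuple.
apply: alternate_perm => //.
suff iI' : increasing I' by rewrite -[LHS]/(u (frame R I') - v (frame R I')) H// subrr.
rewrite /increasing ltn_sorted_uniq_leq (map_inj_uniq val_inj) sort_uniq uI sorted_map.
by apply: sort_sorted => a b; exact: leq_total.
Qed.

End AlternatingFormBasis.

(** * Coefficients of forms and of currents *)

Section FormCoefficients.
Variables (R : realType) (n k : nat).
Local Notation E := 'rV[R]_n.
Local Notation C := R[i].
Local Notation form := (E -> altform R n k).
Local Notation S := (@schwartz R n).
Implicit Types (f g : E -> C) (I J : k.-tuple 'I_n) (w : form) (c : k.-tuple 'I_n -> E -> C).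

Lemma form_ext w w' : (forall I, increasing I -> coef w I = coef w' I) -> w = w'.
Proof.
by move=> H; apply/funext => x; apply: altform_ext => I iI; exact: (congr1 (@^~ x) (H I iI)).
Qed.

Definition form_of c : form := fun x =>
  \sum_(I : k.-tuple 'I_n | increasing I) c I x *: dx R I.

Lemma coef_form_of c I : increasing I -> coef (form_of c) I = c I.
Proof.
move=> iI; apply/funext => x.
transitivity (\sum_(J : k.-tuple 'I_n | increasing J) c J x * dx R J (frame R I)).
  exact: altform_sumE.
rewrite (bigD1 I iI) big1 => [|J /andP[iJ nJ]].
  by rewrite (dx_frame R iI iI) eqxx mulr1 /= addr0.
by rewrite (dx_frame R iJ iI) (negbTE nJ) mulr0.
Qed.

Let component_coef I f J : E -> C := if (f \in S) && (J == I) then f else 0.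

Fact component_subproof I f : form_of (component_coef I f) \in @schwartz_forms R n k.
Proof.
apply/asboolP => J iJ; rewrite coef_form_of// /component_coef.
by case: ifP => [/andP[]//|_]; exact: rpred0.
Qed.

(** The form f dx_I. The zero form is used when f is not a Schwartz function,
    so that [component] is a total function of f. *)
Definition component I f : schwartz_form R n k := SchwartzForm (component_subproof I f).

Lemma coef_component I f J : f \in S -> increasing J ->
  coef (component I f) J = if J == I then f else 0.
Proof. by move=> Sf iJ; rewrite coef_form_of// /component_coef Sf. Qed.

Lemma schwartz_form_ext (phi psi : schwartz_form R n k) :
  (forall I, increasing I -> coef phi I = coef psi I) -> phi = psi.
Proof. by move=> H; apply: schwartz_form_inj; exact: form_ext. Qed.

Lemma component_lin I a f g : f \in S -> g \in S ->
  component I (a *: f + g) = a *: component I f + component I g.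
Proof.
move=> Sf Sg; apply: schwartz_form_ext => J iJ; rewrite schwartz_coef_lin.
rewrite !coef_component ?rpredD ?rpredZ//.
by case: eqP => // _; rewrite scaler0 addr0.
Qed.

Lemma component_laplacian I f : f \in S ->
  component I (laplacian f) = schwartz_form_laplacian (component I f).
Proof.
move=> Sf; apply: schwartz_form_ext => J iJ.
rewrite [RHS]coef_laplacian// !coef_component ?schwartz_laplacian//.
case: eqP => // _; apply/esym; rewrite /laplacian big1 ?oppr0// => i _.
exact: (@partials0 R n [:: i; i]).
Qed.

Lemma coef_sum_schwartz (s : seq (k.-tuple 'I_n)) (P : pred _) (F : _ -> schwartz_form R n k) J :
  coef (\sum_(I <- s | P I) F I) J = \sum_(I <- s | P I) coef (F I) J.
Proof.
elim/big_rec2: _ => [//|I u phi _ <-].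
by rewrite -[F I]scale1r schwartz_coef_lin !scale1r.
Qed.

Lemma schwartz_form_components (phi : schwartz_form R n k) :
  phi = \sum_(I : k.-tuple 'I_n | increasing I) component I (coef phi I).
Proof.
apply: schwartz_form_ext => J iJ.
rewrite coef_sum_schwartz (bigD1 J)//= big1 => [|I /andP[iI IJ]].
  by rewrite coef_component ?schwartz_coef// eqxx addr0.
by rewrite coef_component ?schwartz_coef// eq_sym (negbTE IJ).
Qed.

End FormCoefficients.

Section CurrentCoefficients.
Variables (R : realType) (n k : nat).
Local Notation E := 'rV[R]_n.
Local Notation C := R[i].
Local Notation test_form := (schwartz_form R n k).
Local Notation S := (@schwartz R n).
Implicit Types (f g : E -> C) (I J : k.-tuple 'I_n) (T : current R n k) (phi : test_form).

Lemma current0 T : T 0 = 0.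
Proof.
have := current_linear T 1 0 0; rewrite !scale1r addr0 => /eqP.
by rewrite -subr_eq0 opprD addrA subrr sub0r oppr_eq0 => /eqP.
Qed.

Lemma current_sum T (s : seq (k.-tuple 'I_n)) (P : pred _) (F : _ -> test_form) :
  T (\sum_(I <- s | P I) F I) = \sum_(I <- s | P I) T (F I).
Proof.
elim/big_rec2: _ => [|I u phi _ <-]; first exact: current0.
by rewrite -[F I]scale1r current_linear !scale1r.
Qed.

Lemma current_components T phi :
  T phi = \sum_(I : k.-tuple 'I_n | increasing I) T (component I (coef phi I)).
Proof. by rewrite {1}[phi]schwartz_form_components current_sum. Qed.

(** Continuity at 0 gives a seminorm such that |T| < 1 on the forms of
    seminorm less than e; rescaling f gives the bound with constant 1 / e. *)
Lemma tempered_component T I : tempered (fun f => T (component I f)).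
Proof.
split=> [c f g Sf Sg|]; first by rewrite component_lin// current_linear.
have /(_ 0) /cvgrPdist_lt /(_ 1 ltr01) := @current_continuous R n k T.
rewrite current0 => -[[N e] /= e0 H].
exists N, e^-1; split; first by rewrite invr_ge0 ltW.
move=> f B Sf q; have B0 := qbound_ge0 q; rewrite leNgt; apply/negP => lt.
set y := nc _ in lt; have y0 : 0 < y.
  by apply: le_lt_trans lt; rewrite mulr_ge0// invr_ge0 ltW.
(* The rescaled function has |T| = 1, so its seminorm cannot be less than e.
   *)
pose t : C := (y^-1)%:C%C; have St : t *: f \in S by rewrite rpredZ.
have : `|T (component I (t *: f))| < 1.
  rewrite -normrN -[X in `|X|]add0r; apply: H => /=; rewrite subr0.
  move=> a b J x aN bN iJ; rewrite coef_component//.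
  case: eqP => _; last by rewrite partials0 mulr0 normr0 ltcR.
  have qt := qboundZ t (schwartz_smooth Sf) q.
  have pt := qbound_pbound qt.
  apply: (@le_lt_trans _ _ (nc t * B)%:C%C); first by rewrite rapidE; exact: pt.
  rewrite ltcR nc_real gtr0_norm ?invr_gt0// ltr_pdivrMl//.
  by move: lt; rewrite mulrC ltr_pdivrMr// mulrC.
rewrite -[t *: f]addr0 component_lin ?rpred0// current_linear.
have -> : T (component I 0) = 0.
  have -> : component I (0 : E -> C) = 0; last exact: current0.
  by apply: schwartz_form_ext => J iJ; rewrite coef_component ?rpred0// if_same.
rewrite addr0 normrM !ncE -/y -rmorphM -(rmorph1 (real_complex R)) ltcR.
by rewrite /t nc_real gtr0_norm ?invr_gt0// mulVf ?ltxx// gt_eqF.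
Qed.

(** By linearity, continuity at phi is a bound on L (psi - phi). *)
Lemma coefficient_current (L : (E -> C) -> C) J : tempered L -> increasing J ->
  (fun phi => L (coef phi J)) \in @currents R n k.
Proof.
move=> tL iJ; apply/asboolP; split=> [a phi psi|phi].
  by rewrite schwartz_coef_lin (tempered_lin tL) ?schwartz_coef.
have [N [K [K0 H]]] := tempered_bound tL.
have fphi : Filter (nbhs phi) by exact: nbhs_filter.
apply/(@cvgrPdist_lt C C^o _ _ fphi) => e e0.
have [d d0 eE] : exists2 d : R, 0 < d & e = d%:C%C.
  by case: e e0 => a b; rewrite ltcE/= => /andP[/eqP-> a0]; exists a.
pose r := d / (K * 2 ^+ N + 1).
have c0 : 0 < K * 2 ^+ N + 1 by rewrite ltr_wpDl// mulr_ge0// exprn_ge0.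
have r0 : 0 < r by rewrite divr_gt0.
exists (N, r) => //= psi /= Hpsi.
have Sphi := schwartz_coef phi iJ; have Spsi := schwartz_coef psi iJ.
rewrite distrC -(temperedB tL)// ncE eE ltcR.
have p : pbound N r (coef psi J - coef phi J).
  move=> a b x aN bN; rewrite -rapidE; apply/ltW.
  have := Hpsi a b J x aN bN iJ.
  have -> // : coef (psi - phi : test_form) J = coef psi J - coef phi J.
  by rewrite -scaleN1r addrC schwartz_coef_lin scaleN1r addrC.
have := H _ _ (rpredB Spsi Sphi) (pbound_qbound p).
move=> /le_lt_trans; apply.
rewrite mulrA /r mulrCA gtr_pMr//.
by rewrite ltr_pdivrMr// mul1r ltrDl.
Qed.

Lemma sum_current (L : k.-tuple 'I_n -> (E -> C) -> C) :
  (forall I, increasing I -> tempered (L I)) ->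
  (fun phi => \sum_(I : k.-tuple 'I_n | increasing I) L I (coef phi I)) \in @currents R n k.
Proof.
move=> tL.
have -> : (fun phi : test_form => \sum_(I : k.-tuple 'I_n | increasing I) L I (coef phi I)) =
    \sum_(I : k.-tuple 'I_n | increasing I) (fun phi => L I (coef phi I)).
  by apply/funext => phi; rewrite fct_sumE.
by apply: rpred_sum => I iI; apply: coefficient_current => //; exact: tL.
Qed.

End CurrentCoefficients.

(** * Harmonic forms as currents *)

Section HarmonicInclusion.
Variables (R : realType) (n k : nat).
Local Notation E := 'rV[R]_n.
Local Notation C := R[i].
Local Notation test_form := (schwartz_form R n k).
Local Notation S := (@schwartz R n).
Local Notation pf := (@polynomial_fun R n).
Implicit Types (f g : E -> C) (I J : k.-tuple 'I_n) (T : current R n k) (phi : test_form)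
  (w : harmonic_form R n k).

Lemma tempered_harmonic w I : increasing I ->
  tempered (fun f => cintegral (coef w I * f)).
Proof.
move=> iI; have /asboolP/(_ I iI)[p _ ->] := harmonic_form_subproof w.
exact: tempered_polynomial.
Qed.

Lemma schwartz_harmonic w I f : increasing I -> f \in S -> coef w I * f \in S.
Proof.
move=> iI Sf; have /asboolP/(_ I iI)[p _ ->] := harmonic_form_subproof w.
exact: schwartz_polynomial.
Qed.

Lemma pairingE w phi : pairing w phi =
  \sum_(I : k.-tuple 'I_n | increasing I) cintegral (coef w I * coef phi I).
Proof.
have tI := tempered_cintegral R n.
rewrite -(tempered_sum _ tI) => [|I iI]; last by rewrite schwartz_harmonic ?schwartz_coef.
by congr cintegral; apply/funext => x; rewrite fct_sumE.
Qed.

Lemma pairing_currents w : (fun phi => pairing w phi) \in @currents R n k.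
Proof.
have -> : (fun phi : test_form => pairing w phi) = fun phi =>
    \sum_(I : k.-tuple 'I_n | increasing I) cintegral (coef w I * coef phi I).
  by apply/funext => phi; exact: pairingE.
apply: (@sum_current _ _ _ (fun I f => cintegral (coef w I * f))) => I.
exact: tempered_harmonic.
Qed.

Definition harmonic_current w : current R n k := Current (pairing_currents w).

Fact harmonic_current_linear : linear harmonic_current.
Proof.
move=> a w w'; apply: current_inj; apply/funext => phi.
transitivity (a * pairing w phi + pairing w' phi) => //.
rewrite [LHS]pairingE !pairingE mulr_sumr -big_split; apply: eq_bigr => I iI.
have tI := tempered_cintegral R n.
have Sp := schwartz_coef phi iI.
rewrite -[RHS]/(a * cintegral _ + cintegral _).
rewrite -(tempered_lin tI) ?schwartz_harmonic//; congr cintegral.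
have -> : coef (a *: w + w' : harmonic_form R n k) I = a *: coef w I + coef w' I.
  exact: coef_lin.
apply/funext => x; rewrite -[LHS]/((a * coef w I x + coef w' I x) * coef phi I x).
rewrite -[RHS]/(a * (coef w I x * coef phi I x) + coef w' I x * coef phi I x).
by rewrite mulrDl mulrA.
Qed.

HB.instance Definition _ := GRing.isLinear.Build C (harmonic_form R n k) (current R n k) _
  harmonic_current harmonic_current_linear.

Lemma pairing_component w I f : increasing I -> f \in S ->
  pairing w (component I f) = cintegral (coef w I * f).
Proof.
move=> iI Sf; rewrite pairingE (bigD1 I)//= big1 => [|J /andP[iJ JI]].
  by rewrite addr0 coef_component// eqxx.
rewrite coef_component// (negbTE JI) mulr0.
exact: tempered_at0 (tempered_cintegral R n).
Qed.

Lemma harmonic_current_inj : injective harmonic_current.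
Proof.
move=> w w' e; apply: harmonic_form_inj; apply: form_ext => I iI.
have H f : f \in S -> cintegral (coef w I * f) = cintegral (coef w' I * f).
  by move=> Sf; rewrite -!pairing_component//; exact: (congr1 (fun T : current R n k => T _) e).
have /asboolP/(_ I iI)[p _ pE] := harmonic_form_subproof w.
have /asboolP/(_ I iI)[q _ qE] := harmonic_form_subproof w'.
move: H; rewrite pE qE => H; suff /eqP : p - q = 0 by rewrite subr_eq0 => /eqP->.
apply: cintegral_polynomial_inj => f Sf.
rewrite polynomial_funD polynomial_funN mulrBl (temperedB (tempered_cintegral R n)).
- by rewrite H// subrr.
- exact: schwartz_polynomial.
- exact: schwartz_polynomial.
Qed.

(** Coefficient by coefficient, from [laplacian_distribution_ker] in one
    direction and from integration by parts in the other. *)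
Lemma range_harmonic_current :
  range harmonic_current = [set T : current R n k | current_laplacian T = 0].
Proof.
apply/seteqP; split=> [_ [w _ <-]|T T0] /=.
  apply: current_inj; apply/funext => phi.
  rewrite -[LHS]/(pairing w (schwartz_form_laplacian phi)) pairingE big1// => I iI.
  have /asboolP/(_ I iI)[p p0 ->] := harmonic_form_subproof w.
  rewrite [coef _ _]coef_laplacian// cintegral_polynomial_laplacian ?schwartz_coef//.
  rewrite p0 polynomial_fun0 mul0r; exact: tempered_at0 (tempered_cintegral R n).
have ex I : exists p, increasing I -> polynomial_laplacian p = 0 /\
    forall f, f \in S -> T (component I f) = cintegral (pf p * f).
  have [|p p0 pE] := laplacian_distribution_ker (tempered_component T I); last by exists p.
  move=> f Sf; rewrite component_laplacian//.
  exact: (congr1 (fun U : current R n k => U (component I f)) T0).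
have /choice[p pP] := ex.
pose w := form_of (fun I => pf (p I)).
have hw : w \in @harmonic_forms R n k.
  apply/asboolP => I iI; rewrite coef_form_of//.
  by exists (p I) => //; have [] := pP I iI.
exists (HarmonicForm hw) => //; apply: current_inj; apply/funext => phi.
rewrite -[LHS]/(pairing (HarmonicForm hw) phi) pairingE current_components.
apply: eq_bigr => I iI; have [_ ->] := pP I iI; last exact: schwartz_coef.
by rewrite [coef (HarmonicForm hw) I]coef_form_of.
Qed.

Lemma range_current_laplacian : (0 < n)%N -> range (@current_laplacian R n k) = setT.
Proof.
move=> n0; apply/seteqP; split=> // T _.
have /choice[U UP] : forall I : k.-tuple 'I_n, exists U, tempered U /\
    forall f, f \in S -> U (laplacian f) = T (component I f).
  by move=> I; apply: laplacian_distribution_surj => //; exact: tempered_component.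
have cU : (fun phi : test_form =>
    \sum_(I : k.-tuple 'I_n | increasing I) U I (coef phi I)) \in @currents R n k.
  by apply: sum_current => I _; have [] := UP I.
exists (Current cU) => //; apply: current_inj; apply/funext => phi.
rewrite [RHS]current_components; apply: eq_bigr => I iI.
have [_ UE] := UP I.
by rewrite [coef _ _]coef_laplacian// UE// schwartz_coef.
Qed.

End HarmonicInclusion.

Theorem theorem1p1 (R : realType) (n k : nat)
    (n_ge1 : (1 <= n)%N) (k_le_n : (k <= n)%N) :
  exists j : {linear harmonic_form R n k -> current R n k},
    [/\ is_inclusion j,
        injective j,
        range j = [set T : current R n k | current_laplacian T = 0] &
        range (@current_laplacian R n k) = setT].
Proof.
exists (@harmonic_current R n k); split=> //.
- exact: harmonic_current_inj.
- exact: range_harmonic_current.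
- exact: range_current_laplacian.
Qed.
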